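(* Let $\Lambda$ be a finitely aligned $k$-graph. Then $C^*(\Lambda)$ is AF if and only if all of the corners $s_vC^*(\Lambda)s_v$, $v\in\Lambda^0$, are AF.
   Context: Let $\mathbb N=\{0,1,2,\dots\}$ and $k\ge 1$; order $\mathbb N^k$ coordinatewise, with $m\vee n$ the coordinatewise maximum. A $k$-graph is a countable small category $\Lambda$ with a functor $d:\Lambda\to\mathbb N^k$ (the degree) satisfying the factorisation property: if $d(\lambda)=m+n$ then there are unique $\mu,\nu\in\Lambda$ with $d(\mu)=m$, $d(\nu)=n$, $\lambda=\mu\nu$. Put $\Lambda^n=d^{-1}(n)$. Elements of $\Lambda^0$ are the identity morphisms, identified with the objects and called vertices; $r,s:\Lambda\to\Lambda^0$ are the codomain and domain maps, so $\mu\nu$ is defined when $s(\mu)=r(\nu)$. For $v\in\Lambda^0$, $v\Lambda=\{\lambda\in\Lambda: r(\lambda)=v\}$. For $\mu,\nu\in\Lambda$, $\mathrm{MCE}(\mu,\nu)$ is the set of $\lambda\in\Lambda$ with $d(\lambda)=d(\mu)\vee d(\nu)$ and $\lambda=\mu\mu'=\nu\nu'$ for some $\mu',\nu'\in\Lambda$. $\Lambda$ is finitely aligned if $\mathrm{MCE}(\mu,\nu)$ is finite (possibly empty) for all $\mu,\nu$. A set $F\subseteq v\Lambda$ is exhaustive if for every $\lambda\in v\Lambda$ there is $\mu\in F$ with $\mathrm{MCE}(\lambda,\mu)\ne\emptyset$. For finitely aligned $\Lambda$, $C^*(\Lambda)$ is the universal $C^*$-algebra generated by a Cuntz–Krieger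 $\Lambda$-family $\{s_\lambda:\lambda\in\Lambda\}$, i.e. elements such that (CK1) the $s_v$, $v\in\Lambda^0$, are mutually orthogonal projections; (CK2) $s_\mu s_\nu=s_{\mu\nu}$ when $s(\mu)=r(\nu)$; (CK3) $s_\mu^*s_\nu=\sum_{\mu\alpha=\nu\beta\in\mathrm{MCE}(\mu,\nu)}s_\alpha s_\beta^*$ for all $\mu,\nu$; (CK4) $\prod_{\lambda\in E}(s_v-s_\lambda s_\lambda^* )=0$ for all $v\in\Lambda^0$ and finite exhaustive $E\subseteq v\Lambda$. *)

(* Defs.v *)
From HB Require Import structures.
From mathcomp Require Import all_boot all_order all_algebra.
From mathcomp Require Export complex.
From mathcomp Require Import all_classical all_reals all_analysis.

Set Implicit Arguments.
Unset Strict Implicit.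
Unset Printing Implicit Defensive.

Import Order.TTheory GRing.Theory Num.Theory.
Import numFieldNormedType.Exports.

Local Open Scope classical_set_scope.
Local Open Scope ring_scope.

Reserved Notation "x ** y" (at level 40, left associativity).

(* C*-algebras need not have a unit, so the product is a field of its own
   rather than the multiplication of a ring structure. The norm of a normed
   module over [R[i]] takes its values in the nonnegative reals of [R[i]]. *)
HB.mixin Record isCstarAlgebra (R : realType) A of
    CompleteNormedModule R[i] A := {
  cmul : A -> A -> A ;
  star : A -> A ;
  cmulA : forall x y z, cmul x (cmul y z) = cmul (cmul x y) z ;
  cmulDl : forall x y z, cmul (x + y) z = cmul x z + cmul y z ;
  cmulDr : forall x y z, cmul x (y + z) = cmul x y + cmul x z ;
  cscaleAl : forall (a : R[i]) x y, a *: cmul x y = cmul (a *: x) y ;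
  cscaleAr : forall (a : R[i]) x y, a *: cmul x y = cmul x (a *: y) ;
  starK : forall x, star (star x) = x ;
  starD : forall x y, star (x + y) = star x + star y ;
  starZ : forall (a : R[i]) x, star (a *: x) = Num.conj a *: star x ;
  starM : forall x y, star (cmul x y) = cmul (star y) (star x) ;
  norm_cmul : forall x y, `|cmul x y| <= `|x| * `|y| ;
  norm_star_cmul : forall x, `|cmul (star x) x| = `|x| ^+ 2
}.

#[short(type="cstarAlgType")]
HB.structure Definition CstarAlgebra (R : realType) :=
  {A of CompleteNormedModule R[i] A & isCstarAlgebra R A}.

Notation "x ** y" := (cmul x y) : ring_scope.

Section CstarAlgebras.
Variable R : realType.
Implicit Types A B : cstarAlgType R.

Record star_hom A B (f : A -> B) : Prop := StarHom {
  star_homD : forall x y, f (x + y) = f x + f y ;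
  star_homZ : forall (a : R[i]) x, f (a *: x) = a *: f x ;
  star_homM : forall x y, f (x ** y) = f x ** f y ;
  star_hom_star : forall x, f (star x) = star (f x)
}.

Record cstar_subalgebra A (F : set A) : Prop := CstarSubalgebra {
  cstar_subalgebra0 : F 0 ;
  cstar_subalgebraD : forall x y, F x -> F y -> F (x + y) ;
  cstar_subalgebraZ : forall (a : R[i]) x, F x -> F (a *: x) ;
  cstar_subalgebraM : forall x y, F x -> F y -> F (x ** y) ;
  cstar_subalgebra_star : forall x, F x -> F (star x) ;
  cstar_subalgebra_closed : closed F
}.

Definition finite_dimensional A (F : set A) : Prop :=
  exists (n : nat) (e : 'I_n -> A),
    F = [set \sum_(i < n) c i *: e i | c in [set: 'I_n -> R[i]]].

(* To be used for a C*-subalgebra [B] of [A] (in particular [B = setT]): the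
   C*-subalgebras of [B] are the C*-subalgebras of [A] contained in [B], and,
   [B] being closed, closures in [B] are closures in [A]. *)
Definition AF A (B : set A) : Prop :=
  exists F : nat -> set A,
    [/\ forall n, cstar_subalgebra (F n) /\ finite_dimensional (F n),
        forall n, F n `<=` F n.+1 &
        closure (\bigcup_n F n) = B].

Definition corner A (p : A) : set A := [set p ** a ** p | a in [set: A]].

End CstarAlgebras.

(* Morphisms form a [countType]; [comp mu nu] stands for the composite
   [mu nu] and is only meaningful when [src mu = rng nu]. *)
Record kgraph (k : nat) := KGraph {
  vert : countType ;
  mor :> countType ;
  rng : mor -> vert ;
  src : mor -> vert ;
  idm : vert -> mor ;
  comp : mor -> mor -> mor ;
  deg : mor -> {ffun 'I_k -> nat} ;
  rng_idm : forall v, rng (idm v) = v ;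
  src_idm : forall v, src (idm v) = v ;
  rng_comp : forall mu nu, src mu = rng nu -> rng (comp mu nu) = rng mu ;
  src_comp : forall mu nu, src mu = rng nu -> src (comp mu nu) = src nu ;
  compA : forall la mu nu, src la = rng mu -> src mu = rng nu ->
    comp la (comp mu nu) = comp (comp la mu) nu ;
  comp_idl : forall la, comp (idm (rng la)) la = la ;
  comp_idr : forall la, comp la (idm (src la)) = la ;
  deg_idm : forall v, deg (idm v) = 0 ;
  deg_comp : forall mu nu, src mu = rng nu ->
    deg (comp mu nu) = deg mu + deg nu ;
  factorisation : forall la (m n : {ffun 'I_k -> nat}), deg la = m + n ->
    exists! p : mor * mor,
      [/\ deg p.1 = m, deg p.2 = n, src p.1 = rng p.2 & la = comp p.1 p.2]
}.

Section KGraphs.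
Variables (k : nat) (L : kgraph k).
Implicit Types (mu nu la : L) (v : vert L).

Definition deg_join (m n : {ffun 'I_k -> nat}) : {ffun 'I_k -> nat} :=
  [ffun i => maxn (m i) (n i)].

(* The pairs [(al, be)] such that [mu al = nu be] belongs to MCE(mu, nu). *)
Definition MCE_pairs mu nu : set (L * L) :=
  [set p | [/\ src mu = rng p.1, src nu = rng p.2,
               comp mu p.1 = comp nu p.2 &
               deg (comp mu p.1) = deg_join (deg mu) (deg nu)]].

Definition MCE mu nu : set L :=
  [set la | deg la = deg_join (deg mu) (deg nu) /\
     exists mu' nu', [/\ src mu = rng mu', src nu = rng nu',
                         la = comp mu mu' & la = comp nu nu']].

Definition finitely_aligned : Prop := forall mu nu, finite_set (MCE mu nu).

Definition exhaustive v (F : set L) : Prop :=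
  (forall mu, F mu -> rng mu = v) /\
  (forall la, rng la = v -> exists2 mu, F mu & MCE la mu !=set0).

Section CuntzKrieger.
Variable R : realType.

(* (CK3) is meant for finitely aligned [L], when [MCE_pairs mu nu] is finite.
   In (CK4) finite sets are represented by duplicate-free lists. The default
   value [t (idm v)] of the iterated product is a unit for its factors, since
   [s_v s_la = s_la] for [la] in [v L]; an exhaustive set is never empty, so
   this does not affect the product. *)
Record CK_family (A : cstarAlgType R) (t : L -> A) : Prop := CKFamily {
  CK1_star : forall v, star (t (idm v)) = t (idm v) ;
  CK1_idem : forall v, t (idm v) ** t (idm v) = t (idm v) ;
  CK1_orth : forall v w, v <> w -> t (idm v) ** t (idm w) = 0 ;
  CK2 : forall mu nu, src mu = rng nu -> t mu ** t nu = t (comp mu nu) ;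
  CK3 : forall mu nu, star (t mu) ** t nu =
    \sum_(p \in MCE_pairs mu nu) (t p.1 ** star (t p.2)) ;
  CK4 : forall v (E : seq L), uniq E -> exhaustive v [set` E] ->
    \big[@cmul R A / t (idm v)]_(la <- E)
      (t (idm v) - t la ** star (t la)) = 0
}.

(* [A] together with [t] is (a copy of) the universal C*-algebra C*(L). The
   homomorphism [f] is unique, as [t] generates [A]. *)
Record universal_CK_family (A : cstarAlgType R) (t : L -> A) : Prop :=
  UniversalCKFamily {
  universal_CK : CK_family t ;
  universal_CK_generates : forall B : set A,
    cstar_subalgebra B -> (forall la, B (t la)) -> B = [set: A] ;
  universal_CK_hom : forall (B : cstarAlgType R) (u : L -> B), CK_family u ->
    exists2 f : A -> B, star_hom f & forall la, f (t la) = u la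
}.

End CuntzKrieger.
End KGraphs.

(* Main.v *)
(* If a projection [p] lies in an AF algebra [A], it is equivalent, through a
   partial isometry [w] close to [p], to a projection [q] of some
   finite-dimensional member [F_n]; conjugation by [w] carries the algebras
   [q F_m q] onto an approximating sequence of [p A p].

   Conversely, C*(L) is the union of the corners of the projections [sum s_v]
   over finite sets of vertices, so it suffices to add one vertex projection [p]
   to a projection [f] whose corner is approximable. The commuting range
   projections of the elements [s_mu s_nu^*] in [f A p] have suprema [r_m], and
   [(r_m + p) A (r_m + p)] is approximable because [r_m] is a sum of projections
   equivalent to subprojections of [p]. A
   finite-dimensional [D] in [f A f] containing [r_m] and a finite-dimensional
   [E] in [(r_m + p) A (r_m + p)] containing [r_m D r_m] generate the
   finite-dimensional algebra [D + E + D E + E D + D E D]; this replaces the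
   theorem that extensions of AF algebras are AF. The containment of [r_m D r_m]
   in [E] is arranged by Bratteli's perturbation of matrix units. *)
Require Import Defs.
From mathcomp Require Import all_boot all_order all_algebra.
From mathcomp Require Import all_classical all_reals all_analysis.
From mathcomp Require Import lra.

Set Implicit Arguments.
Unset Strict Implicit.
Unset Printing Implicit Defensive.

Import Order.TTheory GRing.Theory Num.Theory.
Import numFieldNormedType.Exports.

Local Open Scope classical_set_scope.
Local Open Scope ring_scope.

(** * Real-valued norm and completeness *)

Section Norm.
Variables (R : realType) (A : cstarAlgType R).
Implicit Types x y z : A.

(** Functional calculus enters only as Newton-type iterations run inside a closed subalgebra, with
    explicit norm bounds; constants such as 17 and 43 add up the distances covered by these
    iterations. The obstacle that shapes the proof is that the suprema r_m need not converge in A: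
    r_m is only known to fix the elements f u_j p with j < m, so the projection, D and E all have to
    vary with m. Approximation is therefore measured along sequences of algebras that need not be
    nested ([liminf_algebra]). Each member can then be perturbed on its own, as long as the relative
    error at stage m is at most 2^-m, and nestedness is restored once, at the very end, by absorbing
    each algebra into a later one. Absorbing D into E means finding a unitary U close to the unit
    with U D [star U] inside E. Only the matrix units of D have to be approximated in E, to a
    tolerance that depends on D and not on E, so a sufficiently late E always qualifies. *)

Definition nrm x : R := complex.Re `|x|.
Definition cabs (a : R[i]) : R := complex.Re `|a|.

Lemma normE x : `|x| = (nrm x)%:C%C.
Proof. by rewrite /nrm RRe_real // ger0_real. Qed.

Lemma cabsE a : `|a| = (cabs a)%:C%C.
Proof. by rewrite /cabs RRe_real // ger0_real. Qed.

Lemma nrm_ge0 x : 0 <= nrm x.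
Proof. by rewrite -ler0c -normE. Qed.

Lemma cabs_ge0 a : 0 <= cabs a.
Proof. by rewrite -ler0c -cabsE. Qed.

Lemma nrm0 : nrm 0 = 0.
Proof. by rewrite /nrm normr0. Qed.

Lemma nrm_eq0 x : nrm x = 0 -> x = 0.
Proof. by move=> x0; apply/normr0_eq0; rewrite normE x0. Qed.

Lemma nrmN x : nrm (- x) = nrm x.
Proof. by rewrite /nrm normrN. Qed.

Lemma nrmBC x y : nrm (x - y) = nrm (y - x).
Proof. by rewrite -nrmN opprB. Qed.

Lemma nrmD x y : nrm (x + y) <= nrm x + nrm y.
Proof. by rewrite -lecR rmorphD /= -!normE ler_normD. Qed.

Lemma nrmB x y : nrm (x - y) <= nrm x + nrm y.
Proof. by rewrite -(nrmN y) nrmD. Qed.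

Lemma nrm_triangle y x z : nrm (x - z) <= nrm (x - y) + nrm (y - z).
Proof. by rewrite (le_trans _ (nrmD _ _))// addrA subrK. Qed.

Lemma nrmZ a x : nrm (a *: x) = cabs a * nrm x.
Proof. by apply: complexI; rewrite rmorphM /= -!normE -cabsE normrZ. Qed.

Lemma nrmM x y : nrm (x ** y) <= nrm x * nrm y.
Proof. by rewrite -lecR rmorphM /= -!normE norm_cmul. Qed.

Lemma nrm_star_cmul x : nrm (star x ** x) = nrm x ^+ 2.
Proof. by apply: complexI; rewrite rmorphXn /= -!normE norm_star_cmul. Qed.

Lemma nrm_star x : nrm (star x) = nrm x.
Proof.
suff le y : nrm y <= nrm (star y) by apply/eqP; rewrite eq_le -{2}(starK x) !le.
have := nrmM (star y) y; rewrite nrm_star_cmul expr2.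
have [-> _|y0] := eqVneq (nrm y) 0; first exact: nrm_ge0.
by rewrite ler_pM2r // lt_def y0 nrm_ge0.
Qed.

Lemma nrm_sum (I : Type) (r : seq I) (F : I -> A) :
  nrm (\sum_(i <- r) F i) <= \sum_(i <- r) nrm (F i).
Proof.
elim/big_rec2: _ => [|i u v _ uv]; first by rewrite nrm0.
by rewrite (le_trans (nrmD _ _))// lerD2l.
Qed.

Lemma nrm_small_eq0 x : (forall e : R, 0 < e -> nrm x < e) -> x = 0.
Proof.
move=> xe; apply: nrm_eq0; apply/eqP; rewrite eq_le nrm_ge0 andbT leNgt.
by apply/negP => /xe; rewrite ltxx.
Qed.

Lemma ball_nrm (e : R) x y : (`|x - y| < e%:C%C) = (nrm (x - y) < e).
Proof. by rewrite normE ltcR. Qed.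

Lemma posc_realE (e : R[i]) : 0 < e -> exists2 d : R, 0 < d & e = d%:C%C.
Proof.
move=> e0; exists (complex.Re e); last by rewrite RRe_real // gtr0_real.
by rewrite -(ltcR 0) RRe_real // gtr0_real.
Qed.

Lemma closureP (S : set A) x :
  closure S x <-> forall e : R, 0 < e -> exists2 y, S y & nrm (x - y) < e.
Proof.
split=> [clx e e0|h B /nbhs_normP[d d0 dB]].
  have [|y [Sy]] := clx (ball x e%:C%C); first by apply: nbhsx_ballx; rewrite ltcR.
  by rewrite -ball_normE /= ball_nrm => xy; exists y.
have [e e0 ed] := posc_realE d0.
have [y Sy xy] := h _ e0; exists y; split=> //.
by apply: dB; rewrite /= ed ball_nrm.
Qed.

Lemma closedP (S : set A) :
  (forall x, (forall e : R, 0 < e -> exists2 y, S y & nrm (x - y) < e) -> S x) ->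
  closed S.
Proof. by move=> h x /closureP; exact: h. Qed.

Lemma closed_approx (S : set A) x : closed S ->
  (forall e : R, 0 < e -> exists2 y, S y & nrm (x - y) < e) -> S x.
Proof. by move=> cS h; apply: cS; apply/closureP. Qed.

Definition tends (u : nat -> A) l :=
  forall e : R, 0 < e -> exists N, forall n, (N <= n)%N -> nrm (u n - l) < e.

Lemma nrm_complete (u : nat -> A) :
  (forall e : R, 0 < e -> exists N, forall n m, (N <= n)%N -> (N <= m)%N ->
    nrm (u n - u m) < e) -> exists l, tends u l.
Proof.
move=> cu.
have /cauchy_cvg/cvg_ex[l ul] : cauchy (u @ \oo).
  apply: cauchy_exP => d /posc_realE[e e0 ->].
  have [N uN] := cu _ e0; exists (u N).
  exists N => // n /= Nn; rewrite -ball_normE /= ball_nrm.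
  exact: uN.
exists l => e e0.
have /cvgrPdist_lt/(_ e%:C%C) := ul; rewrite ltcR => /(_ e0)[N _ uN].
by exists N => n /uN /=; rewrite ball_nrm nrmBC.
Qed.

End Norm.

Lemma real_complete (R : realType) (u : nat -> R) :
  (forall e : R, 0 < e -> exists N, forall n m, (N <= n)%N -> (N <= m)%N ->
    `|u n - u m| < e) ->
  exists l, forall e : R, 0 < e -> exists N, forall n, (N <= n)%N -> `|u n - l| < e.
Proof.
move=> cu.
have /cauchy_cvg/cvg_ex[l ul] : cauchy (u @ \oo).
  apply: cauchy_exP => e e0.
  have [N uN] := cu _ e0; exists (u N); exists N => // n /= Nn.
  by rewrite -ball_normE; exact: uN.
exists l => e e0.
have /cvgrPdist_lt/(_ e e0)[N _ uN] := ul.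
by exists N => n /uN /=; rewrite distrC.
Qed.

Lemma cabs_ReIm (R : realType) (a : R[i]) :
  [/\ `|complex.Re a| <= cabs a, `|complex.Im a| <= cabs a &
      cabs a <= `|complex.Re a| + `|complex.Im a|].
Proof.
have -> : cabs a = Num.sqrt (complex.Re a ^+ 2 + complex.Im a ^+ 2).
  by rewrite /cabs normc_def.
split.
- by rewrite -sqrtr_sqr ler_wsqrtr // lerDl sqr_ge0.
- by rewrite -(sqrtr_sqr (complex.Im a)) ler_wsqrtr // lerDr sqr_ge0.
rewrite -[leRHS]ger0_norm; last by rewrite addr_ge0.
rewrite -sqrtr_sqr ler_wsqrtr // sqrrD !real_normK ?num_real //.
by rewrite lerD2r lerDl mulrn_wge0 // mulr_ge0.
Qed.

Lemma complex_complete (R : realType) (u : nat -> R[i]) :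
  (forall e : R, 0 < e -> exists N, forall n m, (N <= n)%N -> (N <= m)%N ->
    cabs (u n - u m) < e) ->
  exists l, forall e : R, 0 < e -> exists N, forall n, (N <= n)%N -> cabs (u n - l) < e.
Proof.
move=> cu.
have [a ra] : exists a, forall e : R, 0 < e ->
    exists N, forall n, (N <= n)%N -> `|complex.Re (u n) - a| < e.
  apply: real_complete => e /cu[N uN]; exists N => n m Nn Nm.
  have [+ _ _] := cabs_ReIm (u n - u m).
  by rewrite raddfB /= => /le_lt_trans; apply; exact: uN.
have [b rb] : exists a, forall e : R, 0 < e ->
    exists N, forall n, (N <= n)%N -> `|complex.Im (u n) - a| < e.
  apply: real_complete => e /cu[N uN]; exists N => n m Nn Nm.
  have [_ + _] := cabs_ReIm (u n - u m).
  by rewrite raddfB /= => /le_lt_trans; apply; exact: uN.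
exists (a +i* b)%C => e e0.
have e2 : 0 < e / 2 by rewrite divr_gt0.
have [N1 h1] := ra _ e2; have [N2 h2] := rb _ e2.
exists (maxn N1 N2) => n; rewrite geq_max => /andP[/h1 + /h2].
have [_ _] := cabs_ReIm (u n - (a +i* b)%C).
by rewrite !raddfB /=; lra.
Qed.

(** * Algebra without a unit *)

Section Algebra.
Variables (R : realType) (A : cstarAlgType R).
Implicit Types x y z p q : A.

Lemma cmul0x x : 0 ** x = 0.
Proof. by apply: (addrI (0 ** x)); rewrite -cmulDl !addr0. Qed.

Lemma cmulx0 x : x ** 0 = 0.
Proof. by apply: (addrI (x ** 0)); rewrite -cmulDr !addr0. Qed.

Lemma cmulNl x y : (- x) ** y = - (x ** y).
Proof. by apply/eqP; rewrite -addr_eq0 -cmulDl addNr cmul0x. Qed.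

Lemma cmulNr x y : x ** (- y) = - (x ** y).
Proof. by apply/eqP; rewrite -addr_eq0 -cmulDr addNr cmulx0. Qed.

Lemma cmulBl x y z : (x - y) ** z = x ** z - y ** z.
Proof. by rewrite cmulDl cmulNl. Qed.

Lemma cmulBr x y z : z ** (x - y) = z ** x - z ** y.
Proof. by rewrite cmulDr cmulNr. Qed.

Lemma cmulZl (a : R[i]) x y : (a *: x) ** y = a *: (x ** y).
Proof. by rewrite cscaleAl. Qed.

Lemma cmulZr (a : R[i]) x y : x ** (a *: y) = a *: (x ** y).
Proof. by rewrite cscaleAr. Qed.

Lemma star0 : star (0 : A) = 0.
Proof. by apply: (addrI (star 0)); rewrite -starD !addr0. Qed.

Lemma starN x : star (- x) = - star x.
Proof. by apply/eqP; rewrite -addr_eq0 -starD addNr star0. Qed.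

Lemma starB x y : star (x - y) = star x - star y.
Proof. by rewrite starD starN. Qed.

Lemma cmul_suml (I : Type) (r : seq I) (P : pred I) (F : I -> A) y :
  (\sum_(i <- r | P i) F i) ** y = \sum_(i <- r | P i) F i ** y.
Proof. by apply: (big_morph (fun x => x ** y)) => [u v|]; rewrite ?cmulDl ?cmul0x. Qed.

Lemma cmul_sumr (I : Type) (r : seq I) (P : pred I) (F : I -> A) y :
  y ** (\sum_(i <- r | P i) F i) = \sum_(i <- r | P i) y ** F i.
Proof. by apply: (big_morph (fun x => y ** x)) => [u v|]; rewrite ?cmulDr ?cmulx0. Qed.

Lemma star_sum (I : Type) (r : seq I) (P : pred I) (F : I -> A) :
  star (\sum_(i <- r | P i) F i) = \sum_(i <- r | P i) star (F i).
Proof. exact: (big_morph star (@starD _ _) star0). Qed.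

Lemma star_cmul_eq0 x : star x ** x = 0 -> x = 0.
Proof.
move=> xx; apply: nrm_eq0; apply/eqP.
by rewrite -sqrf_eq0 -nrm_star_cmul xx nrm0.
Qed.

Definition projection p := star p = p /\ p ** p = p.

Lemma nrm_proj p : projection p -> nrm p <= 1.
Proof.
move=> [sp pp]; rewrite leNgt; apply/negP => p1.
have := nrm_star_cmul p; rewrite sp pp expr2 => /eqP.
by rewrite -subr_eq0 -{1}(mulr1 (nrm p)) -mulrBr mulf_eq0 subr_eq0 => /orP[] /eqP; lra.
Qed.

Lemma proj0 : projection 0. Proof. by split; rewrite ?star0 ?cmulx0. Qed.

Lemma starM_self x : star (star x ** x) = star x ** x.
Proof. by rewrite starM starK. Qed.

End Algebra.

(* A decision procedure for identities of nonunital rings: an expression is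
   expanded into a list of signed nonempty words, and opposite words cancel. *)
Module NonunitalRing.

Inductive term := Var of nat | Zero | Add of term & term | Opp of term
  | Mul of term & term.

Definition word := (bool * (nat * seq nat))%type.

Definition wordM (u v : word) : word :=
  (u.1 (+) v.1, (u.2.1, u.2.2 ++ v.2.1 :: v.2.2)).

Fixpoint expand (t : term) : seq word :=
  match t with
  | Var n => [:: (false, (n, [::]))]
  | Zero => [::]
  | Add t1 t2 => expand t1 ++ expand t2
  | Opp t1 => [seq (~~ u.1, u.2) | u <- expand t1]
  | Mul t1 t2 => [seq wordM u v | u <- expand t1, v <- expand t2]
  end.

Definition insert (u : word) (s : seq word) : seq word :=
  if (~~ u.1, u.2) \in s then rem (~~ u.1, u.2) s else u :: s.

Section Interpretation.
Variables (R : realType) (A : cstarAlgType R) (env : seq A).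

Fixpoint eval (t : term) : A :=
  match t with
  | Var n => env`_n
  | Zero => 0
  | Add t1 t2 => eval t1 + eval t2
  | Opp t1 => - eval t1
  | Mul t1 t2 => eval t1 ** eval t2
  end.

Definition evalw (u : word) : A :=
  let x := foldl (fun x n => x ** env`_n) env`_(u.2.1) u.2.2 in
  if u.1 then - x else x.

Lemma evalwN u : evalw (~~ u.1, u.2) = - evalw u.
Proof. by case: u => -[] w; rewrite /evalw /= ?opprK. Qed.

Lemma evalwM u v : evalw (wordM u v) = evalw u ** evalw v.
Proof.
suff h : foldl (fun x n => x ** env`_n) env`_(u.2.1) (u.2.2 ++ v.2.1 :: v.2.2) =
    foldl (fun x n => x ** env`_n) env`_(u.2.1) u.2.2 **
    foldl (fun x n => x ** env`_n) env`_(v.2.1) v.2.2.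
  by rewrite /evalw /= h; case: u.1; case: v.1;
    rewrite /= ?cmulNl ?cmulNr ?opprK.
rewrite foldl_cat /=; move: (foldl _ _ u.2.2) => x.
by elim/last_ind: v.2.2 => //= s n IH; rewrite !foldl_rcons IH cmulA.
Qed.

Lemma eval_expand t : eval t = \sum_(u <- expand t) evalw u.
Proof.
elim: t => /= [n||t1 -> t2 ->|t ->|t1 -> t2 ->].
- by rewrite big_seq1.
- by rewrite big_nil.
- by rewrite big_cat.
- by rewrite big_map -sumrN; apply: eq_bigr => u _; rewrite evalwN.
- rewrite big_allpairs_dep cmul_suml; apply: eq_bigr => u _.
  by rewrite cmul_sumr; apply: eq_bigr => v _; rewrite evalwM.
Qed.

Lemma eval_insert u s :
  \sum_(v <- insert u s) evalw v = evalw u + \sum_(v <- s) evalw v.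
Proof.
rewrite /insert; case: ifPn => [us|_]; last by rewrite big_cons.
by rewrite (big_rem _ us) /= evalwN addrA subrr add0r.
Qed.

Lemma sound t1 t2 :
  foldr insert [::] (expand (Add t1 (Opp t2))) = [::] -> eval t1 = eval t2.
Proof.
move=> h; apply/eqP; rewrite -subr_eq0 -[_ - _]/(eval (Add t1 (Opp t2))).
rewrite eval_expand; have <- : \sum_(u <- foldr insert [::] (expand (Add t1 (Opp t2)))) evalw u =
    \sum_(u <- expand (Add t1 (Opp t2))) evalw u.
  by elim: (expand _) => //= u s IH; rewrite eval_insert big_cons IH.
by rewrite h big_nil.
Qed.

End Interpretation.

Ltac index x env :=
  lazymatch env with
  | x :: _ => constr:(0%N)
  | _ :: ?env' => let n := index x env' in constr:(S n)
  end.

Ltac member x env :=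
  lazymatch env with
  | nil => constr:(false)
  | x :: _ => constr:(true)
  | _ :: ?env' => member x env'
  end.

Ltac atoms x env :=
  lazymatch x with
  | 0%R => env
  | (?y + ?z)%R => let env1 := atoms y env in atoms z env1
  | (- ?y)%R => atoms y env
  | cmul ?y ?z => let env1 := atoms y env in atoms z env1
  | _ => lazymatch member x env with
         | true => env
         | false => constr:(x :: env)
         end
  end.

Ltac reify x env :=
  lazymatch x with
  | 0%R => constr:(Zero)
  | (?y + ?z)%R =>
      let t := reify y env in let u := reify z env in constr:(Add t u)
  | (- ?y)%R => let t := reify y env in constr:(Opp t)
  | cmul ?y ?z =>
      let t := reify y env in let u := reify z env in constr:(Mul t u)
  | _ => let n := index x env in constr:(Var n)
  end.

Ltac solve_identity :=
  lazymatch goal with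
  | |- @eq ?T ?x ?y =>
      let env0 := atoms x (@nil T) in
      let env := atoms y env0 in
      let t := reify x env in
      let u := reify y env in
      refine (@sound _ _ env t u _); vm_compute; reflexivity
  end.

End NonunitalRing.

Ltac nuring := NonunitalRing.solve_identity.

(** * Perturbing approximate projections and partial isometries *)

Lemma half_pow_small (R : realType) (c e : R) : 0 <= c -> 0 < e ->
  exists N, forall n, (N <= n)%N -> c / 2 ^+ n < e.
Proof.
move=> c0 e0; have ce : 0 <= c / e by rewrite divr_ge0 // ltW.
exists (Num.bound (c / e)) => n Nn.
rewrite ltr_pdivrMr ?exprn_gt0 // mulrC -ltr_pdivrMr //.
apply: (lt_le_trans (archi_boundP ce)).
rewrite -natrX ler_nat (leq_trans Nn) //.
exact/ltnW/ltn_expl.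
Qed.

Section Newton.
Variables (R : realType) (A : cstarAlgType R).
Implicit Types (x y z p q v w : A) (E : set A).

(** Identities are passed to limits through this criterion: replacing each factor by an approximant
    costs a multiple of e, and e <= 1 absorbs the quadratic terms into the linear one. *)
Lemma nrm_linear_eq0 x (C : R) :
  (forall e : R, 0 < e -> e <= 1 -> nrm x <= C * e) -> x = 0.
Proof.
move=> h; apply: nrm_small_eq0 => e e0.
have C0 : 0 <= C by have := h _ ltr01 (lexx _); have := nrm_ge0 x; lra.
pose d := Num.min 1 (e / (2 * (C + 1))).
have d0 : 0 < d by rewrite lt_min ltr01 /= divr_gt0 // mulr_gt0 //; lra.
have d1 : d <= 1 by rewrite ge_min lexx.
have de : d * (2 * (C + 1)) <= e.
  by rewrite -ler_pdivlMr ?ge_min ?lexx ?orbT // mulr_gt0 //; lra.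
have := h _ d0 d1; nra.
Qed.

(** Halving the defect at each step makes the step lengths at most C defect(z) / 2^n, with sum 2 C
    defect(z). Since [P] and [defect] are not assumed continuous, the conclusion provides points of
    the orbit near the limit instead of a statement about the limit itself. *)
Lemma iter_limit (T : A -> A) (defect : A -> R) E (P : A -> Prop) (C eta : R) z :
  closed E -> (forall x, E x -> P x -> E (T x) /\ P (T x)) ->
  (forall x, 0 <= defect x) -> 0 <= C ->
  (forall x, P x -> defect x <= eta ->
    defect (T x) <= defect x / 2 /\ nrm (T x - x) <= C * defect x) ->
  E z -> P z -> defect z <= eta ->
  exists l, [/\ E l, nrm (l - z) <= 2 * C * defect z &
    forall e, 0 < e -> exists x, [/\ P x, nrm (x - l) < e & defect x < e]].
Proof.
move=> cE ET def0 C0 Tdef Ez Pz dz.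
pose u n := iter n T z.
have Eu n : E (u n) /\ P (u n) by elim: n => [//|n [? ?]]; exact: ET.
have du n : defect (u n) <= defect z / 2 ^+ n /\ defect (u n) <= eta.
  elim: n => [|n [IH1 IH2]]; first by rewrite expr0 divr1.
  have [h _] := Tdef _ (Eu n).2 IH2; have d0 := def0 (u n); split.
    by rewrite exprSr invfM mulrA (le_trans h) // ler_pM2r ?invr_gt0.
  by rewrite /u iterS (le_trans h) //; move: IH2 d0; rewrite /u; lra.
have step n : nrm (u n.+1 - u n) <= C * (defect z / 2 ^+ n).
  have [_ h] := Tdef _ (Eu n).2 (du n).2.
  by apply: (le_trans h); rewrite ler_wpM2l // (du n).1.
(* The partial sum of the geometric series is kept exact, so that the induction on [m] closes. *)
have far n m : nrm (u (n + m)%N - u n) <=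
    2 * C * (defect z / 2 ^+ n - defect z / 2 ^+ (n + m)).
  elim: m => [|m IH]; first by rewrite addn0 !subrr nrm0 mulr0.
  apply: le_trans (nrm_triangle (u (n + m)%N) _ _) _.
  rewrite addnS; have := step (n + m)%N.
  have -> : defect z / 2 ^+ (n + m).+1 = defect z / 2 ^+ (n + m) / 2.
    by rewrite exprSr invfM mulrA.
  by move: IH; set a := defect z / _; set b := defect z / _; lra.
have far' n m : (n <= m)%N -> nrm (u m - u n) <= 2 * C * defect z / 2 ^+ n.
  move=> /subnKC <-; apply: le_trans (far _ _) _.
  rewrite -[leRHS]mulrA ler_wpM2l ?mulr_ge0 // lerBlDr lerDl.
  by rewrite divr_ge0 // exprn_ge0.
have K0 : 0 <= 2 * C * defect z by rewrite !mulr_ge0.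
have [|l ul] := @nrm_complete _ _ u.
  move=> e e0; have [N hN] := half_pow_small K0 (divr_gt0 e0 (@ltr0Sn R 1)).
  exists N => n m Nn Nm; have := nrm_triangle (u N) (u n) (u m).
  have := far' _ _ Nn; have := far' _ _ Nm; have := hN _ (leqnn N).
  by rewrite (nrmBC (u N)); lra.
exists l; split.
- apply: closed_approx => // e /ul[N uN]; exists (u N); first exact: (Eu N).1.
  by rewrite nrmBC uN.
- apply/ler_addgt0Pr => e /ul[N /(_ _ (leqnn N)) uN].
  have := nrm_triangle (u N) l z; have := far' _ _ (leq0n N).
  rewrite expr0 divr1 /u /= -/u => h1 h2; rewrite (le_trans h2) // addrC lerD //.
  by rewrite nrmBC ltW.
- move=> e e0; have [N1 hN1] := ul _ e0.
  have [N2 hN2] := half_pow_small (def0 z) e0.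
  exists (u (maxn N1 N2)); split; first exact: (Eu _).2.
    by apply: hN1; rewrite leq_maxl.
  by apply: le_lt_trans (du _).1 _; apply: hN2; rewrite leq_maxr.
Qed.

Lemma cstar_subalgebraN E x : cstar_subalgebra E -> E x -> E (- x).
Proof. by move=> sE Ex; rewrite -scaleN1r; apply: cstar_subalgebraZ. Qed.

Lemma cstar_subalgebraB E x y : cstar_subalgebra E -> E x -> E y -> E (x - y).
Proof.
by move=> sE Ex Ey; apply: cstar_subalgebraD => //; exact: cstar_subalgebraN.
Qed.

Lemma cstar_subalgebraT : cstar_subalgebra [set: A].
Proof. by split. Qed.

(* This is [3 a^2 - 2 a^3], for which both 0 and 1 are superattracting. *)
Let cubic (a : A) := a + (a ** a - a - (a ** (a ** a - a) + a ** (a ** a - a))).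

(** The new defect is 4 b^3 - 3 b^2, hence quadratic in the old one. Integer multiples are written
    as repeated sums because [nuring] works without scalars. *)
Let cubic_defect (a : A) (b := a ** a - a) : cubic a ** cubic a - cubic a =
  b ** b ** b + b ** b ** b + b ** b ** b + b ** b ** b - (b ** b + b ** b + b ** b).
Proof. by rewrite /cubic /b; nuring. Qed.

(** Formally the step is b (1 - 2 a), and (1 - 2 a)^2 = 1 + 4 b: its square depends on the defect
    alone. *)
Let cubic_step (a : A) (b := a ** a - a) : (cubic a - a) ** (cubic a - a) =
  b ** b + (b ** b ** b + b ** b ** b + b ** b ** b + b ** b ** b).
Proof. by rewrite /cubic /b; nuring. Qed.

Lemma half_add_self x : 2^-1 *: (x + x) = x :> A.
Proof.
by rewrite -mulr2n -scalerMnr scalerMnl -mulr_natr mulVf ?scale1r // pnatr_eq0.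
Qed.

Lemma cabs_half : cabs (2^-1 : R[i]) = 2^-1.
Proof.
rewrite /cabs ger0_norm ?invr_ge0 //.
by rewrite -(rmorph_nat (real_complex R)) -fmorphV.
Qed.

Lemma nrm_halfD x y (c : R) : nrm x <= c -> nrm y <= c -> nrm (2^-1 *: (x + y)) <= c.
Proof.
move=> xc yc; rewrite nrmZ cabs_half.
by have := nrmD x y; lra.
Qed.

(** The iteration starts at the self-adjoint part of [a], which is within d of [p] and has defect at
    most 4 d. The bound d <= 1/32 puts this below 1/8, where the cubic halves the defect; the orbit
    moves by at most 2 * 2 * 4 d = 16 d, and 16 d + d = 17 d. *)
Lemma proj_near E (a p : A) (d : R) : cstar_subalgebra E -> E a -> projection p ->
  nrm (a - p) <= d -> d <= 32^-1 ->
  exists q, [/\ E q, projection q & nrm (q - p) <= 17 * d].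
Proof.
move=> sE Ea pp ap d32; have [sp ppp] := pp.
pose a1 : A := 2^-1 *: (a + star a).
have Ea1 : E a1.
  apply: cstar_subalgebraZ => //; apply: cstar_subalgebraD => //.
  exact: cstar_subalgebra_star.
have conj2 : Num.conj (2^-1 : R[i]) = 2^-1.
  by rewrite fmorphV rmorph_nat.
have sa1 : star a1 = a1 by rewrite starZ starD starK conj2 addrC.
have a1p : nrm (a1 - p) <= d.
  have -> : a1 - p = 2^-1 *: ((a - p) + star (a - p)).
    by rewrite -{1}(half_add_self p) -scalerBr starB sp opprD addrACA.
  by apply: (nrm_halfD ap); rewrite nrm_star.
have d0 : 0 <= d by rewrite (le_trans (nrm_ge0 _) ap).
have a1d : nrm (a1 ** a1 - a1) <= 4 * d.
  have -> : a1 ** a1 - a1 =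
     p ** (a1 - p) + (a1 - p) ** p + (a1 - p) ** (a1 - p) - (a1 - p).
    have pp0 : p ** p - p = 0 by rewrite ppp subrr.
    by rewrite -[RHS]addr0 -pp0; nuring.
  have := nrm_proj pp; have := nrm_ge0 (a1 - p); have := nrm_ge0 p.
  move: a1p; set x := a1 - p => xd n1 n2 n3.
  apply: le_trans (nrmB _ _) _.
  have := nrmD (p ** x + x ** p) (x ** x); have := nrmD (p ** x) (x ** p).
  have := nrmM p x; have := nrmM x p; have := nrmM x x.
  nra.
have [||||||//||q [Eq qa1 hq]] := @iter_limit cubic (fun x => nrm (x ** x - x))
    E (fun x => star x = x) 2 8^-1 a1.
- exact: cstar_subalgebra_closed.
- move=> x Ex sx; split.
    rewrite /cubic; do ?[apply: cstar_subalgebraD => // | apply: cstar_subalgebraN => //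
      | apply: cstar_subalgebraM => //].
  by rewrite /cubic /= !(starD, starN, starM) sx; nuring.
- by move=> x; exact: nrm_ge0.
- by [].
- move=> x sx xd; split.
    rewrite cubic_defect; move: (x ** x - x) xd => b b8; have b0 := nrm_ge0 b.
    have bb := nrmM b b; have bbb := nrmM (b ** b) b.
    have bb0 := nrm_ge0 (b ** b); have bbb0 := nrm_ge0 (b ** b ** b).
    apply: le_trans (nrmB _ _) _.
    have := nrmD (b ** b ** b + b ** b ** b + b ** b ** b) (b ** b ** b).
    have := nrmD (b ** b ** b + b ** b ** b) (b ** b ** b).
    have := nrmD (b ** b ** b) (b ** b ** b).
    have := nrmD (b ** b + b ** b) (b ** b); have := nrmD (b ** b) (b ** b).
    nra.
  (* The step is self-adjoint, so its squared norm is the norm of its square, which is bounded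
     without any bound on [x]. *)
  have : nrm (cubic x - x) ^+ 2 <= (2 * nrm (x ** x - x)) ^+ 2.
    rewrite -nrm_star_cmul.
    have -> : star (cubic x - x) = cubic x - x.
      by rewrite /cubic /= !(starD, starN, starM) sx; nuring.
    rewrite cubic_step; move: (x ** x - x) xd => b b8; have b0 := nrm_ge0 b.
    have bb := nrmM b b; have bbb := nrmM (b ** b) b.
    have bb0 := nrm_ge0 (b ** b); have bbb0 := nrm_ge0 (b ** b ** b).
    apply: le_trans (nrmD _ _) _.
    have := nrmD (b ** b ** b + b ** b ** b + b ** b ** b) (b ** b ** b).
    have := nrmD (b ** b ** b + b ** b ** b) (b ** b ** b).
    have := nrmD (b ** b ** b) (b ** b ** b).
    rewrite exprMn expr2.
    nra.
  by rewrite ler_pXn2r // nnegrE ?mulr_ge0 ?nrm_ge0.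
- exact: Ea1.
- by apply: le_trans a1d _; lra.
exists q; split=> //.
- split; apply/eqP; rewrite -subr_eq0; apply/eqP.
    apply: (@nrm_linear_eq0 _ 2) => e e0 e1; have [x [sx xq _]] := hq _ e0.
    have -> : star q - q = star (q - x) + (x - q) by rewrite starB sx addrA subrK.
    apply: le_trans (nrmD _ _) _; rewrite nrm_star nrmBC; move: xq; lra.
  apply: (@nrm_linear_eq0 _ (2 * nrm q + 3)) => e e0 e1.
  have [x [sx xq xd]] := hq _ e0.
  have -> : q ** q - q = (q - x) ** q + (x ** (q - x)) + (x ** x - x + (x - q)).
    by nuring.
  have xq' : nrm x <= nrm q + e.
    have := nrmD (x - q) q; rewrite subrK; lra.
  have := nrmD ((q - x) ** q + (x ** (q - x))) (x ** x - x + (x - q)).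
  have := nrmD ((q - x) ** q) (x ** (q - x)).
  have := nrmD (x ** x - x) (x - q).
  have := nrmM (q - x) q; have := nrmM x (q - x).
  have := nrm_ge0 q; have := nrm_ge0 x; have := nrm_ge0 (x - q).
  rewrite (nrmBC q x); nra.
- have := nrm_triangle a1 q p; move: qa1; lra.
Qed.

End Newton.

(** * Newton-Schulz iteration for partial isometries *)

Section NewtonSchulz.
Variables (R : realType) (A : cstarAlgType R).
Implicit Types (x y z p q v w : A) (E : set A).

(** This is v (3 - v* v) / 2 written without a unit; its fixed points are the partial isometries. *)
Let schulz v := v + 2^-1 *: (v - v ** star v ** v).

Let star_schulz v : star (schulz v) = schulz (star v).
Proof.
by rewrite /schulz starD starZ fmorphV rmorph_nat starB !starM starK cmulA.
Qed.

(** With q - v* v = 2 d the step sends v to v + v d, and the new defect is 3 d^2 + 2 d^3; here |d|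
    <= 1/4 and |v| <= 2. *)
Let schulz_defect q v : projection q -> v ** q = v -> nrm (q - star v ** v) <= 2^-1 ->
  nrm (q - star (schulz v) ** schulz v) <= nrm (q - star v ** v) / 2 /\
  nrm (schulz v - v) <= nrm (q - star v ** v).
Proof.
move=> [sq qq] vq h2; set e := q - star v ** v; rewrite -/e in h2.
have qv : q ** star v = star v by rewrite -sq -starM vq.
pose d := 2^-1 *: e.
have edd : e = d + d by rewrite -scalerDr half_add_self.
have sd : star d = d by rewrite starZ fmorphV rmorph_nat starB sq starM_self.
have qd : q ** d = d by rewrite /d cmulZr cmulBr qq cmulA qv.
have dq : d ** q = d by rewrite /d cmulZl cmulBl qq -cmulA vq.
have vv : star v ** v = q - (d + d) by rewrite -edd opprB addrC subrK.
have sch : schulz v = v + v ** d.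
  by rewrite /schulz cmulZr /e cmulBr vq cmulA.
have nd : nrm d <= nrm e / 2.
  by rewrite /d nrmZ cabs_half mulrC.
have e0 := nrm_ge0 e; have d0 := nrm_ge0 d.
split.
  have -> : q - star (schulz v) ** schulz v =
      (d ** d + d ** d + d ** d) + (d ** d ** d + d ** d ** d).
    rewrite sch starD starM sd.
    have -> : (star v + d ** star v) ** (v + v ** d) = star v ** v +
        d ** (star v ** v) + (star v ** v) ** d + d ** (star v ** v) ** d by nuring.
    rewrite vv; transitivity (d + d - d ** q - q ** d - d ** q ** d +
      (d ** d + d ** d + d ** d + d ** d) + (d ** d ** d + d ** d ** d)); first by nuring.
    by rewrite !dq qd; nuring.
  have dd := nrmM d d; have ddd := nrmM (d ** d) d.
  have dd0 := nrm_ge0 (d ** d); have ddd0 := nrm_ge0 (d ** d ** d).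
  apply: le_trans (nrmD _ _) _.
  have := nrmD (d ** d + d ** d) (d ** d); have := nrmD (d ** d) (d ** d).
  have := nrmD (d ** d ** d) (d ** d ** d).
  have : nrm d * nrm d <= nrm d * 4^-1 by nra.
  nra.
have -> : schulz v - v = v ** d by rewrite sch addrC addKr.
apply: le_trans (nrmM _ _) _.
have v2 : nrm v <= 2.
  have : nrm v ^+ 2 <= 2.
    rewrite -nrm_star_cmul vv -edd; apply: le_trans (nrmB _ _) _.
    have := nrm_proj (conj sq qq); lra.
  have := nrm_ge0 v; rewrite expr2; nra.
have := nrm_ge0 v; nra.
Qed.

Let schulz_limit q w : projection q ->
  (forall e : R, 0 < e -> exists v, [/\ v ** q = v, nrm (v - w) < e &
     nrm (q - star v ** v) < e]) -> star w ** w = q.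
Proof.
move=> pq h; apply/eqP; rewrite -subr_eq0; apply/eqP.
apply: (@nrm_linear_eq0 _ _ _ (2 * nrm w + 2)) => e e0 e1.
have [v [_ vw dv]] := h _ e0.
have -> : star w ** w - q =
    (star (w - v) ** w + star v ** (w - v)) - (q - star v ** v).
  by rewrite starB; nuring.
have nv : nrm v <= nrm w + e by have := nrmD (v - w) w; rewrite subrK; lra.
have := nrmB (star (w - v) ** w + star v ** (w - v)) (q - star v ** v).
have := nrmD (star (w - v) ** w) (star v ** (w - v)).
have := nrmM (star (w - v)) w; have := nrmM (star v) (w - v).
have := nrm_ge0 w; have := nrm_ge0 v; have := nrm_ge0 (v - w).
rewrite !nrm_star (nrmBC w v); nra.
Qed.

(* Newton-Schulz iteration for the partial isometry in the polar decomposition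
   of [z]: both defects [q - v* v] and [p - v v*] decay quadratically. *)
Lemma partial_isometry_near E z p q (d : R) : cstar_subalgebra E ->
  projection p -> projection q -> E z -> p ** z = z -> z ** q = z ->
  nrm (q - star z ** z) <= d -> nrm (p - z ** star z) <= d -> d <= 4^-1 ->
  exists w, [/\ E w, star w ** w = q, w ** star w = p & nrm (w - z) <= 4 * d].
Proof.
move=> sE pp pq Ez pz zq zd1 zd2 d4.
have [sp _] := pp; have [sq _] := pq.
pose defect v := nrm (q - star v ** v) + nrm (p - v ** star v).
have swap v : p ** v = v -> star v ** p = star v.
  by move=> pv; rewrite -sp -starM pv.
have [||||||||w [Ew wz hw]] := @iter_limit _ _ schulz defect E
    (fun v => v ** q = v /\ p ** v = v) 1 2^-1 z.
- exact: cstar_subalgebra_closed.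
- move=> v Ev [vq pv]; split.
    apply: cstar_subalgebraD => //; apply: cstar_subalgebraZ => //.
    apply: cstar_subalgebraB => //; apply: cstar_subalgebraM => //.
    by apply: cstar_subalgebraM => //; exact: cstar_subalgebra_star.
  split; rewrite /schulz.
    by rewrite cmulDl cmulZl cmulBl -cmulA vq.
  by rewrite cmulDr cmulZr cmulBr !cmulA pv.
- by move=> v; rewrite addr_ge0 ?nrm_ge0.
- by [].
- rewrite /defect => v [vq pv] h.
  have n1 := nrm_ge0 (q - star v ** v); have n2 := nrm_ge0 (p - v ** star v).
  have [|a1 b1] := schulz_defect pq vq; first by lra.
  (* The range defect of [v] is the source defect of [star v], and the step commutes with the
     adjoint. *)
  have [|] := schulz_defect pp (swap _ pv); first by rewrite starK; lra.
  rewrite -star_schulz !starK => a2 _; split; lra.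
- by [].
- by [].
- by rewrite /defect; lra.
have ww : star w ** w = q.
  apply: schulz_limit => // e /hw[v [[vq pv] vw dv]]; exists v; split=> //.
  by apply: le_lt_trans dv; rewrite lerDl nrm_ge0.
have ww' : w ** star w = p.
  rewrite -{1}(starK w); apply: schulz_limit => // e /hw[v [[vq pv] vw dv]].
  exists (star v); split; [exact: swap|by rewrite -starB nrm_star|].
  by apply: le_lt_trans dv; rewrite starK lerDr nrm_ge0.
exists w; split=> //; apply: le_trans wz _; rewrite /defect; lra.
Qed.

(** The iteration starts at p q, whose defects are compressions of p - q and so at most d. It moves
    by at most 4 d, and p q - q = (p - q) q accounts for one more d. *)
Lemma projections_near_equiv p q (d : R) : projection p -> projection q ->
  nrm (p - q) <= d -> d <= 4^-1 ->
  exists w, [/\ star w ** w = q, w ** star w = p & nrm (w - q) <= 5 * d].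
Proof.
move=> pp pq pqd d4; have [sp ppp] := pp; have [sq qq] := pq.
have cmp r s : projection r -> projection s -> nrm (r - s) <= d ->
    nrm (s - s ** r ** s) <= d.
  move=> pr ps rsd; have [ss sss] := ps.
  have -> : s - s ** r ** s = - (s ** (r - s) ** s).
    by rewrite cmulBr cmulBl !sss opprB.
  rewrite nrmN; apply: le_trans (nrmM _ _) _; have := nrmM s (r - s).
  have := nrm_proj ps; have := nrm_ge0 (s ** (r - s)); have := nrm_ge0 s.
  have := nrm_ge0 (r - s); nra.
have [||||||w [_ ww ww' wd]] := @partial_isometry_near [set: A] (p ** q) p q d
    (@cstar_subalgebraT _ A) pp pq => //.
- by rewrite cmulA ppp.
- by rewrite -cmulA qq.
- by rewrite starM sp sq -cmulA (cmulA p) ppp cmulA; exact: cmp.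
- rewrite starM sp sq -cmulA (cmulA q) qq cmulA; apply: cmp => //.
  by rewrite nrmBC.
exists w; split=> //; apply: le_trans (nrm_triangle (p ** q) _ _) _.
have : nrm (p ** q - q) <= d.
  rewrite -{2}qq -cmulBl; apply: le_trans (nrmM _ _) _.
  have := nrm_proj pq; have := nrm_ge0 q; have := nrm_ge0 (p - q); nra.
lra.
Qed.

End NewtonSchulz.

(** * Finite-dimensional subspaces and subalgebras *)

Section FiniteDimensional.
Variables (R : realType) (A : cstarAlgType R).
Implicit Types (x y z p q v w : A) (S D E : set A) (s t : seq A).

Record linear_subspace S : Prop := Subspace {
  subspace0 : S 0 ;
  subspaceD : forall x y, S x -> S y -> S (x + y) ;
  subspaceZ : forall (c : R[i]) x, S x -> S (c *: x) }.

Lemma cstar_subspace S : cstar_subalgebra S -> linear_subspace S.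
Proof. by case. Qed.

Lemma subspaceN S x : linear_subspace S -> S x -> S (- x).
Proof. by move=> sS Sx; rewrite -scaleN1r; exact: subspaceZ. Qed.

Lemma subspaceB S x y : linear_subspace S -> S x -> S y -> S (x - y).
Proof. by move=> sS Sx Sy; apply: subspaceD => //; exact: subspaceN. Qed.

Lemma subspace_sum S (I : Type) (r : seq I) (P : pred I) (F : I -> A) :
  linear_subspace S -> (forall i, P i -> S (F i)) -> S (\sum_(i <- r | P i) F i).
Proof.
move=> sS SF; elim/big_rec: _ => [|i u Pi Su]; first exact: subspace0.
by apply: subspaceD => //; exact: SF.
Qed.

(** Peeling off one generator at a time is the form used for closedness and for adjoining a unit. *)
Fixpoint lspan s : set A :=
  if s is a :: s' then [set x | exists c, lspan s' (x - c *: a)] else [set 0].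

Lemma lspan_subspace s : linear_subspace (lspan s).
Proof.
elim: s => [|a s [IH0 IHD IHZ]] /=; split => //=.
- by move=> x y -> ->; rewrite addr0.
- by move=> c x ->; rewrite scaler0.
- by exists 0; rewrite scale0r subr0.
- move=> x y [c xc] [d yd]; exists (c + d).
  by rewrite scalerDl opprD addrACA; exact: IHD.
- move=> c x [d xd]; exists (c * d).
  by rewrite -scalerA -scalerBr; exact: IHZ.
Qed.
Hint Resolve lspan_subspace : core.

Lemma lspan_cons s a x : lspan s x -> lspan (a :: s) x.
Proof. by move=> sx; exists 0; rewrite scale0r subr0. Qed.

Lemma lspan_mem s a : a \in s -> lspan s a.
Proof.
elim: s => // b s IH; rewrite inE => /orP[/eqP ->|/IH]; last exact: lspan_cons.
by exists 1; rewrite scale1r subrr; apply: subspace0.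
Qed.

Lemma lspan_min S s : linear_subspace S -> (forall a, a \in s -> S a) -> lspan s `<=` S.
Proof.
move=> sS; elim: s => [|a s IH] sa x /=; first by move=> ->; exact: subspace0.
move=> [c xc]; rewrite -(subrK (c *: a) x); apply: subspaceD => //.
  by apply: IH xc => b bs; apply: sa; rewrite inE bs orbT.
by apply: subspaceZ => //; apply: sa; rewrite mem_head.
Qed.

Lemma lspan_cmul S s t : linear_subspace S ->
  (forall a b, a \in s -> b \in t -> S (a ** b)) ->
  forall x y, lspan s x -> lspan t y -> S (x ** y).
Proof.
move=> sS st x y sx ty; move: x sx; apply: lspan_min.
  split=> [|x1 x2 h1 h2|c x1 h1]; first by rewrite /= cmul0x; exact: subspace0.
    by rewrite /= cmulDl; exact: subspaceD.
  by rewrite /= cmulZl; exact: subspaceZ.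
move=> a sa; move: y ty; apply: lspan_min.
  split=> [|x1 x2 h1 h2|c x1 h1]; first by rewrite /= cmulx0; exact: subspace0.
    by rewrite /= cmulDr; exact: subspaceD.
  by rewrite /= cmulZr; exact: subspaceZ.
by move=> b tb; exact: st.
Qed.

Lemma lspan_map (f : A -> A) s : (forall x y, f (x + y) = f x + f y) ->
  (forall (c : R[i]) x, f (c *: x) = c *: f x) ->
  [set f x | x in lspan s] = lspan [seq f a | a <- s].
Proof.
move=> fD fZ; have f0 : f 0 = 0 by have := fZ 0 0; rewrite !scale0r.
apply/seteqP; split=> [_ [x + <-]|].
  move: x; apply: lspan_min.
    split=> [|x y|c x]; first by rewrite /= f0; exact: subspace0.
      by rewrite /= fD; apply: subspaceD.
    by rewrite /= fZ; apply: subspaceZ.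
  by move=> a sa; apply: lspan_mem; exact: map_f.
apply: lspan_min => [|_ /mapP[a sa ->]].
  split=> [|_ _ [x sx <-] [y sy <-]|c _ [x sx <-]].
  - by exists 0 => //; apply: subspace0.
  - by exists (x + y); [exact: subspaceD|rewrite fD].
  - by exists (c *: x); [exact: subspaceZ|rewrite fZ].
by exists a => //; exact: lspan_mem.
Qed.

Lemma finite_dimensionalP S : finite_dimensional S <-> exists s, S = lspan s.
Proof.
split=> [[n [e ->]]|[s ->]].
  exists [seq e i | i <- enum 'I_n]; apply/seteqP; split=> [_ [c _ <-]|].
    apply: subspace_sum => // i _; apply: subspaceZ => //; apply: lspan_mem.
    by apply: map_f; rewrite mem_enum.
  apply: lspan_min => [|_ /mapP[i _ ->]]; last first.
    exists (fun j => (j == i)%:R) => //.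
    rewrite (bigD1 i) //= eqxx scale1r big1 ?addr0 // => j /negPf ->.
    by rewrite scale0r.
  split=> [|_ _ [b _ <-] [c _ <-]|d _ [c _ <-]].
  - by exists (fun=> 0) => //; rewrite big1 // => i _; rewrite scale0r.
  - exists (fun i => b i + c i) => //; rewrite -big_split /=.
    by apply: eq_bigr => i _; rewrite scalerDl.
  - exists (fun i => d * c i) => //; rewrite scaler_sumr.
    by apply: eq_bigr => i _; rewrite scalerA.
elim: s => [|a s [n [e IH]]].
  exists 0%N, (fun=> 0); apply/seteqP; split=> [_ ->|_ [c _ <-]] /=.
    by exists (fun=> 0) => //; rewrite big_ord0.
  by rewrite big_ord0.
exists n.+1, (fun i => if unlift ord0 i is Some j then e j else a).
apply/seteqP; split=> [x /= [c]|_ [c _ <-]] /=.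
  rewrite IH => -[d _ dx].
  exists (fun i => if unlift ord0 i is Some j then d j else c) => //.
  rewrite big_ord_recl unlift_none.
  under eq_bigr do rewrite liftK.
  by rewrite dx addrC subrK.
exists (c ord0); rewrite big_ord_recl unlift_none addrC addKr IH.
exists (fun i => c (lift ord0 i)) => //.
by apply: eq_bigr => i _; rewrite liftK.
Qed.

(** Induction on the generators. If [a] lies outside the closed span of the others, its distance d >
    0 from that span gives |c| d <= |c a - y|, so the coefficients of [a] along an approximating
    sequence are Cauchy, and their limit is the coefficient sought. *)
Lemma lspan_closed s : closed (lspan s).
Proof.
elim: s => [|a s cs] /=.
  apply: closedP => x h; apply: nrm_small_eq0 => e /h[_ ->].
  by rewrite subr0.
have [sa|sa] := pselect (lspan s a).
  have -> : [set x | exists c, lspan s (x - c *: a)] = lspan s => //.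
  apply/seteqP; split=> [x [c xc]|x sx]; last exact: (@lspan_cons _ a).
  rewrite -(subrK (c *: a) x); apply: subspaceD => //; exact: subspaceZ.
have [d d0 far] : exists2 d : R, 0 < d & forall y, lspan s y -> d <= nrm (a - y).
  apply: contrapT => h; apply: sa; apply: closed_approx cs _ => e e0.
  apply: contrapT => h'; apply: h; exists e => // y sy.
  by rewrite leNgt; apply/negP => ay; apply: h'; exists y.
have farc c y : lspan s y -> cabs c * d <= nrm (c *: a - y).
  move=> sy; have [->|c0] := eqVneq c 0.
    by rewrite /cabs normr0 mul0r nrm_ge0.
  rewrite -[y](scalerKV c0) -scalerBr nrmZ ler_wpM2l ?cabs_ge0 //.
  by apply: far; exact: subspaceZ.
apply: closedP => x h.
pose r n : R := 2^-1 ^+ n.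
have r0 n : 0 < r n by rewrite exprn_gt0 // invr_gt0.
have /choice[u hu] n : exists c, exists2 y, lspan s y & nrm (x - (c *: a + y)) < r n.
  have [y [c yc] xy] := h _ (r0 n); exists c, (y - c *: a) => //.
  by rewrite [c *: a + _]addrC subrK.
have [|c hc] := @complex_complete _ u.
  move=> e e0; have ed : 0 < d * e / 2 by rewrite divr_gt0 // mulr_gt0.
  have [N hN] := half_pow_small (@ler01 R) ed.
  exists N => n m Nn Nm.
  have [y1 sy1 xy1] := hu n; have [y2 sy2 xy2] := hu m.
  have := farc (u n - u m) _ (subspaceB (lspan_subspace s) sy2 sy1).
  have -> : (u n - u m) *: a - (y2 - y1) =
    (x - (u m *: a + y2)) - (x - (u n *: a + y1)).
    rewrite scalerBl; move: (u n *: a) (u m *: a) => b1 b2.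
    by nuring.
  have := nrmB (x - (u m *: a + y2)) (x - (u n *: a + y1)).
  have := hN _ Nn; have := hN _ Nm; rewrite !mul1r -!exprVn -!/(r _).
  have := cabs_ge0 (u n - u m); nra.
exists c; apply: (closed_approx cs) => e e0.
have [N1 hN1] := half_pow_small (@ler01 R) (divr_gt0 e0 (@ltr0Sn R 1)).
have ea : 0 < e / 2 / (nrm a + 1).
  by rewrite divr_gt0 ?divr_gt0 // ltr_wpDl ?nrm_ge0.
have [N2 hN2] := hc _ ea; pose n := maxn N1 N2.
have [y sy xy] := hu n; exists y => //.
have -> : x - c *: a - y = (x - (u n *: a + y)) + (u n - c) *: a.
  rewrite scalerBl; move: (u n *: a) (c *: a) => b1 b2; nuring.
apply: le_lt_trans (nrmD _ _) _; rewrite nrmZ.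
have := hN1 n (leq_maxl _ _); rewrite mul1r -exprVn -/(r n) => h1.
have := hN2 n (leq_maxr _ _); rewrite ltr_pdivlMr ?ltr_wpDl ?nrm_ge0 // => h2.
have := cabs_ge0 (u n - c); have := nrm_ge0 a; nra.
Qed.

Definition fd_algebra S := cstar_subalgebra S /\ finite_dimensional S.

Lemma fd_lspan s : finite_dimensional (lspan s).
Proof. by apply/finite_dimensionalP; exists s. Qed.

Lemma lspan_fd_algebra s :
  (forall a b, a \in s -> b \in s -> lspan s (a ** b)) ->
  (forall a, a \in s -> lspan s (star a)) -> fd_algebra (lspan s).
Proof.
move=> sM sV; split; last exact: fd_lspan.
have [s0 sD sZ] := lspan_subspace s.
split=> //; last exact: lspan_closed.
  by move=> x y; apply: lspan_cmul.
apply: lspan_min => //; split=> [|x y|c x] /=; first by rewrite star0.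
  by rewrite starD; exact: sD.
by rewrite starZ; exact: sZ.
Qed.

(** The map need not be multiplicative, only its image closed under products: this covers
    compressions, where r x r r y r is the image of x r y. *)
Lemma fd_algebra_image (f : A -> A) S :
  (forall x y, f (x + y) = f x + f y) ->
  (forall (c : R[i]) x, f (c *: x) = c *: f x) ->
  (forall x, star (f x) = f (star x)) ->
  (forall x y, S x -> S y -> exists2 z, S z & f x ** f y = f z) ->
  fd_algebra S -> fd_algebra [set f x | x in S].
Proof.
move=> fD fZ fV fM [sS /finite_dimensionalP[s Ss]].
have Sm a : a \in s -> S a by rewrite Ss; exact: lspan_mem.
rewrite Ss lspan_map //; apply: lspan_fd_algebra; rewrite -lspan_map // -Ss.
  move=> _ _ /mapP[a /Sm Sa ->] /mapP[b /Sm Sb ->].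
  by have [z Sz ->] := fM a b Sa Sb; exists z.
move=> _ /mapP[a /Sm Sa ->]; exists (star a); last by rewrite fV.
exact: cstar_subalgebra_star.
Qed.

Lemma fd_algebra_unit S p : fd_algebra S -> projection p ->
  (forall x, S x -> p ** x = x /\ x ** p = x) ->
  fd_algebra [set x | exists c, S (x - c *: p)].
Proof.
move=> [sS /finite_dimensionalP[s Ss]] [sp pp] pS.
have Sm a : a \in s -> S a by rewrite Ss; exact: lspan_mem.
have -> : [set x | exists c, S (x - c *: p)] = lspan (p :: s) by rewrite Ss.
apply: (@lspan_fd_algebra (p :: s)) => [a b|a] /=.
  rewrite !inE => /orP[/eqP->|sa] /orP[/eqP->|sb].
  - by exists 1; rewrite pp scale1r subrr; apply: subspace0.
  - rewrite (pS _ (Sm _ sb)).1; apply: (@lspan_cons _ p); exact: lspan_mem.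
  - rewrite (pS _ (Sm _ sa)).2; apply: (@lspan_cons _ p); exact: lspan_mem.
  - apply: (@lspan_cons _ p).
    by rewrite -Ss; apply: cstar_subalgebraM; rewrite // Ss; exact: lspan_mem.
rewrite inE => /orP[/eqP->|sa].
  by exists 1; rewrite sp scale1r subrr; apply: subspace0.
apply: (@lspan_cons _ p).
by rewrite -Ss; apply: cstar_subalgebra_star; rewrite // Ss; exact: lspan_mem.
Qed.

(* [K] is the span of D, E, D E, E D and D E D, which is closed under products
   since [e d e' = e (r d r) e'] lies in E. *)
Lemma fd_algebra_glue D E r : fd_algebra D -> fd_algebra E -> star r = r ->
  (forall d e, D d -> E e -> d ** e = d ** r ** e) -> D r -> E r ->
  (forall d, D d -> E (r ** d ** r)) ->
  exists K, [/\ fd_algebra K, D `<=` K, E `<=` K &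
    forall S, cstar_subalgebra S -> D `<=` S -> E `<=` S -> K `<=` S].
Proof.
move=> [sD /finite_dimensionalP[s Ds]] [sE /finite_dimensionalP[t Et]] sr der Dr Er rDr.
pose st := [seq a ** b | a <- s, b <- t].
pose ts := [seq b ** a | b <- t, a <- s].
pose sts := [seq a ** b | a <- st, b <- s].
pose k := s ++ t ++ st ++ ts ++ sts.
have kS := lspan_subspace k.
(* Induction principle for [lspan k], with one case for each of the five kinds of generators. *)
have sub S : linear_subspace S -> D `<=` S -> E `<=` S ->
    (forall d e, D d -> E e -> S (d ** e)) ->
    (forall d e, D d -> E e -> S (e ** d)) ->
    (forall d e d', D d -> E e -> D d' -> S (d ** e ** d')) ->
    lspan k `<=` S.
  have Dm a : a \in s -> D a by rewrite Ds; exact: lspan_mem.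
  have Em a : a \in t -> E a by rewrite Et; exact: lspan_mem.
  move=> sS DS ES S1 S2 S3; apply: lspan_min => // a.
  rewrite !mem_cat => /orP[/Dm/DS //|/orP[/Em/ES //|/or3P[]]].
  - by move=> /allpairsP[[u w] /= [/Dm su /Em tw ->]]; exact: S1.
  - by move=> /allpairsP[[u w] /= [/Em su /Dm tw ->]]; exact: S2.
  - move=> /allpairsP[[u w] /= [+ /Dm tw ->]].
    by move=> /allpairsP[[u' w'] /= [/Dm su' /Em tw' ->]]; exact: S3.
have DK : D `<=` lspan k.
  rewrite Ds; apply: lspan_min => // a sa.
  by apply: lspan_mem; rewrite mem_cat sa.
have EK : E `<=` lspan k.
  rewrite Et; apply: lspan_min => // a ta.
  by apply: lspan_mem; rewrite !mem_cat ta orbT.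
have DEK d e : D d -> E e -> lspan k (d ** e).
  rewrite Ds Et; apply: lspan_cmul => // a b sa tb; apply: lspan_mem.
  by rewrite !mem_cat; apply/or3P; apply: Or33; apply/orP; left; exact: allpairs_f.
have EDK d e : D d -> E e -> lspan k (e ** d).
  rewrite Ds Et => dd ee; move: ee dd; apply: lspan_cmul => // a b sa tb; apply: lspan_mem.
  by rewrite !mem_cat; do 3![apply/orP; right]; apply/orP; left; exact: allpairs_f.
have DEDK d e d' : D d -> E e -> D d' -> lspan k (d ** e ** d').
  move=> Dd Ee; have : lspan st (d ** e).
    move: Dd Ee; rewrite Ds Et; apply: lspan_cmul => // a b sa tb.
    by apply: lspan_mem; exact: allpairs_f.
  rewrite Ds; apply: lspan_cmul => // a b sa tb; apply: lspan_mem.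
  by rewrite !mem_cat; do 4![apply/orP; right]; exact: allpairs_f.
have edr d e : D d -> E e -> e ** d = e ** r ** d.
  move=> Dd Ee; rewrite -[LHS]starK starM der; try exact: cstar_subalgebra_star.
  by rewrite !starM !starK sr cmulA.
have ede e d e' : E e -> D d -> E e' -> E (e ** d ** e').
  move=> Ee Dd Ee'; have -> : e ** d ** e' = e ** (r ** d ** r) ** e'.
    by rewrite (edr _ _ Dd Ee) -[LHS]cmulA (der _ _ Dd Ee') !cmulA.
  do 2?[apply: cstar_subalgebraM => //]; exact: rDr.
have KD x d : D d -> lspan k x -> lspan k (x ** d).
  move=> Dd; move: x; apply: sub => [|x Dx|x Ex|d' e Dd' Ee|d' e Dd' Ee|d' e d'' Dd' Ee Dd''] /=.
  - split=> [|x y|c x] /=; rewrite ?cmul0x ?cmulDl ?cmulZl.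
    + exact: subspace0.
    + exact: subspaceD.
    + exact: subspaceZ.
  - by apply: DK; exact: cstar_subalgebraM.
  - exact: EDK.
  - exact: DEDK.
  - by rewrite -cmulA; apply: EDK => //; exact: cstar_subalgebraM.
  - by rewrite -cmulA; apply: DEDK => //; exact: cstar_subalgebraM.
have KE x e : E e -> lspan k x -> lspan k (x ** e).
  move=> Ee; move: x; apply: sub => [|x Dx|x Ex|d e' Dd Ee'|d e' Dd Ee'|d e' d' Dd Ee' Dd'] /=.
  - split=> [|x y|c x] /=; rewrite ?cmul0x ?cmulDl ?cmulZl.
    + exact: subspace0.
    + exact: subspaceD.
    + exact: subspaceZ.
  - exact: DEK.
  - by apply: EK; exact: cstar_subalgebraM.
  - by rewrite -cmulA; apply: DEK => //; exact: cstar_subalgebraM.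
  - by apply: EK; exact: ede.
  - by rewrite -!cmulA (cmulA e'); apply: DEK => //; exact: ede.
exists (lspan k); split=> // [|S sS DS ES].
  apply: lspan_fd_algebra => [a b /lspan_mem ka /lspan_mem|a /lspan_mem].
    move: b; apply: sub => [|x Dx|x Ex|d' e Dd' Ee|d' e Dd' Ee|d' e d'' Dd' Ee Dd''] /=.
    - split=> [|x y|c x] /=; rewrite ?cmulx0 ?cmulDr ?cmulZr.
      + exact: subspace0.
      + exact: subspaceD.
      + exact: subspaceZ.
    - exact: KD.
    - exact: KE.
    - by rewrite cmulA; apply: KE => //; exact: KD.
    - by rewrite cmulA; apply: KD => //; exact: KE.
    - by rewrite !cmulA; apply: (KD) => //; apply: KE => //; exact: KD.
  have Ds' d : D d -> D (star d) by exact: cstar_subalgebra_star.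
  have Es' d : E d -> E (star d) by exact: cstar_subalgebra_star.
  move: a; apply: sub => [|x Dx|x Ex|d' e Dd' Ee|d' e Dd' Ee|d' e d'' Dd' Ee Dd''] /=.
  - split=> [|x y|c x] /=; rewrite ?star0 ?starD ?starZ.
    + exact: subspace0.
    + exact: subspaceD.
    + exact: subspaceZ.
  - by apply: DK; exact: Ds'.
  - by apply: EK; exact: Es'.
  - by rewrite starM; apply: EDK; [exact: Ds'|exact: Es'].
  - by rewrite starM; apply: DEK; [exact: Ds'|exact: Es'].
  - by rewrite !starM cmulA; apply: DEDK; [exact: Ds'|exact: Es'|exact: Ds'].
have SM := cstar_subalgebraM sS.
apply: sub => //.
- exact: cstar_subspace.
- by move=> d e /DS Sd /ES Se; exact: SM.
- by move=> d e /DS Sd /ES Se; exact: SM.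
- by move=> d e d' /DS Sd /ES Se /DS Sd'; apply: (SM) => //; exact: SM.
Qed.

End FiniteDimensional.

(** * Matrix units in finite-dimensional C*-algebras *)

Section SpectralProjections.
Variables (R : realType) (A : cstarAlgType R).
Implicit Types (x y z p q v w : A) (S D E : set A) (s t : seq A).

(** The matrix of coordinates has more rows than columns, so some nonzero row vector annihilates
    it. *)
Lemma finite_dimensional_dependent S : finite_dimensional S ->
  exists n, forall N (x : nat -> A), (n < N)%N -> (forall i, (i < N)%N -> S (x i)) ->
  exists c : nat -> R[i], (exists2 i, (i < N)%N & c i != 0) /\
    \sum_(i < N) c i *: x i = 0.
Proof.
move=> [n [e ->]]; exists n => N x nN Sx.
have /choice[m hm] (i : 'I_N) : exists m : 'I_n -> R[i], \sum_(j < n) m j *: e j = x i.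
  by have [m _ <-] := Sx i (ltn_ord i); exists m.
pose M := \matrix_(i < N, j < n) m i j.
have : kermx M != 0.
  rewrite kermx_eq0 -row_leq_rank -ltnNge; exact: leq_ltn_trans (rank_leq_col M) nN.
rewrite -nz_row_eq0 => nz; set u := nz_row _ in nz.
have uM : u *m M = 0 by apply/sub_kermxP; exact: nz_row_sub.
pose c k := if insub k is Some i then u 0 i else 0.
have cE (i : 'I_N) : c i = u 0 i by rewrite /c valK.
exists c; split.
  have [i ui] := rV0Pn _ nz.
  by exists i; rewrite // cE.
transitivity (\sum_(j < n) (u *m M) 0 j *: e j).
  under [RHS]eq_bigr do rewrite mxE scaler_suml.
  rewrite exchange_big /=; apply: eq_bigr => i _.
  by rewrite -hm scaler_sumr cE; apply: eq_bigr => j _; rewrite mxE scalerA.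
by rewrite uM big1 // => j _; rewrite mxE scale0r.
Qed.

Section SpectralSplitting.
Variables (D : set A) (fdD : fd_algebra D) (p : A) (pp : projection p) (Dp : D p).
Variables (h : A) (Dh : D h) (sh : star h = h) (ph : p ** h = h).

Let sD : cstar_subalgebra D := fdD.1.
Let hp : h ** p = h.
Proof. by rewrite -[LHS]starK starM sh pp.1 ph sh. Qed.

(** Powers of [h] in the corner of [p], whose unit [p] serves as the power 0. *)
Let pw i := iter i (cmul h) p.

Let pwD i : D (pw i).
Proof. by elim: i => //= i IH; exact: cstar_subalgebraM. Qed.

Let pwh i : pw i ** h = h ** pw i.
Proof. by elim: i => /= [|i IH]; rewrite ?ph ?hp // -cmulA IH. Qed.

Let star_pw i : star (pw i) = pw i.
Proof. by elim: i => /= [|i IH]; rewrite ?pp.1 // starM IH sh pwh. Qed.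

Let pwp i : p ** pw i = pw i.
Proof. by elim: i => /= [|i IH]; rewrite ?pp.2 // cmulA ph. Qed.

Let ev (P : {poly R[i]}) : A := \sum_(i < size P) P`_i *: pw i.

Let ev_widen n (P : {poly R[i]}) : (size P <= n)%N -> ev P = \sum_(i < n) P`_i *: pw i.
Proof.
move=> Pn; rewrite /ev (big_ord_widen n (fun i => P`_i *: pw i)) // big_mkcond /=.
by apply: eq_bigr => i _; case: ltnP => // /(nth_default _) ->; rewrite scale0r.
Qed.

Let ev_root (l : R[i]) Q : ev (('X - l%:P) * Q) = h ** ev Q - l *: ev Q.
Proof.
have sz : (size (('X - l%:P) * Q)%R <= (size Q).+1)%N.
  by rewrite (leq_trans (size_polyMleq _ _)) // size_XsubC.
rewrite (ev_widen sz).
transitivity (\sum_(i < (size Q).+1) ('X * Q)`_i *: pw i -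
    l *: \sum_(i < (size Q).+1) Q`_i *: pw i).
  rewrite scaler_sumr -sumrB; apply: eq_bigr => i _.
  by rewrite mulrBl coefB coefCM scalerBl scalerA.
rewrite -(@ev_widen (size Q).+1 Q) //; congr (_ - _).
rewrite big_ord_recl coefXM /= scale0r add0r /ev cmul_sumr.
by apply: eq_bigr => i _; rewrite coefXM /= cmulZr.
Qed.

Let pw_eigen (l : R[i]) z i : h ** z = l *: z -> p ** z = z -> pw i ** z = l ^+ i *: z.
Proof.
move=> hz pz; elim: i => /= [|i IH]; first by rewrite pz scale1r.
by rewrite -cmulA IH cmulZr hz scalerA exprSr.
Qed.

(* If [P = ('X - l) Q] is the minimal polynomial of [h], then [z = Q(h)] is an
   eigenvector of [h] in the algebra generated by [h], so that [z z] and [z* z]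
   are multiples of [z]; the projection is a multiple of [z* z]. *)
Lemma spectral_splitting : (forall c, h != c *: p) ->
  exists q, [/\ projection q, D q, p ** q = q, q != 0 & q != p].
Proof.
move=> hns.
have [n dep] := finite_dimensional_dependent fdD.2.
have [c [[i0 i0n ci0] c0]] := dep n.+1 pw (leqnn _) (fun i _ => pwD i).
have exP : exists k, `[< exists P : {poly R[i]}, [/\ P != 0, size P = k & ev P = 0] >].
  pose P := \poly_(i < n.+1) c i.
  exists (size P); apply/asboolP; exists P; split=> //.
    apply/eqP => P0; move: ci0; have : P`_i0 = 0 by rewrite P0 coef0.
    by rewrite coef_poly i0n => ->; rewrite eqxx.
  rewrite (ev_widen (size_poly _ _)) -[RHS]c0.
  by apply: eq_bigr => i _; rewrite coef_poly ltn_ord.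
have p0 : p != 0.
  apply/eqP => p0; have := hns 0; rewrite scale0r => /eqP; apply.
  by rewrite -ph p0 cmul0x.
case: (ex_minnP exP) => k /asboolP[P [P0 sP evP]] mink.
have [l /factor_theorem[Q PQ]] : exists l, root P l.
  apply/closed_rootP; apply/eqP => /eqP /size_poly1P[b b0 Pb].
  move: evP; rewrite Pb /ev size_polyC b0 big_ord1 coefC eqxx /= => /eqP.
  by rewrite scaler_eq0 (negPf b0) (negPf p0).
rewrite mulrC in PQ.
have Q0 : Q != 0 by apply: contraNneq P0 => Q0; rewrite PQ Q0 mulr0.
pose z := ev Q.
have z0 : z != 0.
  apply/eqP => z0; have /mink : `[< exists P' : {poly R[i]},
    [/\ P' != 0, size P' = size Q & ev P' = 0] >] by apply/asboolP; exists Q.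
  by rewrite -sP PQ size_monicM ?monicXsubC // size_XsubC /= ltnn.
have hz : h ** z = l *: z.
  by apply/eqP; rewrite -subr_eq0 -ev_root -PQ evP.
have Dz : D z.
  by apply: (subspace_sum _ (cstar_subspace sD)) => i _; apply: cstar_subalgebraZ.
have pz : p ** z = z.
  by rewrite /z /ev cmul_sumr; apply: eq_bigr => i _; rewrite cmulZr pwp.
have [mu zz] : exists mu, z ** z = mu *: z.
  exists (\sum_(i < size Q) Q`_i * l ^+ i).
  rewrite {1}/z /ev cmul_suml scaler_suml; apply: eq_bigr => i _.
  by rewrite cmulZl (pw_eigen _ hz pz) scalerA.
have [nu szz] : exists nu, star z ** z = nu *: z.
  exists (\sum_(i < size Q) Num.conj Q`_i * l ^+ i).
  rewrite {1}/z /ev star_sum cmul_suml scaler_suml; apply: eq_bigr => i _.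
  by rewrite starZ star_pw cmulZl (pw_eigen _ hz pz) scalerA.
pose r := star z ** z.
have r0 : r != 0 by apply: contraNneq z0 => /star_cmul_eq0 ->.
have sr : star r = r by exact: starM_self.
pose ka := nu * mu.
have rr : r ** r = ka *: r.
  by rewrite /r szz cmulZl cmulZr zz !scalerA /ka mulrAC.
have ka0 : ka != 0.
  apply: contraNneq r0 => ka0; apply/eqP; apply: star_cmul_eq0.
  by rewrite sr rr ka0 scale0r.
have ska : Num.conj ka = ka.
  apply/eqP; rewrite -subr_eq0; move: r0; apply: contraNT => h0; apply/eqP.
  have : (Num.conj ka - ka) *: r = 0.
    rewrite scalerBl -{1}sr -starZ -rr starM sr; exact: subrr.
  by move/eqP; rewrite scaler_eq0 (negPf h0) => /eqP.
clearbody ka; have ska' : Num.conj ka^-1 = ka^-1 by rewrite fmorphV /= ska.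
exists (ka^-1 *: r); split.
- split; first by rewrite starZ ska' sr.
  by rewrite cmulZl cmulZr rr (scalerA ka^-1 ka) mulVf // scale1r.
- apply: cstar_subalgebraZ => //; apply: cstar_subalgebraM => //.
  exact: cstar_subalgebra_star.
- by rewrite cmulZr /r szz cmulZr pz.
- by rewrite scaler_eq0 negb_or invr_eq0 ka0.
(* Were the spectral projection all of [p], the eigenvalue equation would read h = h p = l p. *)
apply/eqP => rp; have /eqP := hns l; apply.
have : h ** (ka^-1 *: r) = l *: (ka^-1 *: r).
  rewrite cmulZr /r szz cmulZr hz !scalerA; congr (_ *: _).
  by rewrite -[in RHS]mulrA [in RHS]mulrC.
by rewrite rp hp.
Qed.

End SpectralSplitting.
End SpectralProjections.

(** * Minimal projections and matrix units *)

Section MatrixUnits.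
Variables (R : realType) (A : cstarAlgType R).
Implicit Types (x y z p q v w : A) (S E : set A) (s t : seq A).

(** If both the real and the imaginary part of p y p were multiples of p, so would be p y p itself;
    one of the two can therefore be split spectrally. *)
Lemma scalar_splitting D p : fd_algebra D -> projection p -> D p ->
  (exists2 y, D y & forall c, p ** y ** p != c *: p) ->
  exists q, [/\ projection q, D q, p ** q = q, q != 0 & q != p].
Proof.
move=> fdD pp Dp [y Dy ns]; have [sp ppp] := pp; have sD := fdD.1.
pose z := p ** y ** p.
have Dz : D z by do 2?[apply: cstar_subalgebraM => //].
have Dsz : D (star z) by exact: cstar_subalgebra_star.
have pz : p ** z = z by rewrite /z !cmulA ppp.
have psz : p ** star z = star z by rewrite /z !starM sp !cmulA ppp.
have [ns1|/existsNP[c1 /negP/negPn/eqP e1]] :=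
  pselect (forall c, z + star z != c *: p).
  apply: spectral_splitting (ns1) => //.
  - exact: cstar_subalgebraD.
  - by rewrite starD starK addrC.
  - by rewrite cmulDr pz psz.
have [ns2|/existsNP[c2 /negP/negPn/eqP e2]] :=
  pselect (forall c, 'i%R *: (z - star z) != c *: p).
  apply: spectral_splitting (ns2) => //.
  - by apply: cstar_subalgebraZ => //; exact: cstar_subalgebraB.
  - by rewrite starZ starB starK conjCi scaleNr -scalerN opprB.
  - by rewrite cmulZr cmulBr pz psz.
exfalso; have /eqP := ns (2^-1 * (c1 - 'i%R * c2)); apply.
rewrite -scalerA scalerBl -scalerA -e1 -e2 scalerA -expr2 sqrCi scaleN1r opprK.
rewrite -[LHS]half_add_self; congr (_ *: _).
by rewrite -/z; nuring.
Qed.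

Section Units.
Variables (D : set A) (fdD : fd_algebra D) (u : A) (pu : projection u) (Du : D u).

Let sD : cstar_subalgebra D := fdD.1.

Definition projection_partition N (e : nat -> A) :=
  [/\ forall i, (i < N)%N -> [/\ projection (e i), D (e i) & e i != 0],
      forall i j, (i < N)%N -> (j < N)%N -> i != j -> e i ** e j = 0 &
      \sum_(i < N) e i = u].

(** Nonzero orthogonal projections are linearly independent: multiplying a relation by [e i]
    isolates its coefficient. *)
Let partition_bound : exists n, forall N e, projection_partition N e -> (N <= n)%N.
Proof.
have [n dep] := finite_dimensional_dependent fdD.2.
exists n => N e [eP eO _]; rewrite leqNgt; apply/negP => nN.
have [i iN|c [[i iN ci] c0]] := dep N e nN; first by have [] := eP i iN.
have [[_ ee] _ ei0] := eP i iN.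
have : (\sum_(j < N) c j *: e j) ** e i = 0 by rewrite c0 cmul0x.
rewrite cmul_suml (bigD1 (Ordinal iN)) //= big1 => [|j ji].
  rewrite cmulZl ee addr0 => /eqP; rewrite scaler_eq0.
  by rewrite (negPf ci) (negPf ei0).
rewrite cmulZl eO ?scaler0 // ltn_ord.
Qed.

(** The piece [q] takes the place of [e i], and the remainder [e i - q] receives the new index
    [N]. *)
Let partition_split N e i q : projection_partition N e -> (i < N)%N ->
  projection q -> D q -> e i ** q = q -> q != 0 -> q != e i ->
  projection_partition N.+1
    (fun j => if j == i then q else if j == N then e i - q else e j).
Proof.
move=> [eP eO eu] iN pq Dq eq q0 qe; have [[se ee] De _] := eP i iN.
have [sq qq] := pq.
have qe' : q ** e i = q by rewrite -[LHS]starK starM sq se eq sq.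
have Ni : N != i by rewrite gtn_eqF.
have ej j : (j < N)%N -> j != i -> e j ** q = 0 /\ q ** e j = 0.
  move=> jN ji; rewrite -eq cmulA eO // cmul0x; split=> //.
  by rewrite eq -qe' -cmulA eO ?cmulx0 // eq_sym.
split.
- move=> j; rewrite ltnS => jN; case: eqP => // _; case: eqVneq => [_|jN'].
    split; last by rewrite subr_eq0 eq_sym.
      split; first by rewrite starB se sq.
      by rewrite cmulBl !cmulBr ee eq qe' qq subrr subr0.
    exact: cstar_subalgebraB.
  by apply: eP; rewrite ltn_neqAle jN'.
- move=> j k; rewrite !ltnS => jN kN jk.
  have [ji|ji] := eqVneq j i; have [ki|ki] := eqVneq k i.
  + by rewrite ji ki eqxx in jk.
  + case: eqVneq => [_|kN']; first by rewrite cmulBr qe' qq subrr.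
    by apply: (ej _ _ _).2; rewrite // ltn_neqAle kN'.
  + case: eqVneq => [_|jN']; first by rewrite cmulBl eq qq subrr.
    by apply: (ej _ _ _).1; rewrite // ltn_neqAle jN'.
  + case: (eqVneq j N) => [jN'|jN']; case: (eqVneq k N) => [kN'|kN'].
    * by rewrite jN' kN' eqxx in jk.
    * have kN1 : (k < N)%N by rewrite ltn_neqAle kN'.
      by rewrite cmulBl (ej _ kN1 ki).2 eO ?subrr // eq_sym.
    * have jN1 : (j < N)%N by rewrite ltn_neqAle jN'.
      by rewrite cmulBr (ej _ jN1 ji).1 eO ?subrr.
    * by apply: eO; rewrite // ltn_neqAle ?kN' ?jN'.
have sumE : \sum_(j < N | j != Ordinal iN)
      (if j == i :> nat then q else if j == N :> nat then e i - q else e j) =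
    \sum_(j < N | j != Ordinal iN) e j.
  by apply: eq_bigr => j ji; rewrite (ltn_eqF (ltn_ord j)) ifN.
rewrite big_ord_recr /= (negPf Ni) eqxx (bigD1 (Ordinal iN)) //= eqxx sumE.
by rewrite -eu [in RHS](bigD1 (Ordinal iN)) //= addrC addrA subrK.
Qed.

(** In a partition with the largest number of members no [e i] can be split, which forces every e_i
    x e_i to be scalar. If u = 0 the partition is empty, as members are nonzero. *)
Lemma minimal_partition : exists N e, projection_partition N e /\
  forall i x, (i < N)%N -> D x -> exists c, e i ** x ** e i = c *: e i.
Proof.
have ex : exists N, `[< exists e, projection_partition N e >].
  have [u0|u0] := eqVneq u 0.
    exists 0%N; apply/asboolP; exists (fun=> 0); split=> //.
    by rewrite big_ord0.
  exists 1%N; apply/asboolP; exists (fun=> u); split=> //.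
    by move=> [|i] [|j].
  by rewrite big_ord1.
have [n nb] := partition_bound.
have ub N : `[< exists e, projection_partition N e >] -> (N <= n)%N.
  by move=> /asboolP[e]; exact: nb.
case: (ex_maxnP ex ub) => N /asboolP[e Pe] maxN.
exists N, e; split=> // i x iN Dx; apply: contrapT => ns.
have [eP _ _] := Pe; have [pe De _] := eP i iN.
have [|q [pq Dq eq q0 qe]] := scalar_splitting fdD pe De.
  exists x => // c; apply/eqP => xc; apply: ns; by exists c.
have /maxN : `[< exists e, projection_partition N.+1 e >].
  by apply/asboolP; eexists; exact: (partition_split Pe iN pq Dq eq q0 qe).
by rewrite ltnn.
Qed.

(* For [z = p y q] one has [z* z = c q] and [z z* = c p]. Were [c = - t^2]
   negative, [b = z + z* + i t (p + q)] would satisfy [b* b = 0]. *)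
Let minimal_equiv p q y : projection p -> projection q -> D p -> D q ->
  q != 0 -> p ** q = 0 \/ p = q ->
  (forall x, D x -> exists c, p ** x ** p = c *: p) ->
  (forall x, D x -> exists c, q ** x ** q = c *: q) ->
  D y -> p ** y ** q != 0 ->
  exists2 w, D w & star w ** w = q /\ w ** star w = p.
Proof.
move=> [sp pp] [sq qq] Dp Dq q0 pq mp mq Dy z0; set z := p ** y ** q in z0.
have Dz : D z by do 2?[apply: cstar_subalgebraM => //].
have Dsy : D (star y) by exact: cstar_subalgebra_star.
have [c zz] : exists c, star z ** z = c *: q.
  have [|c cE] := mq (star y ** p ** y); first by do 2?[apply: cstar_subalgebraM => //].
  by exists c; rewrite -cE /z !starM sp sq !cmulA -(cmulA _ p p) pp.
have [c' zz'] : exists c, z ** star z = c *: p.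
  have [|c1 cE] := mp (y ** q ** star y); first by do 2?[apply: cstar_subalgebraM => //].
  by exists c1; rewrite -cE /z !starM sp sq !cmulA -(cmulA _ q q) qq.
have pz : p ** z = z by rewrite /z !cmulA pp.
have zq : z ** q = z by rewrite /z -!cmulA qq.
have qz : q ** star z = star z by rewrite -sq -starM zq.
have zp : star z ** p = star z by rewrite -sp -starM pz.
have c0 : c != 0.
  by apply: contraNneq z0 => c0; apply/eqP/star_cmul_eq0; rewrite zz c0 scale0r.
have {c'}zz' : z ** star z = c *: p.
  rewrite zz'; congr (_ *: _); apply/eqP; rewrite -subr_eq0.
  have : (c' - c) *: z = 0.
    by rewrite scalerBl -{1}pz -cmulZl -zz' -cmulA zz cmulZr zq subrr.
  by move/eqP; rewrite scaler_eq0 (negPf z0) orbF.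
have /CrealP rc : Num.conj c = c.
  apply/eqP; rewrite -subr_eq0; have : (Num.conj c - c) *: q = 0.
    by rewrite scalerBl -{1}sq -starZ -zz starM_self subrr.
  by move/eqP; rewrite scaler_eq0 (negPf q0) orbF.
have [cpos|cneg|/esym/eqP] := real_ltgt0P rc; last by rewrite eq_sym (negPf c0).
  have t0 : 0 <= sqrtC c by rewrite sqrtC_ge0 ltW.
  have tc : (sqrtC c)^-1 * ((sqrtC c)^-1 * c) = 1.
    by rewrite mulrA -invfM -expr2 sqrtCK mulVf.
  have ct : Num.conj (sqrtC c)^-1 = (sqrtC c)^-1 by apply: geC0_conj; rewrite invr_ge0.
  exists ((sqrtC c)^-1 *: z); first exact: cstar_subalgebraZ.
  by rewrite starZ ct !cmulZl !cmulZr zz zz' !scalerA -!mulrA tc !scale1r.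
(* If p = q then z = b q and c = |b|^2 cannot be negative. The argument with [b] further down relies
   on p q = 0. *)
exfalso; case: pq => [pq|pq]; last first.
  have [b zb] : exists b, z = b *: q by rewrite /z pq; exact: mq.
  have cb : c = b * Num.conj b.
    apply/eqP; rewrite -subr_eq0; have : (c - b * Num.conj b) *: q = 0.
      by rewrite scalerBl -zz zb starZ sq cmulZl cmulZr qq scalerA mulrC subrr.
    by move/eqP; rewrite scaler_eq0 (negPf q0) orbF.
  by move: (lt_geF cneg); rewrite cb -normCK exprn_ge0.
have qp : q ** p = 0 by rewrite -sp -sq -starM pq star0.
pose t : R[i] := sqrtC (- c).
have ct : Num.conj t = t by apply: geC0_conj; rewrite sqrtC_ge0 oppr_ge0 ltW.
have t2 : t * t = - c by rewrite -expr2 sqrtCK.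
have t0 : t != 0 by rewrite sqrtC_eq0 oppr_eq0.
have z2 : z ** z = 0 by rewrite -{1}zq -{2}pz cmulA -(cmulA z) qp cmulx0 cmul0x.
have sz2 : star z ** star z = 0 by rewrite -starM z2 star0.
have qz0 : q ** z = 0 by rewrite -pz cmulA qp cmul0x.
have zp0 : z ** p = 0 by rewrite -zq -cmulA qp cmulx0.
have pz0 : p ** star z = 0 by rewrite -sp -starM zp0 star0.
have zq0 : star z ** q = 0 by rewrite -sq -starM qz0 star0.
pose a := z + star z; pose g := p + q; pose b := a + ('i%R * t) *: g.
have ag : a ** g = a.
  by rewrite /a /g cmulDr !cmulDl zp0 zp zq zq0 addr0 add0r addrC.
have ga : g ** a = a.
  by rewrite /a /g cmulDr !cmulDl pz qz0 pz0 qz addr0 add0r.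
have gg : g ** g = g by rewrite /g cmulDr !cmulDl pp qq pq qp addr0 add0r.
have aa : a ** a = c *: g.
  by rewrite /a /g cmulDr !cmulDl z2 sz2 zz zz' addr0 add0r scalerDr addrC.
have sb : star b = a - ('i%R * t) *: g.
  by rewrite /b /a /g starD starZ !starD starK sp sq rmorphM /= conjCi ct mulNr
    scaleNr (addrC (star z)).
have b0 : b = 0.
  apply: star_cmul_eq0; rewrite sb /b cmulDr !cmulBl cmulZl !cmulZr cmulZl ag ga gg aa.
  rewrite scalerA mulrACA -expr2 sqrCi t2 mulrN mulN1r opprK.
  by rewrite addrA subrK subrr.
have : ('i%R * t) *: g = 0.
  rewrite -[LHS]half_add_self; have -> : ('i%R * t) *: g + ('i%R * t) *: g = b - star b.
    by rewrite sb /b; move: (_ *: g) => v; nuring.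
  by rewrite b0 star0 subrr scaler0.
move/eqP; rewrite scaler_eq0 mulf_eq0 (negPf (neq0Ci _)) (negPf t0) /= => /eqP g0.
have : q ** g = 0 by rewrite g0 cmulx0.
by rewrite /g cmulDr qp qq add0r => /eqP; rewrite (negPf q0).
Qed.

(** Here [rho i] represents the equivalence class of [i], and the matrix units are w_i w_j* with rho
    i = rho j. For inequivalent indices the sources of w_i and w_j are orthogonal, so w_i w_j* = 0
    and [mu_span] expresses that e_i D e_j vanishes. *)
Record matrix_units N (e w : nat -> A) (rho : nat -> nat) : Prop := MatrixUnits {
  mu_partition : projection_partition N e ;
  mu_rho : forall i, (i < N)%N -> (rho i < N)%N ;
  mu_mem : forall i, (i < N)%N -> D (w i) ;
  mu_source : forall i, (i < N)%N -> star (w i) ** w i = e (rho i) ;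
  mu_range : forall i, (i < N)%N -> w i ** star (w i) = e i ;
  mu_span : forall i j x, (i < N)%N -> (j < N)%N -> D x ->
    exists c, e i ** x ** e j = c *: (w i ** star (w j)) }.

(** Minimal projections linked by a nonzero e_i x e_j are equivalent in [D]; each class is referred
    to its least index. *)
Lemma exists_matrix_units : exists N e (w : nat -> A) rho, matrix_units N e w rho.
Proof.
have [N [e [Pe me]]] := minimal_partition; have [eP eO _] := Pe.
pose rel i j := exists2 w, D w & star w ** w = e j /\ w ** star w = e i.
have rel_of i j x : (i < N)%N -> (j < N)%N -> D x -> e i ** x ** e j != 0 -> rel i j.
  move=> iN jN Dx exe; have [pi Di _] := eP i iN; have [pj Dj ej0] := eP j jN.
  apply: (@minimal_equiv (e i) (e j) x) => //.
  - by have [->|ij] := eqVneq i j; [right|left; exact: eO].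
  - by move=> x' Dx'; exact: me.
  - by move=> x' Dx'; exact: me.
have relxx i : (i < N)%N -> rel i i.
  by move=> iN; have [[si ii] Di _] := eP i iN; exists (e i) => //; rewrite si ii.
have relC i j : rel i j -> rel j i.
  move=> [w Dw [w1 w2]]; exists (star w); first exact: cstar_subalgebra_star.
  by rewrite starK.
have src w i j : (j < N)%N -> star w ** w = e j -> w ** star w = e i -> w ** e j = w.
  move=> jN w1 w2; have [[sj jj] _ _] := eP j jN.
  apply/eqP; rewrite -subr_eq0; apply/eqP/star_cmul_eq0.
  rewrite starB starM sj cmulBl !cmulBr !cmulA.
  by rewrite -!(cmulA (e j) (star w)) w1 !jj !subrr.
have relT i j k : (j < N)%N -> (k < N)%N -> rel i j -> rel j k -> rel i k.
  move=> jN kN [w Dw [w1 w2]] [v Dv [v1 v2]]; exists (w ** v).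
    exact: cstar_subalgebraM.
  have jv : e j ** v = v by rewrite -v2 -cmulA v1; exact: src v2.
  rewrite starM !cmulA -(cmulA (star v)) w1 -(cmulA w) v2; split.
    by rewrite -cmulA jv v1.
  by rewrite (src w i j).
(* Indices outside the partition get a vacuous condition, so that [rho] is a total function. *)
have exrho i : exists j, if (i < N)%N then (j < N)%N && `[< rel i j >] else true.
  by case: ltnP => iN; [exists i; rewrite iN; apply/asboolP; exact: relxx|exists 0%N].
pose rho i := ex_minn (exrho i).
have rhoP i : (i < N)%N -> (rho i < N)%N /\ rel i (rho i).
  by move=> iN; rewrite /rho; case: ex_minnP => j; rewrite iN => /andP[jN /asboolP].
have rhoE i j : (i < N)%N -> (j < N)%N -> rel i j -> rho i = rho j.
  move=> iN jN ij; rewrite /rho; apply: eq_ex_minn => k; rewrite iN jN.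
  case: ltnP => //= kN; apply/asboolP/asboolP => h; last exact: relT jN kN ij h.
  by apply: relT iN kN (relC _ _ ij) h.
have /choice[w wP] i : exists w, (i < N)%N ->
    [/\ D w, star w ** w = e (rho i) & w ** star w = e i].
  case: (ltnP i N) => [iN|]; last by exists 0.
  by have [_ [w Dw [w1 w2]]] := rhoP i iN; exists w.
exists N, e, w, rho; split=> //.
- by move=> i /rhoP[].
- by move=> i /wP[].
- by move=> i /wP[].
- by move=> i /wP[].
move=> i j x iN jN Dx; have [->|exe] := eqVneq (e i ** x ** e j) 0.
  by exists 0; rewrite scale0r.
have ij := rhoE _ _ iN jN (rel_of _ _ _ iN jN Dx exe).
have [rN _] := rhoP _ iN.
have [Dwi wi1 wi2] := wP _ iN; have [Dwj wj1 wj2] := wP _ jN; rewrite -ij in wj1.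
(* Pulling e_i x e_j back along w_i and w_j lands in the corner of the single minimal projection
   [e (rho i)], which is scalar. *)
have [|c wc] := me (rho i) (star (w i) ** x ** w j) rN.
  do 2?[apply: cstar_subalgebraM => //]; exact: cstar_subalgebra_star.
have wie := src _ _ _ rN wi1 wi2.
have ejw : e (rho i) ** star (w j) = star (w j).
  by have [[sr _] _ _] := eP _ rN; rewrite -{1}sr -starM (src _ _ _ rN wj1 wj2).
exists c; rewrite -[in RHS]wie -cmulZl -cmulZr -wc -wi2 -wj2 !cmulA wie.
by rewrite -[RHS]cmulA ejw.
Qed.

End Units.
End MatrixUnits.

(** * Perturbation of finite-dimensional subalgebras *)

Section Perturbation.
Variables (R : realType) (A : cstarAlgType R).
Implicit Types (x y z p q v : A) (E D : set A).

Lemma nrm_cmul_le x y (a b : R) : nrm x <= a -> nrm y <= b -> nrm (x ** y) <= a * b.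
Proof.
by move=> xa yb; apply: le_trans (nrmM _ _) _; rewrite ler_pM ?nrm_ge0.
Qed.

Lemma nrm_contractl x y (c : R) : nrm x <= 1 -> nrm y <= c -> nrm (x ** y) <= c.
Proof. by move=> x1 yc; have := nrm_cmul_le x1 yc; rewrite mul1r. Qed.

Lemma nrm_contractr x y (c : R) : nrm x <= 1 -> nrm y <= c -> nrm (y ** x) <= c.
Proof. by move=> x1 yc; have := nrm_cmul_le yc x1; rewrite mulr1. Qed.

Lemma source_projection v q : projection q -> star v ** v = q -> v ** q = v.
Proof.
move=> [sq qq] vv; apply/eqP; rewrite -subr_eq0; apply/eqP/star_cmul_eq0.
rewrite starB starM sq cmulBl !cmulBr !cmulA.
by rewrite -!(cmulA q (star v)) vv !qq !subrr.
Qed.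

Lemma range_projection v p : projection p -> v ** star v = p -> p ** v = v.
Proof.
move=> pp vv; rewrite -[LHS]starK starM pp.1 (source_projection pp) ?starK //.
Qed.

Lemma nrm_partial_isometry v q : projection q -> star v ** v = q -> nrm v <= 1.
Proof.
move=> pq vv; have := nrm_proj pq; rewrite -vv nrm_star_cmul expr2.
have := nrm_ge0 v; nra.
Qed.

Lemma sum_projection n (e : nat -> A) : (forall i, (i < n)%N -> projection (e i)) ->
  (forall i j, (i < n)%N -> (j < n)%N -> i != j -> e i ** e j = 0) ->
  projection (\sum_(i < n) e i) /\
  forall i, (i < n)%N -> (\sum_(i < n) e i) ** e i = e i.
Proof.
move=> eP eO; have sum_e i : (i < n)%N -> (\sum_(i < n) e i) ** e i = e i.
  move=> iN; rewrite cmul_suml (bigD1 (Ordinal iN)) //= big1.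
    by rewrite (eP _ iN).2 addr0.
  by move=> j ji; apply: eO.
split=> //; split.
  by rewrite star_sum; apply: eq_bigr => i _; rewrite (eP _ (ltn_ord i)).1.
by rewrite cmul_sumr; apply: eq_bigr => i _; rewrite sum_e.
Qed.

(** A projection constructed inside this subalgebra is exactly, not just approximately, orthogonal
    to [s]. *)
Lemma annihilator_subalgebra E (s : A) : cstar_subalgebra E -> star s = s ->
  cstar_subalgebra [set x | E x /\ (s ** x = 0 /\ x ** s = 0)].
Proof.
move=> sE ss; split=> /=.
- by split; [exact: cstar_subalgebra0|rewrite cmulx0 cmul0x].
- move=> x y [Ex [sx xs]] [Ey [sy ys]]; split; first exact: cstar_subalgebraD.
  by rewrite cmulDl cmulDr sx xs sy ys addr0.
- move=> c x [Ex [sx xs]]; split; first exact: cstar_subalgebraZ.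
  by rewrite cmulZl cmulZr sx xs scaler0.
- move=> x y [Ex [sx xs]] [Ey [sy ys]]; split; first exact: cstar_subalgebraM.
  by rewrite cmulA sx cmul0x -cmulA ys cmulx0.
- move=> x [Ex [sx xs]]; split; first exact: cstar_subalgebra_star.
  by split; rewrite -ss -starM ?sx ?xs star0.
apply: closedP => x h; split.
  apply: closed_approx; first exact: cstar_subalgebra_closed sE.
  by move=> e /h[y [Ey _] xy]; exists y.
split; apply: (@nrm_linear_eq0 _ _ _ (nrm s)) => e e0 _; have [y [_ [sy ys]] xy] := h e e0.
  rewrite -[s ** x]subr0 -sy -cmulBr (le_trans (nrmM _ _)) //.
  by rewrite ler_wpM2l ?nrm_ge0 // ltW.
rewrite -[x ** s]subr0 -ys -cmulBl (le_trans (nrmM _ _)) // mulrC.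
by rewrite ler_wpM2l ?nrm_ge0 // ltW.
Qed.

(** The expression is (1 - s') a (1 - s') without a unit. Each one-sided compression doubles the
    error and adds d': first 2 d + d', then 4 d + 3 d'. *)
Lemma compress_near (s s' a e : A) (d d' : R) : projection s -> projection s' ->
  projection e -> s ** e = 0 -> nrm (a - e) <= d -> nrm (s' - s) <= d' ->
  nrm (a - s' ** a - (a - s' ** a) ** s' - e) <= 4 * d + 3 * d'.
Proof.
move=> ps ps' pe se ad sd.
have es : e ** s = 0 by rewrite -pe.1 -ps.1 -starM se star0.
have s1 := nrm_proj ps'; have e1 := nrm_proj pe.
have a1 : nrm (a - s' ** a - e) <= 2 * d + d'.
  have -> : a - s' ** a - e = (a - e) - (s' ** (a - e) + (s' - s) ** e).
    by rewrite [(_ - s) ** e]cmulBl se; nuring.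
  apply: le_trans (nrmB _ _) _.
  have := nrmD (s' ** (a - e)) ((s' - s) ** e).
  have := nrm_contractl s1 ad; have := nrm_contractr e1 sd; lra.
move: (a - s' ** a) a1 => b b1.
have -> : b - b ** s' - e = (b - e) - ((b - e) ** s' + e ** (s' - s)).
  by rewrite [e ** (_ - _)]cmulBr es; nuring.
apply: le_trans (nrmB _ _) _.
have := nrmD ((b - e) ** s') (e ** (s' - s)).
have := nrm_contractr s1 b1; have := nrm_contractl e1 sd; lra.
Qed.

(** Induction on [k]: the approximant of the last projection is compressed to the complement of the
    sum of those already perturbed, and [proj_near] is applied in the annihilator of that sum. *)
Lemma orthogonal_projections_near k (e : nat -> A) :
  (forall i, (i < k)%N -> projection (e i)) ->
  (forall i j, (i < k)%N -> (j < k)%N -> i != j -> e i ** e j = 0) ->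
  forall eps : R, 0 < eps -> exists2 del : R, 0 < del & forall E, cstar_subalgebra E ->
  (forall i, (i < k)%N -> exists2 a, E a & nrm (a - e i) <= del) ->
  exists e' : nat -> A,
    (forall i, (i < k)%N -> [/\ E (e' i), projection (e' i) & nrm (e' i - e i) <= eps]) /\
    forall i j, (i < k)%N -> (j < k)%N -> i != j -> e' i ** e' j = 0.
Proof.
elim: k => [|k IH] eP eO eps eps0.
  by exists 1 => // E _ _; exists e.
have eP' i : (i < k)%N -> projection (e i) by move=> ik; exact/eP/ltnW.
have eO' i j : (i < k)%N -> (j < k)%N -> i != j -> e i ** e j = 0.
  by move=> ik jk; apply: eO; exact: ltnW.
(* [tau] is the error that [proj_near] accepts. The bound 4 del + 3 k eps1 of the compression is
   split evenly: del <= tau / 8 and (k + 1) eps1 <= tau / 6 contribute at most tau / 2 each. *)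
pose tau := Num.min (eps / 17) 32^-1.
have tau0 : 0 < tau by rewrite lt_min invr_gt0 divr_gt0 /=.
have tau1 : tau <= 32^-1 by rewrite ge_min lexx orbT.
have tau2 : 17 * tau <= eps by rewrite mulrC -ler_pdivlMr // ge_min lexx.
clearbody tau.
pose eps1 := Num.min eps (tau / (6 * k.+1%:R)).
have eps10 : 0 < eps1 by rewrite lt_min eps0 divr_gt0 // mulr_gt0.
have [del1 del10 hdel1] := IH eP' eO' _ eps10.
pose del := Num.min del1 (tau / 8).
exists del => [|E sE ap]; first by rewrite lt_min del10 divr_gt0.
have [|e' [e'P e'O]] := hdel1 E sE.
  move=> i ik; have [a Ea ae] := ap i (ltnW ik); exists a => //.
  by rewrite (le_trans ae) // ge_min lexx.
have [a Ea ae] := ap k (ltnSn k).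
have [ps _] := sum_projection eP' eO'.
have e'P' i : (i < k)%N -> projection (e' i) by move=> /e'P[].
have [ps' s'e] := sum_projection e'P' e'O.
set s := \sum_(i < k) e i in ps; set s' := \sum_(i < k) e' i in ps' s'e.
have se : s ** e k = 0.
  rewrite /s cmul_suml big1 // => i _; rewrite eO //; first exact: (ltnW (ltn_ord i)).
  by rewrite ltn_eqF.
have sd : nrm (s' - s) <= k%:R * eps1.
  rewrite /s /s' -sumrB (le_trans (nrm_sum _ _)) //.
  have -> : k%:R * eps1 = \sum_(i < k) eps1 by rewrite sumr_const card_ord mulr_natl.
  by apply: ler_sum => i _; have [] := e'P i (ltn_ord i).
have Es' : E s'.
  apply: (subspace_sum _ (cstar_subspace sE)) => i _.
  by have [] := e'P i (ltn_ord i).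
have := compress_near ps ps' (eP k (ltnSn k)) se ae sd.
set b := _ - _ ** s' => be.
have {be}bd : nrm (b - e k) <= tau.
  apply: le_trans be _.
  have h1 : del <= tau / 8 by rewrite ge_min lexx orbT.
  have h2 : k.+1%:R * eps1 <= tau / 6.
    rewrite mulrC -ler_pdivlMr // ge_min -mulrA -invfM lexx orbT //.
  have : k.+1%:R * eps1 = k%:R * eps1 + eps1 by rewrite -natr1 mulrDl mul1r.
  lra.
have Eb : E b.
  apply: cstar_subalgebraB => //; first exact: cstar_subalgebraB (cstar_subalgebraM _ _ _).
  apply: cstar_subalgebraM => //.
  exact: cstar_subalgebraB (cstar_subalgebraM _ _ _).
have [s's' sp'] := ps'.
have Eb' : E b /\ (s' ** b = 0 /\ b ** s' = 0).
  have -> : s' ** b = (s' - s' ** s') ** (a - a ** s') by rewrite /b; nuring.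
  have -> : b ** s' = (a - s' ** a) ** (s' - s' ** s') by rewrite /b; nuring.
  by rewrite sp' subrr cmul0x cmulx0.
have [q [[Eq [sq qs]] pq qe]] :=
  proj_near (annihilator_subalgebra sE s's') Eb' (eP k (ltnSn k)) bd tau1.
have eq i : (i < k)%N -> e' i ** q = 0 /\ q ** e' i = 0.
  move=> ik; have [_ [se' _] _] := e'P i ik; have [sq' _] := pq.
  have h : q ** e' i = 0 by rewrite -(s'e i ik) cmulA qs cmul0x.
  by split=> //; rewrite -sq' -se' -starM h star0.
exists (fun i => if i == k then q else e' i); split.
  move=> i; rewrite ltnS leq_eqVlt; case: eqVneq => [-> _|_ /= ik].
    by split=> //; rewrite (le_trans qe).
  have [? ? h] := e'P i ik; split=> //.
  by rewrite (le_trans h) // ge_min lexx.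
move=> i j; rewrite !ltnS (leq_eqVlt i) (leq_eqVlt j).
case: (eqVneq i k) => [->|ik] /=; case: (eqVneq j k) => [->|jk] //=; rewrite ?eqxx //.
- by move=> _ jk' _; exact: (eq j jk').2.
- by move=> ik' _ _; exact: (eq i ik').1.
- by move=> ik' jk'; exact: e'O.
Qed.

(** The iteration starts at z = p' a q', which is within 3 d of w and has norm at most 2. Its
    defects are at most d + 6 d + 3 d = 10 d, hence the bound 1/40 on d and the distance 4 * 10 d +
    3 d = 43 d. *)
Lemma partial_isometry_perturb E (w p q p' q' a : A) (d : R) : cstar_subalgebra E ->
  projection p -> projection q -> star w ** w = q -> w ** star w = p ->
  projection p' -> projection q' -> E p' -> E q' -> E a ->
  nrm (p' - p) <= d -> nrm (q' - q) <= d -> nrm (a - w) <= d -> d <= 40^-1 ->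
  exists w', [/\ E w', star w' ** w' = q', w' ** star w' = p' & nrm (w' - w) <= 43 * d].
Proof.
move=> sE pp pq ww ww' pp' pq' Ep' Eq' Ea pd qd ad d40.
have wq := source_projection pq ww; have pw := range_projection pp ww'.
have w1 := nrm_partial_isometry pq ww.
have p1 := nrm_proj pp; have q1 := nrm_proj pq.
have p1' := nrm_proj pp'; have q1' := nrm_proj pq'.
have d0 : 0 <= d by apply: le_trans ad; exact: nrm_ge0.
pose z := p' ** a ** q'.
have zw : nrm (z - w) <= 3 * d.
  have -> : z - w = p' ** (a - w) ** q' + ((p' - p) ** w ** q' + w ** (q' - q)).
    rewrite [(p' - p) ** w]cmulBl pw [w ** (q' - q)]cmulBr wq /z; nuring.
  have := nrmD (p' ** (a - w) ** q') ((p' - p) ** w ** q' + w ** (q' - q)).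
  have := nrmD ((p' - p) ** w ** q') (w ** (q' - q)).
  have := nrm_contractr q1' (nrm_contractl p1' ad).
  have := nrm_contractr q1' (nrm_contractr w1 pd); have := nrm_contractl w1 qd.
  lra.
have z2 : nrm z <= 2.
  have := nrmD (z - w) w; rewrite subrK; lra.
have near r r' u v : nrm (r' - r) <= d -> star v ** v = r -> nrm v <= 1 -> nrm u <= 2 ->
    nrm (u - v) <= 3 * d -> nrm (r' - star u ** u) <= 10 * d.
  move=> rd vv v1 u2 uv.
  have -> : r' - star u ** u = (r' - r) - (star u ** (u - v) + star (u - v) ** v).
    by rewrite starB cmulBr cmulBl vv; nuring.
  have := nrmB (r' - r) (star u ** (u - v) + star (u - v) ** v).
  have := nrmD (star u ** (u - v)) (star (u - v) ** v).
  have su2 : nrm (star u) <= 2 by rewrite nrm_star.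
  have suv : nrm (star (u - v)) <= 3 * d by rewrite nrm_star.
  have := nrm_cmul_le su2 uv; have := nrm_contractr v1 suv; lra.
have [||||||w' [Ew' h1 h2 h3]] := @partial_isometry_near _ _ E z p' q' (10 * d) sE pp' pq'.
- by do 2?[apply: cstar_subalgebraM => //].
- by rewrite /z !cmulA pp'.2.
- by rewrite /z -!cmulA pq'.2.
- exact: near qd ww w1 z2 zw.
- rewrite -{1}(starK z); apply: (near p p' (star z) (star w)) => //.
  + by rewrite starK.
  + by rewrite nrm_star.
  + by rewrite nrm_star.
  + by rewrite -starB nrm_star.
- lra.
exists w'; split=> //; have := nrm_triangle z w' w; lra.
Qed.

End Perturbation.

(** * Conjugating a finite-dimensional algebra into a nearby one *)

Section UnitaryPerturbation.
Variables (R : realType) (A : cstarAlgType R).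
Implicit Types (x y z p q v : A) (E D : set A).

(* The unitary is [sum x_i w_i* + V], where [x_i] is close to [w_i], has the same
   source, and [x_i x_j*] lies in E, and where [V] is a partial isometry close to
   [f - u]. *)
Lemma unitary_perturbation D u : fd_algebra D -> projection u -> D u ->
  (forall x, D x -> u ** x = x /\ x ** u = x) ->
  forall eps : R, 0 < eps -> exists2 del : R, 0 < del &
  exists xs : seq A, (forall x, x \in xs -> D x) /\
  forall f E, projection f -> f ** u = u -> cstar_subalgebra E -> E f ->
    (forall y, E y -> f ** y = y /\ y ** f = y) ->
    (forall x, x \in xs -> exists2 y, E y & nrm (y - x) <= del) ->
  exists U, [/\ star U ** U = f, U ** star U = f, nrm (U - f) <= eps &
    forall x, D x -> E (U ** x ** star U)].
Proof.
move=> fdD pu Du uD eps eps0.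
have [N [e [w [rho [[eP eO eu] rhoN wD ws wr wspan]]]]] := exists_matrix_units fdD pu Du.
have eP' i : (i < N)%N -> projection (e i) by move=> /eP[].
(* The two summands of U contribute 48 N th and 5 N th, within eps. The second bound meets the
   thresholds 1/40 on th and 1/4 on N th; N + 1 avoids division by zero. *)
pose th := Num.min (eps / (100 * N.+1%:R)) (40 * N.+1%:R)^-1.
have N0 : 0 < N.+1%:R :> R by [].
have th0 : 0 < th by rewrite lt_min invr_gt0 divr_gt0 // mulr_gt0.
have th1 : N.+1%:R * th <= 40^-1.
  by rewrite mulrC -ler_pdivlMr // ge_min !invfM lexx orbT.
have th2 : N.+1%:R * th <= eps / 100.
  by rewrite mulrC -ler_pdivlMr // ge_min !invfM mulrA lexx.
clearbody th.
have thN : N.+1%:R * th = N%:R * th + th by rewrite -natr1 mulrDl mul1r.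
have thN0 : 0 <= N%:R * th by rewrite mulr_ge0 // ltW.
have [d1 d10 hd1] := orthogonal_projections_near eP' eO th0.
exists (Num.min d1 th); first by rewrite lt_min d10.
exists ([seq e i | i <- iota 0 N] ++ [seq w i | i <- iota 0 N]); split.
  move=> x; rewrite mem_cat => /orP[|] /mapP[i + ->]; rewrite mem_iota add0n => iN.
    by have [] := eP i iN.
  exact: wD.
move=> f E pf fu sE Ef fE near.
have uf : u ** f = u by rewrite -[LHS]starK starM pf.1 pu.1 fu pu.1.
have [|e' [e'P e'O]] := hd1 E sE.
  move=> i iN; have [|a Ea ae] := near (e i).
    by rewrite mem_cat map_f // mem_iota.
  by exists a => //; rewrite (le_trans ae) // ge_min lexx.
have wnear i : (i < N)%N -> exists2 a, E a & nrm (a - w i) <= th.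
  move=> iN; have [|a Ea ae] := near (w i).
    by rewrite mem_cat orbC map_f // mem_iota.
  by exists a => //; rewrite (le_trans ae) // ge_min lexx orbT.
have e'P' i : (i < N)%N -> projection (e' i) by move=> /e'P[].
have e'E i : (i < N)%N -> E (e' i) by move=> /e'P[].
have e'n i : (i < N)%N -> nrm (e' i - e i) <= th by move=> /e'P[].
have [pu' u'e] := sum_projection e'P' e'O; set u' := \sum_(i < N) e' i in pu' u'e.
have Eu' : E u' by apply: (subspace_sum _ (cstar_subspace sE)) => i _; exact: e'E.
have uu' : nrm (u' - u) <= N%:R * th.
  rewrite -eu -sumrB (le_trans (nrm_sum _ _)) //.
  have -> : N%:R * th = \sum_(i < N) th by rewrite sumr_const card_ord mulr_natl.
  by apply: ler_sum => i _; exact: e'n.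
have th40 : th <= 40^-1 by lra.
have /choice[w' w'P] i : exists w', (i < N)%N -> [/\ E w', star w' ** w' = e' (rho i),
    w' ** star w' = e' i & nrm (w' - w i) <= 43 * th].
  case: (ltnP i N) => [iN|]; last by exists 0.
  have rN := rhoN i iN; have [a Ea aw] := wnear i iN.
  have [v vP] := partial_isometry_perturb sE (eP' i iN) (eP' _ rN) (ws i iN) (wr i iN)
    (e'P' i iN) (e'P' _ rN) (e'E i iN) (e'E _ rN) Ea (e'n i iN) (e'n _ rN) aw th40.
  by exists v.
have th4 : th <= 4^-1 by lra.
have /choice[y yP] i : exists y, (i < N)%N -> [/\ star y ** y = e i, y ** star y = e' i &
    nrm (y - e i) <= 5 * th].
  case: (ltnP i N) => [iN|]; last by exists 0.
  have [v vP] := projections_near_equiv (e'P' i iN) (eP' i iN) (e'n i iN) th4.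
  by exists v.
(* [y] turns the source [e' (rho i)] back into [e (rho i)]. It need not lie in E, but it cancels in
   x_i x_j*, which equals w'_i w'_j* when rho i = rho j and 0 otherwise. The distance is 43 th + 5
   th. *)
pose x i := w' i ** y (rho i).
have xs i : (i < N)%N -> star (x i) ** x i = e (rho i).
  move=> iN; have [_ w's _ _] := w'P i iN; have rN := rhoN i iN.
  have [ys yr _] := yP _ rN.
  rewrite /x starM cmulA -(cmulA (star (y _))) w's -cmulA.
  by rewrite (range_projection (e'P' _ rN) yr) ys.
have xr i : (i < N)%N -> x i ** star (x i) = e' i.
  move=> iN; have [_ w's w'r _] := w'P i iN; have rN := rhoN i iN.
  have [ys yr _] := yP _ rN.
  by rewrite /x starM cmulA -(cmulA (w' i)) yr (source_projection (e'P' _ rN) w's).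
have xn i : (i < N)%N -> nrm (x i - w i) <= 48 * th.
  move=> iN; have [_ w's w'r w'n] := w'P i iN; have rN := rhoN i iN.
  have [ys yr yn] := yP _ rN.
  have we := source_projection (eP' _ rN) (ws i iN).
  have -> : x i - w i = w' i ** (y (rho i) - e (rho i)) + (w' i - w i) ** e (rho i).
    by rewrite [(w' i - _) ** _]cmulBl we /x; nuring.
  have := nrmD (w' i ** (y (rho i) - e (rho i))) ((w' i - w i) ** e (rho i)).
  have := nrm_contractl (nrm_partial_isometry (e'P' _ rN) w's) yn.
  have := nrm_contractr (nrm_proj (eP' _ rN)) w'n; lra.
have xxE i j : (i < N)%N -> (j < N)%N -> E (x i ** star (x j)).
  move=> iN jN; have [Ewi _ _ _] := w'P i iN; have [Ewj _ _ _] := w'P j jN.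
  have riN := rhoN i iN; have rjN := rhoN j jN.
  have [ysi yri _] := yP _ riN; have [ysj yrj _] := yP _ rjN.
  rewrite /x starM cmulA -(cmulA (w' i)).
  have [->|rij] := eqVneq (rho i) (rho j).
    rewrite yrj; do 2?[apply: cstar_subalgebraM => //]; first exact: e'E.
    exact: cstar_subalgebra_star.
  have -> : y (rho i) ** star (y (rho j)) = 0.
    rewrite -(source_projection (eP' _ riN) ysi) -(source_projection (eP' _ rjN) ysj).
    rewrite starM (eP' _ rjN).1 -cmulA (cmulA (e _)) eO //.
    by rewrite cmul0x cmulx0.
  rewrite cmulx0 cmul0x.
  exact: cstar_subalgebra0.
have xe' i : (i < N)%N -> e' i ** x i = x i.
  by move=> iN; exact: range_projection (e'P' i iN) (xr i iN).
have xe i : (i < N)%N -> x i ** e (rho i) = x i.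
  by move=> iN; apply: source_projection (xs i iN); exact/eP'/rhoN.
have we i : (i < N)%N -> e i ** w i = w i.
  by move=> iN; exact: range_projection (eP' i iN) (wr i iN).
have wre i : (i < N)%N -> w i ** e (rho i) = w i.
  by move=> iN; apply: source_projection (ws i iN); exact/eP'/rhoN.
have xO i j : (i < N)%N -> (j < N)%N -> i != j -> star (x i) ** x j = 0.
  move=> iN jN ij; rewrite -(xe' i iN) -(xe' j jN) starM (e'P' i iN).1.
  by rewrite cmulA -(cmulA (star (x i))) e'O // cmulx0 cmul0x.
have wO i j : (i < N)%N -> (j < N)%N -> i != j -> star (w i) ** w j = 0.
  move=> iN jN ij; rewrite -(we i iN) -(we j jN) starM (eP' i iN).1.
  by rewrite cmulA -(cmulA (star (w i))) eO // cmulx0 cmul0x.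
pose U0 := \sum_(i < N) x i ** star (w i).
have sU0 : star U0 = \sum_(i < N) w i ** star (x i).
  by rewrite star_sum; apply: eq_bigr => i _; rewrite starM starK.
have U0s : star U0 ** U0 = u.
  rewrite sU0 cmul_suml -eu; apply: eq_bigr => i _.
  rewrite cmul_sumr (bigD1 i) //= big1 => [|j ji].
    rewrite addr0 cmulA -(cmulA (w i)) (xs i (ltn_ord i)).
    by rewrite (wre i (ltn_ord i)) (wr i (ltn_ord i)).
  by rewrite cmulA -(cmulA (w i)) xO // ?cmulx0 ?cmul0x // eq_sym.
have U0r : U0 ** star U0 = u'.
  rewrite sU0 cmul_suml; apply: eq_bigr => i _.
  rewrite cmul_sumr (bigD1 i) //= big1 => [|j ji].
    rewrite addr0 cmulA -(cmulA (x i)) (ws i (ltn_ord i)).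
    by rewrite (xe i (ltn_ord i)) (xr i (ltn_ord i)).
  by rewrite cmulA -(cmulA (x i)) wO // ?cmulx0 ?cmul0x // eq_sym.
have U0n : nrm (U0 - u) <= N%:R * (48 * th).
  have -> : U0 - u = \sum_(i < N) (x i - w i) ** star (w i).
    rewrite -eu -sumrB; apply: eq_bigr => i _.
    by rewrite cmulBl (wr i (ltn_ord i)).
  apply: le_trans (nrm_sum _ _) _.
  have -> : N%:R * (48 * th) = \sum_(i < N) (48 * th).
    by rewrite sumr_const card_ord mulr_natl.
  apply: ler_sum => i _; have rN := rhoN i (ltn_ord i).
  apply: nrm_contractr (xn i (ltn_ord i)).
  by rewrite nrm_star; exact: nrm_partial_isometry (eP' _ rN) (ws i (ltn_ord i)).
have compl r : projection r -> f ** r = r -> r ** f = r -> projection (f - r).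
  move=> [sr rr] fr rf; split; first by rewrite starB sr pf.1.
  by rewrite cmulBl !cmulBr fr rf rr pf.2 subrr subr0.
have [fu' u'f] := fE u' Eu'.
(* [V] completes [U0] to a unitary of the corner of [f]. As its source is orthogonal to u, it
   annihilates D and does not affect U z U* for z in D. *)
have [|| V [Vs Vr Vn]] := @projections_near_equiv _ _ (f - u') (f - u) (N%:R * th)
  (compl _ pu' fu' u'f) (compl _ pu fu uf).
- have -> : f - u' - (f - u) = u - u' by nuring.
  by rewrite nrmBC.
- lra.
have U0u : U0 ** u = U0 by exact: source_projection U0s.
have u'U0 : u' ** U0 = U0 by exact: range_projection U0r.
have Vu : V ** u = 0.
  rewrite -(source_projection (compl _ pu fu uf) Vs) -cmulA cmulBl fu pu.2 subrr.
  by rewrite cmulx0.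
have u'V : u' ** V = 0.
  rewrite -(range_projection (compl _ pu' fu' u'f) Vr) cmulA cmulBr u'f pu'.2 subrr.
  by rewrite cmul0x.
have UV : star U0 ** V = 0 by rewrite -u'U0 starM pu'.1 -cmulA u'V cmulx0.
have VU : star V ** U0 = 0 by rewrite -[LHS]starK starM starK UV star0.
have UV' : U0 ** star V = 0.
  by rewrite -U0u -cmulA -pu.1 -starM Vu star0 cmulx0.
have VU' : V ** star U0 = 0 by rewrite -[LHS]starK starM starK UV' star0.
exists (U0 + V); split.
- rewrite starD cmulDl !cmulDr UV VU U0s Vs addr0 add0r; nuring.
- rewrite starD cmulDl !cmulDr UV' VU' U0r Vr addr0 add0r; nuring.
- have -> : U0 + V - f = (U0 - u) + (V - (f - u)) by nuring.
  apply: le_trans (nrmD _ _) _; lra.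
move=> z Dz; have [uz zu] := uD z Dz.
have Vz : V ** z = 0 by rewrite -uz cmulA Vu cmul0x.
have zV : z ** star V = 0 by rewrite -zu -cmulA -pu.1 -starM Vu star0 cmulx0.
have -> : (U0 + V) ** z ** star (U0 + V) = U0 ** z ** star U0.
  by rewrite starD [(_ + V) ** z]cmulDl Vz addr0 cmulDr -[_ ** star V]cmulA zV cmulx0 addr0.
rewrite sU0 cmul_suml cmul_suml.
apply: (subspace_sum _ (cstar_subspace sE)) => i _; rewrite cmul_sumr.
apply: (subspace_sum _ (cstar_subspace sE)) => j _.
have [iN jN] := (ltn_ord i, ltn_ord j).
have -> : x i ** star (w i) ** z ** (w j ** star (x j)) =
    x i ** (star (w i) ** (e i ** z ** e j) ** w j) ** star (x j).
  rewrite !cmulA -(cmulA (x i) (star (w i)) (e i)) -(cmulA _ (e j) (w j)) we //.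
  by rewrite -(eP' i iN).1 -[in RHS]starM we.
have [c ->] := wspan i j z iN jN Dz.
rewrite cmulZr cmulZl cmulZr cmulZl; apply: cstar_subalgebraZ => //.
have -> : star (w i) ** (w i ** star (w j)) ** w j = e (rho i) ** e (rho j).
  by rewrite (cmulA (star (w i))) ws // -cmulA ws.
rewrite cmulA xe // -cmulA.
have -> : e (rho j) ** star (x j) = star (x j).
  by rewrite -(eP' _ (rhoN j jN)).1 -starM xe.
exact: xxE.
Qed.

End UnitaryPerturbation.

(** * Approximation of corners by finite-dimensional algebras *)

Section Approximation.
Variables (R : realType) (A : cstarAlgType R).
Implicit Types (x y z p q f g u : A) (E D S : set A) (K : nat -> set A).

(** The limits of sequences with n-th term in [K n]. Quantifying over all large n replaces
    nestedness. *)
Definition liminf_algebra K x := forall e : R, 0 < e ->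
  exists N, forall n, (N <= n)%N -> exists2 y, K n y & nrm (x - y) < e.

Lemma liminf_subspace K : (forall n, linear_subspace (K n)) -> linear_subspace (liminf_algebra K).
Proof.
move=> sK; split.
- by move=> e e0; exists 0%N => n _; exists 0; rewrite ?subrr ?nrm0 //; exact: subspace0.
- move=> x y Kx Ky e e0; have e2 : 0 < e / 2 by rewrite divr_gt0.
  have [N hN] := Kx _ e2; have [M hM] := Ky _ e2.
  exists (maxn N M) => n; rewrite geq_max => /andP[/hN[x' Kx' xx'] /hM[y' Ky' yy']].
  exists (x' + y'); first exact: subspaceD.
  rewrite opprD addrACA; apply: le_lt_trans (nrmD _ _) _; lra.
- move=> c x Kx e e0.
  have c1 : 0 < cabs c + 1 by rewrite ltr_wpDl ?cabs_ge0.
  have [N hN] := Kx _ (divr_gt0 e0 c1).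
  exists N => n /hN[y Ky xy]; exists (c *: y); first exact: subspaceZ.
  rewrite -scalerBr nrmZ; move: xy; rewrite ltr_pdivlMr //.
  have := nrm_ge0 (x - y); have := cabs_ge0 c; nra.
Qed.

Lemma liminf_closed K x :
  (forall e : R, 0 < e -> exists2 y, liminf_algebra K y & nrm (x - y) < e) ->
  liminf_algebra K x.
Proof.
move=> h e e0; have e2 : 0 < e / 2 by rewrite divr_gt0.
have [y Ky xy] := h _ e2; have [N hN] := Ky _ e2.
exists N => n /hN[z Kz yz]; exists z => //.
apply: le_lt_trans (nrm_triangle y _ _) _; lra.
Qed.

Lemma liminf_lipschitz K K' (phi : A -> A) (C : R) x : liminf_algebra K x ->
  (forall y z, nrm (phi y - phi z) <= C * nrm (y - z)) ->
  (forall n y, K n y -> K' n (phi y)) -> liminf_algebra K' (phi x).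
Proof.
move=> Kx lip KK' e e0.
have C1 : 0 < `|C| + 1 by rewrite ltr_wpDl.
have [N hN] := Kx _ (divr_gt0 e0 C1); exists N => n /hN[y Ky xy].
exists (phi y); first exact: KK'.
apply: le_lt_trans (lip _ _) _; move: xy; rewrite ltr_pdivlMr //.
have := ler_norm C; have := nrm_ge0 (x - y); nra.
Qed.

Lemma liminf_mono K K' x : liminf_algebra K x -> (forall n, K n `<=` K' n) ->
  liminf_algebra K' x.
Proof.
move=> Kx KK'; apply: (liminf_lipschitz (phi := id) (C := 1) Kx) => [y z|n y].
  by rewrite mul1r.
exact: KK'.
Qed.

Lemma liminf_star K x : (forall n y, K n y -> K n (star y)) -> liminf_algebra K x ->
  liminf_algebra K (star x).
Proof.
move=> sK Kx; apply: (liminf_lipschitz (C := 1) Kx) => // y z.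
by rewrite -starB nrm_star mul1r.
Qed.

Lemma liminf_mulmul K K' a b x : (forall n y, K n y -> K' n (a ** y ** b)) ->
  liminf_algebra K x -> liminf_algebra K' (a ** x ** b).
Proof.
move=> KK' Kx; apply: (liminf_lipschitz (phi := fun y => a ** y ** b)
  (C := nrm a * nrm b) Kx) => // y z.
rewrite -cmulBl -cmulBr (le_trans (nrmM _ _)) // mulrAC ler_wpM2r ?nrm_ge0 //.
exact: nrmM.
Qed.

(** Conjugation by a unitary near the unit moves an element in proportion to its norm, hence the
    relative error; approximants of [x] eventually have norm at most |x| + 1. *)
Lemma liminf_transfer K K' (idx : nat -> nat) x : (forall m, (m <= idx m)%N) ->
  (forall m y, K (idx m) y -> exists2 y', K' m y' & nrm (y' - y) <= nrm y / 2 ^+ m) ->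
  liminf_algebra K x -> liminf_algebra K' x.
Proof.
move=> idxP KK' Kx e e0; pose d := Num.min 1 (e / 2).
have d0 : 0 < d by rewrite lt_min ltr01 divr_gt0.
have [d1 d2] : d <= 1 /\ d <= e / 2 by rewrite !ge_min !lexx orbT.
have [N hN] := Kx d d0.
have x1 : 0 <= nrm x + 1 by rewrite addr_ge0 ?nrm_ge0.
have [M hM] := half_pow_small x1 (divr_gt0 e0 (@ltr0Sn R 1)).
exists (maxn N M) => m; rewrite geq_max => /andP[Nm Mm].
have [y Ky xy] := hN _ (leq_trans Nm (idxP m)).
have [y' K'y' yy'] := KK' m y Ky; exists y' => //.
have yx : nrm y <= nrm x + 1.
  have := nrmB x (x - y); rewrite subKr; lra.
have : nrm y / 2 ^+ m <= (nrm x + 1) / 2 ^+ m.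
  by rewrite ler_wpM2r // invr_ge0 exprn_ge0.
have := hM m Mm; have := nrm_triangle y x y'; rewrite (nrmBC y y'); lra.
Qed.

Lemma liminf_seq K (xs : seq A) (d : R) : 0 < d ->
  (forall x, x \in xs -> liminf_algebra K x) ->
  exists N, forall n, (N <= n)%N -> forall x, x \in xs -> exists2 y, K n y & nrm (y - x) <= d.
Proof.
move=> d0; elim: xs => [|a xs IH] Kxs; first by exists 0%N.
have [|N hN] := IH; first by move=> x xxs; apply: Kxs; rewrite inE xxs orbT.
have [M hM] := Kxs a (mem_head _ _) d d0.
exists (maxn N M) => n; rewrite geq_max => /andP[/hN h1 /hM[y Ky ay]] x.
rewrite inE => /orP[/eqP ->|/h1//]; exists y => //.
by rewrite nrmBC ltW.
Qed.

Definition in_corner f x := f ** x = x /\ x ** f = x.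

Lemma in_cornerE f x : projection f -> in_corner f (f ** x ** f).
Proof. by move=> [_ ff]; split; rewrite ?cmulA ?ff // -cmulA ff. Qed.

Lemma corner_subalgebra f : projection f -> cstar_subalgebra (in_corner f).
Proof.
move=> [sf ff]; split.
- by rewrite /in_corner cmulx0 cmul0x.
- by move=> x y [fx xf] [fy yf]; split; rewrite ?cmulDr ?cmulDl ?fx ?xf ?fy ?yf.
- by move=> c x [fx xf]; split; rewrite ?cmulZr ?cmulZl ?fx ?xf.
- by move=> x y [fx xf] [fy yf]; split; rewrite ?cmulA ?fx // -cmulA yf.
- by move=> x [fx xf]; split; rewrite -{1}sf -starM ?fx ?xf.
apply: closedP => x h; split; apply/eqP; rewrite -subr_eq0; apply/eqP.
  apply: (@nrm_linear_eq0 _ _ _ (nrm f + 1)) => e e0 _; have [y [fy _] xy] := h e e0.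
  have -> : f ** x - x = f ** (x - y) - (x - y) by rewrite cmulBr fy; nuring.
  apply: le_trans (nrmB _ _) _; have := nrmM f (x - y); have := nrm_ge0 f; nra.
apply: (@nrm_linear_eq0 _ _ _ (nrm f + 1)) => e e0 _; have [y [_ yf] xy] := h e e0.
have -> : x ** f - x = (x - y) ** f - (x - y) by rewrite cmulBl yf; nuring.
apply: le_trans (nrmB _ _) _; have := nrmM (x - y) f; have := nrm_ge0 f; nra.
Qed.

(** E' is U* E U for the unitary of [unitary_perturbation]: U D U* inside E says that D is inside
    E', and a U within eps / 2 of f moves y by at most eps |y|. The tolerance and the test elements
    are fixed before [f] and [E]. *)
Lemma absorb D u : fd_algebra D -> projection u -> D u -> D `<=` in_corner u ->
  forall eps : R, 0 < eps -> exists2 del : R, 0 < del &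
  exists xs : seq A, (forall x, x \in xs -> D x) /\
  forall f E, projection f -> f ** u = u -> fd_algebra E -> E f -> E `<=` in_corner f ->
    (forall x, x \in xs -> exists2 y, E y & nrm (y - x) <= del) ->
  exists E', [/\ fd_algebra E', E' f, E' `<=` in_corner f, D `<=` E' &
    forall y, E y -> exists2 y', E' y' & nrm (y' - y) <= nrm y * eps].
Proof.
move=> fdD pu Du uD eps eps0; have eps2 : 0 < eps / 2 by rewrite divr_gt0.
have [del del0 [xs [xsD h]]] := unitary_perturbation fdD pu Du uD eps2.
exists del => //; exists xs; split=> // f E pf fu fdE Ef fE near.
have [U [Us Ur Uf UD]] := h f E pf fu fdE.1 Ef fE near.
have [sf ff] := pf; have U1 := nrm_partial_isometry pf Us.
have Uf1 := source_projection pf Us; have fU := range_projection pf Ur.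
have uf : u ** f = u by rewrite -[LHS]starK starM sf pu.1 fu pu.1.
have sUf : f ** star U = star U by rewrite -{1}sf -starM Uf1.
have fsU : star U ** f = star U by rewrite -{1}sf -starM fU.
exists [set star U ** y ** U | y in E]; split.
- apply: fd_algebra_image => // [x y|c x|x|x y Ex Ey].
  + by rewrite cmulDr cmulDl.
  + by rewrite cmulZr cmulZl.
  + by rewrite !starM starK cmulA.
  + exists (x ** y); first exact: (cstar_subalgebraM fdE.1).
    rewrite !cmulA -(cmulA _ U) Ur -[in LHS](cmulA (star U) x f).
    by rewrite (fE x Ex).2.
- by exists f => //; rewrite fsU Us.
- by move=> _ [y Ey <-]; split; rewrite ?cmulA ?sUf // -cmulA Uf1.
- move=> x Dx; have [ux xu] := uD x Dx; exists (U ** x ** star U); first exact: UD.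
  rewrite !cmulA Us -cmulA Us -{1}ux -{1}xu !cmulA fu -!cmulA uf xu ux //.
move=> y Ey; exists (star U ** y ** U); first by exists y.
have -> : star U ** y ** U - y = star (U - f) ** y ** U + y ** (U - f).
  by rewrite starB sf cmulBr (fE y Ey).2 !cmulBl (fE y Ey).1; nuring.
have sU : nrm (star (U - f)) <= eps / 2 by rewrite nrm_star.
apply: le_trans (nrmD _ _) _.
have := nrm_contractr U1 (nrm_cmul_le sU (lexx (nrm y))).
have := nrm_cmul_le (lexx (nrm y)) Uf; lra.
Qed.

Lemma fd_algebra_line p : projection p -> fd_algebra (lspan [:: p]).
Proof.
move=> [sp pp]; apply: lspan_fd_algebra => [a b|a]; rewrite !inE.
  by move=> /eqP-> /eqP->; rewrite pp; apply: lspan_mem; rewrite mem_head.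
by move=> /eqP->; rewrite sp; apply: lspan_mem; rewrite mem_head.
Qed.

Lemma line_in_corner p : projection p -> lspan [:: p] `<=` in_corner p.
Proof.
move=> pp; apply: lspan_min; first exact/cstar_subspace/corner_subalgebra.
by move=> a; rewrite inE => /eqP->; rewrite /in_corner pp.2.
Qed.

(** Nesting is not asked for, so members can be perturbed separately; each must contain [f], the
    unit with respect to which perturbing unitaries are taken. *)
Definition approximable_corner f := exists K,
  (forall n, [/\ fd_algebra (K n), K n f & K n `<=` in_corner f]) /\
  forall x, liminf_algebra K (f ** x ** f).

(** A late member of [K] is conjugated so as to contain [D]. An element of [xs] is first
    approximated within eps by y, then y moves by eps |y| <= eps (|x| + eps), which gives the stated
    error. *)
Lemma approximable_absorb f D u K N (eps : R) : projection f ->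
  (forall n, [/\ fd_algebra (K n), K n f & K n `<=` in_corner f]) ->
  (forall x, liminf_algebra K (f ** x ** f)) ->
  fd_algebra D -> projection u -> D u -> D `<=` in_corner u -> f ** u = u -> 0 < eps ->
  forall xs : seq A, (forall x, x \in xs -> in_corner f x) ->
  exists n (K' : set A), [/\ (N <= n)%N, [/\ fd_algebra K', K' f & K' `<=` in_corner f], D `<=` K',
    forall y, K n y -> exists2 y', K' y' & nrm (y' - y) <= nrm y * eps &
    forall x, x \in xs -> exists2 y, K' y & nrm (y - x) <= eps * (nrm x + eps + 1)].
Proof.
move=> pf KP limK fdD pu Du uD fu eps0 xs xsf.
have uf : u ** f = u by rewrite -[LHS]starK starM pf.1 pu.1 fu pu.1.
have [del del0 [ys [ysD h]]] := absorb fdD pu Du uD eps0.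
have inlim x : in_corner f x -> liminf_algebra K x.
  by move=> [fx xf]; have := limK x; rewrite fx xf.
have [|M1 hM1] := @liminf_seq K ys del del0.
  move=> y /ysD/uD[uy yu]; apply: inlim; split.
    by rewrite -uy cmulA fu.
  by rewrite -yu -cmulA uf.
have [|M2 hM2] := @liminf_seq K xs eps eps0; first by move=> x /xsf/inlim.
pose n := maxn N (maxn M1 M2).
have [Nn M1n M2n] : [/\ (N <= n)%N, (M1 <= n)%N & (M2 <= n)%N].
  by rewrite !leq_max !leqnn !orbT.
have [fdK Kf Kc] := KP n.
have [K' [fdK' K'f K'c DK' K'n]] := h f (K n) pf fu fdK Kf Kc (hM1 n M1n).
exists n, K'; split=> // x xxs.
have [y Ky yx] := hM2 n M2n x xxs; have [y' K'y' y'y] := K'n y Ky.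
exists y' => //; have := nrm_triangle y y' x.
have : nrm y <= nrm x + eps by have := nrmD (y - x) x; rewrite subrK; lra.
have := nrm_ge0 y; nra.
Qed.

End Approximation.

(** * Enlarging an approximable corner *)

Section Corners.
Variables (R : realType) (A : cstarAlgType R).
Implicit Types (x y z p q f g u : A) (E D S : set A).

Lemma incr_subset (F : nat -> set A) n m : (forall i, F i `<=` F i.+1) ->
  (n <= m)%N -> F n `<=` F m.
Proof.
move=> Finc /subnKC <-; elim: (m - n)%N => [|k IH]; first by rewrite addn0.
by rewrite addnS; apply: subset_trans IH _; exact: Finc.
Qed.

Lemma corner_in_corner p x : projection p -> corner p x <-> in_corner p x.
Proof.
move=> pp; split=> [[a _ <-]|[px xp]]; first exact: in_cornerE.
by exists x => //; rewrite px xp.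
Qed.

Lemma AF_approximable p : projection p -> AF (corner p) -> approximable_corner p.
Proof.
move=> pp [F [Ffd Finc Fcl]].
have Fp n : F n `<=` in_corner p.
  move=> x Fx; apply/(corner_in_corner _ pp); rewrite -Fcl.
  by apply: subset_closure; exists n.
(* The algebras [F n] need not contain [p], so it is adjoined as a unit. *)
exists (fun n => [set x | exists c, F n (x - c *: p)]); split=> [n|x e e0].
  split.
  - by apply: fd_algebra_unit => //; exact: Fp.
  - by exists 1; rewrite scale1r subrr; exact: (cstar_subalgebra0 (Ffd n).1).
  - move=> x [c /Fp xc]; rewrite -(subrK (c *: p) x).
    have pS := corner_subalgebra pp; apply: (cstar_subalgebraD pS) => //.
    apply: (cstar_subalgebraZ pS).
    by rewrite /in_corner pp.2.
have : closure (\bigcup_n F n) (p ** x ** p) by rewrite Fcl; exists x.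
move=> /closureP/(_ e e0)[y [N _ Fy] xy]; exists N => n Nn.
exists y => //; exists 0; rewrite scale0r subr0.
exact: incr_subset Fy.
Qed.

Lemma half_pow_gt0 m : 0 < 2^-1 ^+ m :> R.
Proof. by rewrite exprn_gt0 // invr_gt0. Qed.

(** The algebra to be contained may change with m; the relative error 2^-m at stage m leaves the
    limits intact. *)
Lemma approximable_absorb_seq f (K D : nat -> set A) (u : nat -> A) :
  projection f ->
  (forall n, [/\ fd_algebra (K n), K n f & K n `<=` in_corner f]) ->
  (forall x, liminf_algebra K (f ** x ** f)) ->
  (forall m, fd_algebra (D m)) -> (forall m, projection (u m)) ->
  (forall m, D m (u m)) -> (forall m, D m `<=` in_corner (u m)) ->
  (forall m, f ** u m = u m) ->
  exists K' : nat -> set A,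
    [/\ forall m, [/\ fd_algebra (K' m), K' m f & K' m `<=` in_corner f],
        forall m, D m `<=` K' m &
        forall x, liminf_algebra K' (f ** x ** f)].
Proof.
move=> pf KP limK fdD pu Du uD fu.
have /choice[idx /choice[K' hK']] m : exists n, exists E : set A, [/\ (m <= n)%N,
    [/\ fd_algebra E, E f & E `<=` in_corner f], D m `<=` E &
    forall y, K n y -> exists2 y', E y' & nrm (y' - y) <= nrm y * 2^-1 ^+ m].
  have [|n [E [mn EP DE KE _]]] := approximable_absorb m pf KP limK (fdD m) (pu m) (Du m)
    (uD m) (fu m) (half_pow_gt0 m) (xs := [::]); first by [].
  by exists n, E.
exists K'; split.
- by move=> m; have [] := hK' m.
- by move=> m; have [] := hK' m.
move=> x; apply: (liminf_transfer (idx := idx) _ _ (limK x)).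
  by move=> m; have [] := hK' m.
by move=> m y Ky; have [_ _ _ /(_ y Ky)[y' K'y' yy']] := hK' m;
  exists y' => //; rewrite -exprVn.
Qed.

Lemma projection_add p q : projection p -> projection q -> p ** q = 0 ->
  projection (p + q).
Proof.
move=> [sp pp] [sq qq] pq; have qp : q ** p = 0 by rewrite -sp -sq -starM pq star0.
by split; rewrite ?starD ?sp ?sq // cmulDl !cmulDr pp qq pq qp addr0 add0r.
Qed.

Lemma in_corner_le f u x : projection f -> projection u -> f ** u = u ->
  in_corner u x -> in_corner f x.
Proof.
move=> pf pu fu [ux xu].
have uf : u ** f = u by rewrite -[LHS]starK starM pf.1 pu.1 fu pu.1.
by split; [rewrite -ux cmulA fu|rewrite -xu -cmulA uf].
Qed.

(** [x] carries the subprojection r = x* x of g onto r' = x x*, orthogonal to g. Approximants of the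
    corner of g are made to contain r and are glued along r to the algebra spanned by x, x*, r and
    r'. *)
Lemma approximable_add_range g x : projection g -> g ** x = 0 -> x ** g = x ->
  x ** star x ** x = x -> approximable_corner g -> approximable_corner (g + x ** star x).
Proof.
move=> pg gx xg xxx [K [KP limK]].
pose r := star x ** x; pose r' := x ** star x.
have [sg gg] := pg.
have gsx : g ** star x = star x by rewrite -{1}sg -starM xg.
have sxg : star x ** g = 0 by rewrite -{1}sg -starM gx star0.
have xx : x ** x = 0 by rewrite -{1}xg -cmulA gx cmulx0.
have sxx : star x ** star x = 0 by rewrite -starM xx star0.
have sxxx : star x ** x ** star x = star x by rewrite -[in RHS]xxx !starM starK cmulA.
have pr : projection r by split; rewrite /r ?starM_self // cmulA sxxx.
have pr' : projection r' by split; rewrite /r' ?starM ?starK // cmulA xxx.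
have gr : g ** r = r by rewrite /r cmulA gsx.
have gr' : g ** r' = 0 by rewrite /r' cmulA gx cmul0x.
have pg' := projection_add pg pr' gr'.
have gg' : (g + r') ** g = g.
  by rewrite cmulDl gg /r' -cmulA sxg cmulx0 addr0.
have [K' [K'P rK' limK']] := approximable_absorb_seq pg KP limK
  (fun=> fd_algebra_line pr) (fun=> pr)
  (fun=> lspan_mem (mem_head r [::])) (fun=> line_in_corner pr) (fun=> gr).
have K'r m : K' m r by apply: rK'; apply: lspan_mem; rewrite mem_head.
(* Unless x = 0 these are 2 by 2 matrix units, with r, r' and x in the roles of e_11, e_22 and
   e_21. *)
pose D := lspan [:: x; star x; r; r'].
have Dx a : a \in [:: x; star x; r; r'] -> D a by exact: lspan_mem.
have sD := lspan_subspace [:: x; star x; r; r'].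
have D0 : D 0 := subspace0 sD.
have rx : r ** x = 0 by rewrite /r -cmulA xx cmulx0.
have xr : x ** r = x by rewrite /r cmulA xxx.
have r'x : r' ** x = x by rewrite /r' xxx.
have xr' : x ** r' = 0 by rewrite /r' cmulA xx cmul0x.
have srx : r ** star x = star x by rewrite /r sxxx.
have sxr : star x ** r = 0 by rewrite /r cmulA sxx cmul0x.
have r'sx : r' ** star x = 0 by rewrite /r' -cmulA sxx cmulx0.
have sxr' : star x ** r' = star x by rewrite /r' cmulA sxxx.
have rr' : r ** r' = 0 by rewrite /r' cmulA rx cmul0x.
have r'r : r' ** r = 0 by rewrite /r' -cmulA sxr cmulx0.
have fdD : fd_algebra D.
  apply: lspan_fd_algebra => [a b|a]; last first.
    by rewrite !inE => /or4P[] /eqP->; rewrite ?starK ?pr.1 ?pr'.1;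
      apply: Dx; rewrite !inE eqxx ?orbT.
  by rewrite !inE => /or4P[] /eqP-> /or4P[] /eqP->;
    rewrite ?xx ?sxx ?rx ?xr ?r'x ?xr' ?srx ?sxr ?r'sx ?sxr' ?rr' ?r'r ?pr.2 ?pr'.2 -/r -/r' //;
    apply: Dx; rewrite !inE eqxx ?orbT.
(* [D] meets the corner of g only through r, which is the compatibility required for gluing. *)
have dg d : D d -> d ** g = d ** r.
  move: d; apply: lspan_min.
    split=> [|y z|c y] /=; first by rewrite !cmul0x.
      by rewrite !cmulDl => -> ->.
    by rewrite !cmulZl => ->.
  move=> a; rewrite !inE => /or4P[] /eqP-> /=.
  - by rewrite xg /r cmulA xxx.
  - by rewrite sxg /r cmulA sxx cmul0x.
  - by rewrite pr.2 /r -cmulA xg.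
  - by rewrite /r' /r -cmulA sxg -cmulA (cmulA (star x)) sxx cmul0x !cmulx0.
have K'sub m : linear_subspace (K' m).
  by have [fdK' _ _] := K'P m; exact: (cstar_subspace fdK'.1).
have /choice[G GP] m : exists G, [/\ fd_algebra G, D `<=` G, K' m `<=` G &
    G `<=` in_corner (g + r')].
  have [fdK' K'g K'c] := K'P m.
  have [||||G [fdG DG KG Gmin]] := fd_algebra_glue fdD fdK' (proj1 pr).
  - move=> d e Dd K'e; rewrite -[in LHS](K'c e K'e).1 cmulA.
    by rewrite dg.
  - by apply: Dx; rewrite !inE eqxx ?orbT.
  - exact: K'r.
  - apply: lspan_min.
      split=> [|y z|c y] /=; rewrite ?cmulx0 ?cmul0x.
      + exact: subspace0.
      + by rewrite cmulDr cmulDl; exact: subspaceD.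
      + by rewrite cmulZr cmulZl; exact: subspaceZ.
    move=> a; rewrite !inE => /or4P[] /eqP-> /=.
    + by rewrite rx cmul0x; exact: subspace0.
    + by rewrite -cmulA sxr cmulx0; exact: subspace0.
    + by rewrite !pr.2.
    + by rewrite rr' cmul0x; exact: subspace0.
  exists G; split=> //; apply: Gmin; first exact: corner_subalgebra.
    apply: lspan_min; first exact/cstar_subspace/corner_subalgebra.
    have xc : in_corner (g + r') x.
      by split; rewrite ?cmulDl ?cmulDr ?gx ?add0r /r' ?xxx // xg cmulA xx cmul0x addr0.
    have C := corner_subalgebra pg'.
    have sxc := cstar_subalgebra_star C xc.
    move=> a; rewrite !inE => /or4P[] /eqP-> //; exact: cstar_subalgebraM.
  by move=> y K'y; apply: in_corner_le (K'c y K'y).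
exists G; split=> [m|y].
  have [fdG DG KG Gc] := GP m; have [_ K'g _] := K'P m; split=> //.
  apply: (cstar_subalgebraD fdG.1); first exact: KG.
  by apply: DG; apply: Dx; rewrite !inE eqxx ?orbT.
have GM m a b : G m a -> G m b -> G m (a ** b).
  by have [fdG _ _ _] := GP m; exact: (cstar_subalgebraM fdG.1).
have Gx m : G m x by have [_ DG _ _] := GP m; apply: DG; apply: Dx; rewrite mem_head.
have Gsx m : G m (star x) by have [fdG _ _ _] := GP m; exact: (cstar_subalgebra_star fdG.1).
have KG m a : K' m a -> G m a by have [_ _ KG _] := GP m; exact: KG.
have Gg m : G m g by have [_ K'g _] := K'P m; exact: KG.
have Glim : linear_subspace (liminf_algebra G).
  by apply: liminf_subspace => m; have [fdG _ _ _] := GP m; exact: (cstar_subspace fdG.1).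
have mm a b z : (forall m, G m a) -> (forall m, G m b) ->
    liminf_algebra G (a ** (g ** z ** g) ** b).
  move=> Ga Gb; apply: liminf_mulmul (limK' z) => m c /KG Gc.
  by apply: (GM) => //; exact: GM.
(* The four blocks of y; writing r' as x x* brings the middle of each into the corner of g. *)
have -> : (g + r') ** y ** (g + r') = g ** (g ** y ** g) ** g + x ** (g ** (star x ** y) ** g) ** g
    + g ** (g ** (y ** x) ** g) ** star x + x ** (g ** (star x ** y ** x) ** g) ** star x.
  have -> : g ** (g ** y ** g) ** g = g ** y ** g by rewrite !cmulA gg -cmulA gg.
  have -> : x ** (g ** (star x ** y) ** g) ** g = r' ** y ** g.
    by rewrite !cmulA xg -cmulA gg.
  have -> : g ** (g ** (y ** x) ** g) ** star x = g ** y ** r'.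
    by rewrite !cmulA gg -(cmulA _ g) gsx.
  have -> : x ** (g ** (star x ** y ** x) ** g) ** star x = r' ** y ** r'.
    by rewrite !cmulA xg -(cmulA _ g) gsx.
  by nuring.
by do 3?[apply: (subspaceD Glim)]; exact: mm.
Qed.

End Corners.

(** * Gluing corners *)

Section Gluing.
Variables (R : realType) (A : cstarAlgType R).
Implicit Types (x y z p q f g : A) (E D S : set A).

(** The block f x f is approximated in [D m], and (f + p) x p in [E m]. The corner of r_m + p
    changes with m, so [E m] is only asked to approximate the finitely many compressed u_j with j <
    m, up to an error of order 2^-m; density of the span of the u_j does the rest. *)
Lemma approximable_add f p (r u : nat -> A) : projection f -> projection p ->
  f ** p = 0 -> (forall m, projection (r m)) -> (forall m, f ** r m = r m) ->
  approximable_corner f -> (forall m, approximable_corner (r m + p)) ->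
  (forall S, linear_subspace S -> closed S -> (forall j, S (u j)) -> forall x, S x) ->
  (forall j m, (j < m)%N -> r m ** (f ** u j ** p) = f ** u j ** p) ->
  approximable_corner (f + p).
Proof.
move=> pf pp fp pr fr [F [FP limF]] Hr dense ru.
have [sf ff] := pf; have [sp p2] := pp.
have pf0 : p ** f = 0 by rewrite -sp -sf -starM fp star0.
have rf m : r m ** f = r m by rewrite -[LHS]starK starM sf (pr m).1 fr (pr m).1.
have rp m : r m ** p = 0 by rewrite -rf -cmulA fp cmulx0.
have pr0 m : p ** r m = 0 by rewrite -fr cmulA pf0 cmul0x.
have pfp := projection_add pf pp fp.
have prp m := projection_add (pr m) pp (rp m).
have [D [DP rD limD]] := approximable_absorb_seq pf FP limF
  (fun m => fd_algebra_line (pr m)) pr (fun m => lspan_mem (mem_head (r m) [::]))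
  (fun m => line_in_corner (pr m)) fr.
have Dr m : D m (r m) by apply: rD; apply: lspan_mem; rewrite mem_head.
have DM m x y : D m x -> D m y -> D m (x ** y).
  by have [fdD _ _] := DP m; exact: (cstar_subalgebraM fdD.1).
pose C m := [set r m ** d ** r m | d in D m].
have fdC m : fd_algebra (C m).
  have [fdD _ _] := DP m; apply: fd_algebra_image => // [x y|c x|x|x y Dx Dy].
  - by rewrite cmulDr cmulDl.
  - by rewrite cmulZr cmulZl.
  - by rewrite !starM (pr m).1 cmulA.
  - exists (x ** r m ** y); first by do 2?[apply: (DM)].
    by rewrite !cmulA -(cmulA _ (r m) (r m)) (pr m).2.
pose C' m := [set x | exists c, C m (x - c *: (r m + p))].
have fdC' m : fd_algebra (C' m).
  apply: fd_algebra_unit => // _ [d Dd <-]; split.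
    by rewrite !cmulA cmulDl (pr m).2 pr0 addr0.
  by rewrite -cmulA cmulDr (pr m).2 rp addr0.
have C0 m : C m 0 by exact: (cstar_subalgebra0 (fdC m).1).
have CC' m x : C m x -> C' m x by move=> Cx; exists 0; rewrite scale0r subr0.
have C'r m : C' m (r m).
  by apply: CC'; exists (r m) => //; rewrite !(pr m).2.
have C'rp m : C' m (r m + p) by exists 1; rewrite scale1r subrr.
have C'p m : C' m p.
  have -> : p = (r m + p) - r m by nuring.
  exact: cstar_subalgebraB (fdC' m).1 (C'rp m) (C'r m).
have C'c m : C' m `<=` in_corner (r m + p).
  have Sc := corner_subalgebra (prp m).
  have rc : in_corner (r m + p) (r m + p) by rewrite /in_corner (prp m).2.
  move=> x [c [d Dd xd]]; rewrite -(subrK (c *: (r m + p)) x) -xd.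
  apply: (cstar_subalgebraD Sc); last exact: (cstar_subalgebraZ Sc).
  split; first by rewrite !cmulA cmulDl (pr m).2 pr0 addr0.
  by rewrite -cmulA cmulDr (pr m).2 rp addr0.
(* For m > j this no longer depends on m: it is (f + p) u_j p, because r_m fixes f u_j p. *)
pose v j m := (r m + p) ** u j ** p.
have vc j m : in_corner (r m + p) (v j m).
  split; first by rewrite !cmulA (prp m).2.
  by rewrite -cmulA cmulDr pr0 p2 add0r.
have /choice[E EP] m : exists E, [/\ fd_algebra E, E `<=` in_corner (r m + p), C' m `<=` E &
    forall j, (j < m)%N -> exists2 y, E y &
      nrm (y - v j m) <= 2^-1 ^+ m * (nrm (v j m) + 2^-1 ^+ m + 1)].
  have [H [HP limH]] := Hr m.
  have [|n [E [_ [fdE _ Ec] CE _ Ev]]] := approximable_absorb 0 (prp m) HP limH (fdC' m)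
    (prp m) (C'rp m) (C'c m) (prp m).2 (half_pow_gt0 R m)
    (xs := [seq v j m | j <- iota 0 m]).
    by move=> _ /mapP[j _ ->].
  exists E; split=> // j jm; apply: Ev; apply: map_f.
  by rewrite mem_iota.
have /choice[K KP] m : exists K, [/\ fd_algebra K, D m `<=` K, E m `<=` K &
    K `<=` in_corner (f + p)].
  have [fdD Df Dc] := DP m; have [fdE Ec CE _] := EP m.
  have [||||K [fdK DK EK Kmin]] := fd_algebra_glue fdD fdE (proj1 (pr m)).
  - move=> d e /Dc[_ df] /Ec[ec _]; rewrite -{1}ec cmulA cmulDr.
    by rewrite -{2}df -(cmulA d) fp cmulx0 addr0.
  - exact: Dr.
  - exact/CE.
  - by move=> d Dd; apply/CE/CC'; exists d.
  exists K; split=> //; apply: Kmin; first exact: corner_subalgebra.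
    move=> x /Dc; apply: in_corner_le => //.
    by rewrite cmulDl ff pf0 addr0.
  move=> x /Ec; apply: in_corner_le => //.
  by rewrite cmulDl !cmulDr fr fp pr0 p2 addr0 add0r.
exists K; split=> [m|].
  have [fdK DK EK Kc] := KP m; have [_ Df _] := DP m; split=> //.
  apply: (cstar_subalgebraD fdK.1); first exact: DK.
  by apply: EK; have [_ _ CE _] := EP m; exact: CE.
have sK m : linear_subspace (K m).
  by have [fdK _ _ _] := KP m; exact: (cstar_subspace fdK.1).
have limS := liminf_subspace sK.
have limp x : liminf_algebra K ((f + p) ** x ** p).
  move: x; apply: dense => /=.
  - split=> [|x y|c x]; rewrite ?cmulx0 ?cmul0x.
    + exact: subspace0.
    + by rewrite cmulDr cmulDl; exact: subspaceD.
    + by rewrite cmulZr cmulZl; exact: subspaceZ.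
  - apply: closedP => x h; apply: liminf_closed => e /h[y Ky xy].
    exists ((f + p) ** y ** p) => //; rewrite -cmulBl -cmulBr.
    apply: le_lt_trans xy; apply: nrm_contractr; first exact: nrm_proj.
    by apply: nrm_contractl; first exact: nrm_proj.
  move=> j e e0; pose x := (f + p) ** u j ** p.
  have x2 : 0 <= nrm x + 2 by rewrite addr_ge0 ?nrm_ge0.
  have [N hN] := half_pow_small x2 e0.
  exists (maxn N j.+1) => m; rewrite geq_max => /andP[/hN me jm].
  have vx : v j m = x.
    rewrite /v /x !cmulDl; congr (_ + _).
    by rewrite -(ru j m jm) !cmulA rf.
  have [_ _ _ /(_ j jm)] := EP m; rewrite vx => -[y Ey yx].
  exists y; first by have [_ _ EK _] := KP m; exact: EK.
  rewrite nrmBC; apply: le_lt_trans yx _; apply: le_lt_trans me.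
  rewrite mulrC -exprVn ler_wpM2r ?(ltW (half_pow_gt0 R m)) //.
  have : 2^-1 ^+ m <= 1 :> R by rewrite exprn_ile1 ?invr_ge0 ?invf_le1 ?ler1n.
  lra.
move=> x.
(* The remaining block p x f is the adjoint of f x* p. *)
have -> : (f + p) ** x ** (f + p) =
    f ** x ** f + (f + p) ** x ** p + star ((f + p) ** (f ** star x ** p) ** p).
  have -> : star ((f + p) ** (f ** star x ** p) ** p) = p ** x ** f.
    rewrite !cmulA cmulDl ff pf0 addr0 -cmulA p2 !starM starK sf sp.
    by rewrite cmulA.
  by nuring.
apply: (subspaceD limS); last first.
  apply: liminf_star => // m y Ky.
  by have [fdK _ _ _] := KP m; exact: (cstar_subalgebra_star fdK.1).
apply: (subspaceD limS) => //; apply: liminf_mono (limD x) _ => m.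
by have [_ DK _ _] := KP m.
Qed.

(** Each algebra constructed so far is absorbed into a conjugate of some later [K n]; this yields
    nested algebras with unchanged limits. *)
Lemma AF_of_corners (P : nat -> A) (K : nat -> set A) :
  (forall n, projection (P n)) -> (forall n m, (n <= m)%N -> P m ** P n = P n) ->
  (forall n, [/\ fd_algebra (K n), K n (P n) & K n `<=` in_corner (P n)]) ->
  (forall x, liminf_algebra K x) -> AF [set: A].
Proof.
move=> pP Pinc KP limK.
(* A state holds the stage [s.1], which fixes the error 2^-[s.1], the index [s.2.1] of the corner,
   and the current algebra [s.2.2]. *)
pose good (s : nat * (nat * set A)) :=
  [/\ fd_algebra s.2.2, s.2.2 (P s.2.1) & s.2.2 `<=` in_corner (P s.2.1)].
pose rel (s s' : nat * (nat * set A)) := [/\ (s.1 <= s'.2.1)%N, s.2.2 `<=` s'.2.2 &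
  forall y, K s'.2.1 y -> exists2 y', s'.2.2 y' & nrm (y' - y) <= nrm y / 2 ^+ s.1].
have /choice[next nextP] s : exists s', s'.1 = s.1.+1 /\ (good s -> good s' /\ rel s s').
  have [gs|] := pselect (good s); last by exists (s.1.+1, s.2).
  have [fdD DPn Dc] := gs.
  have [del del0 [xs [xsD h]]] := absorb fdD (pP _) DPn Dc (half_pow_gt0 R s.1).
  have [N hN] := liminf_seq del0 (fun x (_ : x \in xs) => limK x).
  pose n := maxn N (maxn s.1 s.2.1).
  have [Nn s1n s2n] : [/\ (N <= n)%N, (s.1 <= n)%N & (s.2.1 <= n)%N].
    by rewrite !leq_max !leqnn !orbT.
  have [fdK KPn Kc] := KP n.
  have [E [fdE EPn Ec DE KE]] := h (P n) (K n) (pP n) (Pinc _ _ s2n) fdK KPn Kc (hN n Nn).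
  exists (s.1.+1, (n, E)); split=> // _; split=> //; split=> //= y /KE[y' Ey' yy'].
  by exists y' => //; rewrite -exprVn.
pose sq i := iter i next (0%N, (0%N, K 0%N)).
have sq1 i : (sq i).1 = i by elim: i => //= i IH; rewrite (nextP _).1 IH.
have good_sq i : good (sq i).
  elim: i => [|i IH]; first by have := KP 0%N.
  by have [] := (nextP (sq i)).2 IH.
have rel_sq i : rel (sq i) (sq i.+1) by have [] := (nextP (sq i)).2 (good_sq i).
exists (fun i => (sq i).2.2); split.
- by move=> n; have [] := good_sq n.
- by move=> n; have [] := rel_sq n.
apply/seteqP; split=> // x _; apply/closureP => e e0.
have : liminf_algebra (fun i => (sq i.+1).2.2) x.
  apply: (liminf_transfer (idx := fun i => (sq i.+1).2.1) _ _ (limK x)).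
    by move=> m; have [+ _ _] := rel_sq m; rewrite sq1.
  by move=> m y Ky; have [_ _ /(_ y Ky)] := rel_sq m; rewrite sq1.
move=> /(_ e e0)[N /(_ N (leqnn N))[y Dy xy]].
by exists y => //; exists N.+1.
Qed.

Lemma AF_corner p : projection p -> AF [set: A] -> AF (corner p).
Proof.
move=> pp [F [Ffd Finc Fcl]].
(* 1/100 is below the threshold 1/32 of [proj_near], and 17/100 is below the threshold 1/4 of
   [projections_near_equiv]. *)
have c0 : 0 < 100^-1 :> R by rewrite invr_gt0.
have : closure (\bigcup_n F n) p by rewrite Fcl.
move=> /closureP/(_ _ c0)[a [N _ Fa] pa].
have ap : nrm (a - p) <= 100^-1 by rewrite nrmBC ltW.
have [|q [Fq pq qp]] := proj_near (Ffd N).1 Fa pp ap; first by lra.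
have [||w [ws wr _]] := @projections_near_equiv _ _ p q (17 / 100) pp pq.
- by rewrite nrmBC; lra.
- lra.
have wq := source_projection pq ws; have pw := range_projection pp wr.
have qw : q ** star w = star w by rewrite -{1}pq.1 -starM wq.
have wp : star w ** p = star w by rewrite -{1}pp.1 -starM pw.
have w1 := nrm_partial_isometry pq ws.
have sw1 : nrm (star w) <= 1 by rewrite nrm_star.
(* Starting at N puts q in every member, so the product of the images of x and y is the image of x q
   y. *)
exists (fun n => [set w ** y ** star w | y in F (N + n)%N]); split.
- move=> n; apply: fd_algebra_image => // [x y|c x|x|x y Fx Fy].
  + by rewrite cmulDr cmulDl.
  + by rewrite cmulZr cmulZl.
  + by rewrite !starM starK cmulA.
  have FM := cstar_subalgebraM (Ffd (N + n)%N).1.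
  exists (x ** q ** y).
    by do 2?[apply: (FM)] => //; exact: incr_subset (leq_addr _ _) _ Fq.
  by rewrite !cmulA -(cmulA _ (star w) w) ws.
- by move=> n _ [y Fy <-]; exists y => //; rewrite addnS; exact: Finc.
apply/seteqP; split=> x.
  move=> /closureP h; apply/corner_in_corner => //.
  apply: closed_approx; first exact: cstar_subalgebra_closed (corner_subalgebra pp).
  move=> e /h[_ [n _ [y _ <-]] xy]; exists (w ** y ** star w) => //.
  by split; rewrite ?cmulA ?pw // -cmulA wp.
move=> /(corner_in_corner _ pp)[px xp]; apply/closureP => e e0.
have : closure (\bigcup_n F n) (star w ** x ** w) by rewrite Fcl.
move=> /closureP/(_ e e0)[y [n _ Fy] xy].
exists (w ** y ** star w).
  exists n => //; exists y => //; exact: incr_subset (leq_addl _ _) _ Fy.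
have -> : x - w ** y ** star w = w ** (star w ** x ** w - y) ** star w.
  by rewrite cmulBr cmulBl !cmulA wr px -(cmulA _ w) wr xp.
by apply: le_lt_trans xy; apply: nrm_contractr => //; exact: nrm_contractl.
Qed.

End Gluing.

(** * Cuntz-Krieger families *)

Section RangeSupremum.
Variables (R : realType) (A : cstarAlgType R).
Implicit Types (p f : A).

(** For the commuting projections c_j = a_j a_j* the supremum is built by r_(m+1) = r_m + c_m - r_m
    c_m. Commutation of r_m with every c_j is carried through the induction, since it makes the next
    r a projection. *)
Lemma exists_range_supremum f p (a : nat -> A) : projection f -> projection p ->
  f ** p = 0 -> (forall j, f ** a j = a j) -> (forall j, a j ** p = a j) ->
  (forall j, a j ** star (a j) ** a j = a j) ->
  (forall i j, a i ** star (a i) ** (a j ** star (a j)) =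
    a j ** star (a j) ** (a i ** star (a i))) ->
  approximable_corner p ->
  exists r : nat -> A, [/\ forall m, projection (r m), forall m, f ** r m = r m,
    forall m, approximable_corner (r m + p) &
    forall j m, (j < m)%N -> r m ** a j = a j].
Proof.
move=> pf pp fp fa ap aaa cc app; have [sf ff] := pf; have [sp p2] := pp.
have pf0 : p ** f = 0 by rewrite -sp -sf -starM fp star0.
pose c j := a j ** star (a j); pose r := nat_rect (fun=> A) 0 (fun m s => s + (c m - s ** c m)).
have sc j : star (c j) = c j by rewrite /c starM starK.
have ca j : c j ** a j = a j by exact: aaa.
have c2 j : c j ** c j = c j by rewrite {2 3}/c cmulA ca.
have cc' i j : c i ** c j = c j ** c i by exact: cc.
have fc j : f ** c j = c j by rewrite /c cmulA fa.
have rP m : [/\ projection (r m), f ** r m = r m, forall j, r m ** c j = c j ** r m,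
    approximable_corner (r m + p) & forall j, (j < m)%N -> r m ** a j = a j].
  elim: m => [|m].
    split; [exact: proj0|exact: cmulx0| |by rewrite add0r|by []].
    by move=> j; rewrite cmul0x cmulx0.
  rewrite [r m.+1]/=; set s := r m; move=> [ps fs sc' aps sa].
  have [ss s2] := ps.
  have sf' : s ** f = s by rewrite -[LHS]starK starM sf ss fs.
  have sp' : s ** p = 0 by rewrite -sf' -cmulA fp cmulx0.
  have ps' : p ** s = 0 by rewrite -fs cmulA pf0 cmul0x.
  have pa j : p ** a j = 0 by rewrite -fa cmulA pf0 cmul0x.
  have as' j : a j ** s = 0 by rewrite -ap -cmulA ps' cmulx0.
  have scs j : s ** c j ** s = s ** c j by rewrite -cmulA -sc' cmulA s2.
  have sca j : c j ** s ** a j = s ** a j by rewrite -sc' -cmulA ca.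
  split.
  - split; first by rewrite starD starB starM ss sc sc'.
    transitivity (s ** s + (s ** c m - s ** s ** c m + c m ** s + c m ** c m
      - c m ** s ** c m - s ** c m ** s - s ** (c m ** c m) + s ** c m ** s ** c m)).
      by nuring.
    rewrite s2 c2 scs -!sc' -(cmulA s (c m) (c m)) c2; by nuring.
  - by rewrite cmulDr cmulBr cmulA fs fc.
  - move=> j; have h : s ** c m ** c j = c j ** (s ** c m).
      by rewrite -cmulA cc' cmulA sc' -cmulA.
    by rewrite cmulDl cmulBl cmulDr cmulBr h (sc' j) (cc' m j).
  (* The increment c_m - s c_m is the range projection of x = (1 - s) a_m, whose source lies under
     p. *)
  - pose x := a m - s ** a m.
    have sx : star x = star (a m) - star (a m) ** s by rewrite starB starM ss.
    have xx : x ** star x = c m - s ** c m.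
      transitivity (c m - c m ** s - s ** c m + s ** c m ** s).
        by rewrite sx /x /c; nuring.
      by rewrite scs -sc'; nuring.
    have -> : s + (c m - s ** c m) + p = (s + p) + x ** star x by rewrite xx; nuring.
    apply: approximable_add_range => //.
    + exact: projection_add.
    + by rewrite /x cmulDl !cmulBr pa !cmulA s2 ps' cmul0x !subrr addr0.
    + by rewrite /x cmulDr !cmulBl as' -!cmulA as' cmulx0 ap subrr add0r.
    + rewrite xx /x; transitivity (c m ** a m - c m ** s ** a m - s ** (c m ** a m)
        + s ** (c m ** s ** a m)); first by nuring.
      by rewrite ca sca cmulA s2; nuring.
  move=> j; rewrite ltnS leq_eqVlt => /orP[/eqP->|jm].
    by rewrite cmulDl cmulBl -cmulA ca; nuring.
  rewrite cmulDl cmulBl sa // sc' -cmulA sa // subrr addr0 //.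
by exists r; split=> [m|m|m|j m]; have [? ? ? ? h] := rP m; first [by []|exact: h].
Qed.

End RangeSupremum.

(** * Spanning elements and vertex projections of a Cuntz-Krieger family *)

Section Graph.
Variables (k : nat) (L : kgraph k) (R : realType) (A : cstarAlgType R) (t : L -> A).
Implicit Types (mu nu la : L) (v : vert L).

(** Both identities give factorisations of [la] into degrees 0 and 0, and these coincide by
    uniqueness. *)
Lemma deg0_idm la : deg la = 0 -> la = idm (rng la).
Proof.
move=> d0; have [p [_ uniq_p]] := factorisation (la := la) (m := 0) (n := 0) (etrans d0 (esym (addr0 _))).
have e1 : p = (la, idm (src la)).
  by apply: uniq_p; split; rewrite ?deg_idm ?rng_idm ?comp_idr.
have e2 : p = (idm (rng la), la).
  by apply: uniq_p; split; rewrite ?deg_idm ?src_idm ?comp_idl.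
by move: e1; rewrite e2 => -[].
Qed.

Lemma deg_comp_eq mu la : src mu = rng la -> deg (Defs.comp mu la) = deg mu ->
  la = idm (src mu).
Proof.
move=> ml; rewrite deg_comp // => d; rewrite ml; apply: deg0_idm.
apply/ffunP => i; have /eqP := congr1 (fun e : {ffun 'I_k -> nat} => e i) d.
by rewrite !ffunE -[X in _ == X]addn0 eqn_add2l => /eqP.
Qed.

(** Comparing degrees, both components have degree 0. With (CK3) this makes every [t mu] a partial
    isometry with source projection [t (idm (src mu))]. *)
Lemma MCE_pairs_diag mu : MCE_pairs mu mu = [set (idm (src mu), idm (src mu))].
Proof.
have join2 : deg_join (deg mu) (deg mu) = deg mu.
  by apply/ffunP => i; rewrite ffunE maxnn.
apply/seteqP; split=> [[al be] [/= h1 h2 h3]|_ ->].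
  rewrite join2 => h4; rewrite (deg_comp_eq h1 h4); congr (_, _).
  by apply: (deg_comp_eq h2); rewrite -h3.
by split; rewrite /= ?rng_idm ?comp_idr.
Qed.

Hypothesis tCK : CK_family t.

Lemma ck_vertex_projection v : projection (t (idm v)).
Proof. by split; [exact: CK1_star tCK v|exact: CK1_idem tCK v]. Qed.

Lemma ck_src mu : t mu ** t (idm (src mu)) = t mu.
Proof. by rewrite (CK2 tCK) ?rng_idm ?comp_idr. Qed.

Lemma ck_rng mu : t (idm (rng mu)) ** t mu = t mu.
Proof. by rewrite (CK2 tCK) ?src_idm ?comp_idl. Qed.

Lemma ck_isometry mu : star (t mu) ** t mu = t (idm (src mu)).
Proof.
rewrite (CK3 tCK) MCE_pairs_diag fsbig_set1 /=.
by rewrite (CK1_star tCK) (CK1_idem tCK).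
Qed.

(** The list is the finite support over which the set-indexed sum of (CK3) is taken. *)
Lemma CK3_support mu nu : exists s : seq (L * L),
  (forall p, p \in s -> MCE_pairs mu nu p) /\
  star (t mu) ** t nu = \sum_(p <- s) (t p.1 ** star (t p.2)).
Proof.
rewrite (CK3 tCK); eexists; split; last by [].
by move=> p; case: finite_supportP => // X XM _ _; exact: XM.
Qed.

(* By (CK3) the product is a sum of the self-adjoint elements [t la ** star (t la)]
   with [la] in MCE(mu, nu). *)
Lemma ck_ranges_commute mu nu :
  t mu ** star (t mu) ** (t nu ** star (t nu)) =
  t nu ** star (t nu) ** (t mu ** star (t mu)).
Proof.
have <- : star (t mu ** star (t mu) ** (t nu ** star (t nu))) =
    t nu ** star (t nu) ** (t mu ** star (t mu)) by rewrite !starM !starK.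
have [s [sM smn]] := CK3_support mu nu.
have -> : t mu ** star (t mu) ** (t nu ** star (t nu)) =
    \sum_(p <- s) t (Defs.comp mu p.1) ** star (t (Defs.comp mu p.1)).
  rewrite -cmulA (cmulA (star _)) smn cmul_suml cmul_sumr.
  apply: eq_big_seq => p /sM[h1 h2 h3 _].
  rewrite {2}h3 -(CK2 tCK h1) -(CK2 tCK h2) starM !cmulA //.
by rewrite star_sum; apply: eq_bigr => p _; rewrite starM starK.
Qed.

Lemma closure_subalgebra S : linear_subspace S ->
  (forall x y : A, S x -> S y -> S (x ** y)) -> (forall x, S x -> S (star x)) ->
  cstar_subalgebra (closure S).
Proof.
move=> sS SM SV.
have cl0 x : closure S x -> forall e : R, 0 < e -> exists2 y, S y & nrm (x - y) < e.
  by move/closureP.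
split.
- by apply: subset_closure; exact: subspace0.
- move=> x y /cl0 Sx /cl0 Sy; apply/closureP => e e0.
  have e2 : 0 < e / 2 by rewrite divr_gt0.
  have [x' Sx' xx'] := Sx _ e2; have [y' Sy' yy'] := Sy _ e2.
  exists (x' + y'); first exact: subspaceD.
  rewrite opprD addrACA; apply: le_lt_trans (nrmD _ _) _; lra.
- move=> c x /cl0 Sx; apply/closureP => e e0.
  have c1 : 0 < cabs c + 1 by rewrite ltr_wpDl ?cabs_ge0.
  have [y Sy xy] := Sx _ (divr_gt0 e0 c1).
  exists (c *: y); first exact: subspaceZ.
  rewrite -scalerBr nrmZ; move: xy; rewrite ltr_pdivlMr //.
  have := nrm_ge0 (x - y); have := cabs_ge0 c; nra.
- move=> x y /cl0 Sx /cl0 Sy; apply/closureP => e e0.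
  have y1 : 0 < 2 * (nrm y + 1) by rewrite mulr_gt0 // ltr_wpDl ?nrm_ge0.
  have [x' Sx' xx'] := Sx _ (divr_gt0 e0 y1).
  (* [y'] is chosen after [x'], whose norm enters its tolerance. *)
  have x1 : 0 < 2 * (nrm x' + 1) by rewrite mulr_gt0 // ltr_wpDl ?nrm_ge0.
  have [y' Sy' yy'] := Sy _ (divr_gt0 e0 x1).
  exists (x' ** y'); first exact: SM.
  have -> : x ** y - x' ** y' = (x - x') ** y + x' ** (y - y') by nuring.
  move: xx' yy'; rewrite !ltr_pdivlMr // => xx' yy'.
  have := nrmD ((x - x') ** y) (x' ** (y - y')).
  have := nrmM (x - x') y; have := nrmM x' (y - y').
  have := nrm_ge0 (x - x'); have := nrm_ge0 (y - y'); nra.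
- move=> x /cl0 Sx; apply/closureP => e /Sx[y Sy xy].
  by exists (star y); [exact: SV|rewrite -starB nrm_star].
exact: closed_closure.
Qed.

Hypothesis tgen : forall B : set A,
  cstar_subalgebra B -> (forall la, B (t la)) -> B = [set: A].

(** By (CK3) the span of the t_mu t_nu* is closed under products, so its closure is a C*-subalgebra;
    it contains each t_la, which is t_la times the projection of its source. *)
Lemma ck_dense S : linear_subspace S -> closed S ->
  (forall mu nu, S (t mu ** star (t nu))) -> forall x, S x.
Proof.
move=> sS cS Sgen.
(* The span, as the intersection of all subspaces containing the generators: each closure property
   then follows by minimality. *)
pose B : set A := [set x | forall S', linear_subspace S' ->
  (forall mu nu, S' (t mu ** star (t nu))) -> S' x].
have sB : linear_subspace B.
  split=> [S' sS' _|x y Bx By S' sS' S'g|c x Bx S' sS' S'g].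
  - exact: subspace0.
  - by apply: subspaceD; [|exact: Bx|exact: By].
  - by apply: subspaceZ => //; exact: Bx.
have Bgen mu nu : B (t mu ** star (t nu)) by move=> S' _; exact.
have Bmin S' : linear_subspace S' -> (forall mu nu, S' (t mu ** star (t nu))) -> B `<=` S'.
  by move=> sS' S'g x; exact.
have BM x y : B x -> B y -> B (x ** y).
  move=> Bx By; move: x Bx; apply: (Bmin) => /=.
    split=> [|x x'|c x] /=; rewrite ?cmul0x ?cmulDl ?cmulZl.
    - exact: subspace0.
    - exact: subspaceD.
    - exact: subspaceZ.
  move=> mu nu; move: y By; apply: (Bmin) => /=.
    split=> [|x x'|c x] /=; rewrite ?cmulx0 ?cmulDr ?cmulZr.
    - exact: subspace0.
    - exact: subspaceD.
    - exact: subspaceZ.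
  move=> si ta; have [s [sM ->]] : exists s : seq (L * L), (forall p, p \in s -> MCE_pairs nu si p) /\
      t mu ** star (t nu) ** (t si ** star (t ta)) =
      \sum_(p <- s) t mu ** (t p.1 ** star (t p.2)) ** star (t ta).
    have [s [sM smn]] := CK3_support nu si; exists s; split=> //.
    by rewrite -cmulA (cmulA (star _)) smn cmul_suml cmul_sumr;
      apply: eq_bigr => p _; rewrite !cmulA.
  apply: (subspace_sum _ sB) => p _.
  (* The pair [p] is composable with nu and si but perhaps not with mu and ta; a term that is not
     composable vanishes. *)
  have prod0 al be : src al <> rng be -> t al ** t be = 0.
    move=> ne; rewrite -(ck_src al) -(ck_rng be) -cmulA (cmulA (t (idm _))).
    by rewrite (CK1_orth tCK ne) cmul0x cmulx0.
  have [h1|h1] := pselect (src mu = rng p.1); last first.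
    by rewrite (cmulA (t mu)) (prod0 _ _ h1) !cmul0x; exact: subspace0.
  have [h2|h2] := pselect (src ta = rng p.2); last first.
    by rewrite -cmulA -(cmulA _ (star _)) -starM (prod0 _ _ h2) star0 !cmulx0; exact: subspace0.
  by rewrite -cmulA -(cmulA _ (star _)) -starM (CK2 tCK h2) cmulA (CK2 tCK h1).
have BV x : B x -> B (star x).
  move: x; apply: (Bmin) => /=.
    split=> [|x x'|c x] /=; rewrite ?star0 ?starD ?starZ.
    - exact: subspace0.
    - exact: subspaceD.
    - exact: subspaceZ.
  by move=> mu nu; rewrite starM starK.
have clB := closure_subalgebra sB BM BV.
have clBT : closure B = [set: A].
  apply: tgen => // la; apply: subset_closure; rewrite -(ck_src la) -(CK1_star tCK).
  exact: Bgen.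
move=> x; have /closureP Bx : closure B x by rewrite clBT.
apply: closed_approx => // e /Bx[y By xy]; exists y => //.
exact: (Bmin S).
Qed.

Definition vertex_sum (F : seq (vert L)) : A := \sum_(v <- F) t (idm v).

Lemma vertex_sum_idm F v : uniq F ->
  vertex_sum F ** t (idm v) = if v \in F then t (idm v) else 0.
Proof.
elim: F => [|w F IH] /=; rewrite /vertex_sum ?big_nil ?cmul0x // => /andP[wF uF].
rewrite big_cons cmulDl -/(vertex_sum F) IH // inE eq_sym.
case: eqVneq => [<-|/eqP wv] /=; first by rewrite (negPf wF) (CK1_idem tCK) addr0.
by rewrite (CK1_orth tCK wv) add0r.
Qed.

Lemma vertex_sum_mor F mu : uniq F ->
  vertex_sum F ** t mu = if rng mu \in F then t mu else 0.
Proof.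
move=> uF; rewrite -(ck_rng mu) cmulA vertex_sum_idm //.
by case: ifP => _; rewrite ?ck_rng ?cmul0x.
Qed.

Lemma vertex_sum_sub F G : uniq G -> {subset F <= G} ->
  vertex_sum G ** vertex_sum F = vertex_sum F.
Proof.
move=> uG FG; rewrite {2 3}/vertex_sum cmul_sumr; apply: eq_big_seq => v vF.
by rewrite vertex_sum_idm // FG.
Qed.

Lemma vertex_sum_projection F : uniq F -> projection (vertex_sum F).
Proof.
move=> uF; split; last exact: vertex_sum_sub.
by rewrite star_sum; apply: eq_bigr => v _; exact: CK1_star.
Qed.

(** Enumerates the spanning elements by the naturals; numbers that encode no pair give 0. *)
Definition ck_span (j : nat) : A :=
  if unpickle j is Some (mu, nu) then t mu ** star (t nu) else 0.

Lemma ck_span_dense S : linear_subspace S -> closed S -> (forall j, S (ck_span j)) ->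
  forall x, S x.
Proof.
move=> sS cS Sj; apply: ck_dense => // mu nu.
by have := Sj (pickle (mu, nu)); rewrite /ck_span pickleK.
Qed.

(** Compression keeps t_mu t_nu* or kills it, according to the ranges of mu and nu; a nonzero t_mu
    t_nu* has equal sources and is a partial isometry with range projection t_mu t_mu*. *)
Lemma ck_span_compress F v j (a := vertex_sum F ** ck_span j ** t (idm v)) : uniq F ->
  a = 0 \/ exists mu, [/\ a ** star a = t mu ** star (t mu), a ** star a ** a = a &
     vertex_sum F ** a = a /\ a ** t (idm v) = a].
Proof.
move=> uF; rewrite /a /ck_span; case: unpickle => [[mu nu]|]; last first.
  by left; rewrite cmulx0 cmul0x.
have pv := ck_vertex_projection v.
have nv : star (t nu) ** t (idm v) = if rng nu == v then star (t nu) else 0.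
  rewrite -{1}(ck_rng nu) starM (CK1_star tCK) -cmulA.
  case: eqVneq => [<-|/eqP rv]; last by rewrite (CK1_orth tCK rv) cmulx0.
  by rewrite (CK1_idem tCK) -{1}(CK1_star tCK) -starM ck_rng.
have -> : vertex_sum F ** (t mu ** star (t nu)) ** t (idm v) =
    (if rng mu \in F then t mu else 0) ** (if rng nu == v then star (t nu) else 0).
  by rewrite cmulA vertex_sum_mor // -cmulA nv.
case: ifP => [muF|_]; last by left; rewrite cmul0x.
case: ifP => [nuv|_]; last by left; rewrite cmulx0.
have [sv|/eqP sv] := eqVneq (src mu) (src nu); last first.
  left; rewrite -(ck_src mu) -(ck_src nu) starM (CK1_star tCK) cmulA -(cmulA (t mu)).
  by rewrite (CK1_orth tCK sv) cmulx0 !cmul0x.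
have nn : star (t nu) ** t nu = t (idm (src nu)) by exact: ck_isometry.
have aa : t mu ** star (t nu) ** star (t mu ** star (t nu)) = t mu ** star (t mu).
  by rewrite starM starK cmulA -(cmulA (t mu)) nn -sv ck_src.
right; exists mu; rewrite aa cmulA -(cmulA (t mu)) ck_isometry ck_src; split=> //.
by rewrite cmulA vertex_sum_mor // muF -cmulA nv nuv.
Qed.

Lemma vertex_sum_approximable F : (forall v, AF (corner (t (idm v)))) -> uniq F ->
  approximable_corner (vertex_sum F).
Proof.
move=> cAF; elim: F => [_|v F IH /= /andP[vF uF]].
  (* The empty sum is the projection 0, whose corner is the zero algebra. *)
  exists (fun=> lspan [:: 0]); split=> [n|x e e0].
    rewrite /vertex_sum big_nil; split.
    - exact/fd_algebra_line/proj0.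
    - by apply: lspan_mem; rewrite mem_head.
    - exact/line_in_corner/proj0.
  exists 0%N => n _; exists 0; first by apply: lspan_mem; rewrite mem_head.
  by rewrite /vertex_sum big_nil cmulx0 subrr nrm0.
have -> : vertex_sum (v :: F) = vertex_sum F + t (idm v).
  by rewrite /vertex_sum big_cons addrC.
have pF := vertex_sum_projection uF; have pv := ck_vertex_projection v.
have Fv : vertex_sum F ** t (idm v) = 0 by rewrite vertex_sum_idm // (negPf vF).
pose a j := vertex_sum F ** ck_span j ** t (idm v).
have aP j : a j ** star (a j) ** a j = a j /\ vertex_sum F ** a j = a j /\
    a j ** t (idm v) = a j.
  rewrite /a; have [->|[mu [_ ? [? ?]]]] := ck_span_compress v j uF; last by [].
  by rewrite !(cmulx0, cmul0x).
have acc i j : a i ** star (a i) ** (a j ** star (a j)) =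
    a j ** star (a j) ** (a i ** star (a i)).
  have [ai|[mu [mui _ _]]] := ck_span_compress v i uF; first by rewrite /a ai !(cmulx0, cmul0x).
  have [aj|[nu [nuj _ _]]] := ck_span_compress v j uF; first by rewrite /a aj !(cmulx0, cmul0x).
  by rewrite /a mui nuj ck_ranges_commute.
have [r [pr fr rp ra]] := exists_range_supremum pF pv Fv (fun j => (aP j).2.1)
  (fun j => (aP j).2.2) (fun j => (aP j).1) acc (AF_approximable pv (cAF v)).
exact: (approximable_add pF pv Fv pr fr (IH uF) rp ck_span_dense).
Qed.

Definition first_vertices n : seq (vert L) := undup (pmap unpickle (iota 0 n)).

Lemma mem_first_vertices n v : (pickle v < n)%N -> v \in first_vertices n.
Proof.
move=> vn; rewrite mem_undup mem_pmap -(pickleK v); apply: map_f.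
by rewrite mem_iota.
Qed.

Lemma first_vertices_sub n m : (n <= m)%N -> {subset first_vertices n <= first_vertices m}.
Proof.
move=> nm v; rewrite !mem_undup !mem_pmap => /mapP[j + ->]; rewrite mem_iota => jn.
by apply: map_f; rewrite mem_iota (leq_trans jn).
Qed.

(** A diagonal choice: [K n] approximates the first n spanning elements compressed to the corner of
    [P n], and each spanning element eventually lies in that corner. *)
Lemma AF_of_vertex_corners : (forall v, AF (corner (t (idm v)))) -> AF [set: A].
Proof.
move=> cAF; pose P n := vertex_sum (first_vertices n).
have uF n : uniq (first_vertices n) by exact: undup_uniq.
have pP n : projection (P n) by exact: vertex_sum_projection.
have /choice[K KP] n : exists K, [/\ fd_algebra K, K (P n), K `<=` in_corner (P n) &
    forall j, (j < n)%N -> exists2 y, K y &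
      nrm (y - P n ** ck_span j ** P n) <= 2^-1 ^+ n].
  have [H [HP limH]] := vertex_sum_approximable cAF (uF n).
  have [|N hN] := @liminf_seq _ _ H [seq P n ** ck_span j ** P n | j <- iota 0 n] _
    (half_pow_gt0 R n); first by move=> _ /mapP[j _ ->]; exact: limH.
  exists (H N); have [? ? ?] := HP N; split=> // j jn; apply: hN => //.
  by apply: map_f; rewrite mem_iota.
apply: (AF_of_corners (P := P) (K := K)) => // [n m nm|n|].
- by apply: vertex_sum_sub => //; exact: first_vertices_sub.
- by have [] := KP n.
apply: ck_span_dense.
- by apply: liminf_subspace => n; have [fdK _ _ _] := KP n; exact: (cstar_subspace fdK.1).
- by apply: closedP => x; exact: liminf_closed.
move=> j e e0; have [N hN] := half_pow_small (@ler01 R) e0.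
have [M hM] : exists M, forall n, (M <= n)%N -> P n ** ck_span j ** P n = ck_span j.
  rewrite /ck_span; case: unpickle => [[mu nu]|]; last first.
    by exists 0%N => n _; rewrite cmulx0 cmul0x.
  (* [first_vertices n] contains the vertices with code below n, hence the successor. *)
  exists (maxn (pickle (rng mu)) (pickle (rng nu))).+1 => n; rewrite gtn_max => /andP[mn nn].
  rewrite cmulA vertex_sum_mor // mem_first_vertices // -cmulA.
  by rewrite -(pP n).1 -starM vertex_sum_mor // mem_first_vertices.
exists (maxn N (maxn M j.+1)) => n; rewrite !geq_max => /and3P[/hN ne /hM Pn jn].
have [_ _ _ /(_ j jn)[y Ky]] := KP n; rewrite Pn => yj.
exists y => //; rewrite nrmBC; apply: le_lt_trans yj _.
by rewrite exprVn -div1r.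
Qed.

End Graph.

(* [A] is C*(L), generated by the universal Cuntz-Krieger family [t]. *)
Theorem proposition4p1 (R : realType) (k : nat) (hk : (0 < k)%N)
    (L : kgraph k) (hL : finitely_aligned L)
    (A : cstarAlgType R) (t : L -> A) (ht : universal_CK_family t) :
  AF [set: A] <-> forall v : vert L, AF (corner (t (idm v))).
Proof.
have tCK := universal_CK ht; split=> [AFA v|].
  by apply: AF_corner AFA; exact: ck_vertex_projection.
exact: (AF_of_vertex_corners tCK (universal_CK_generates ht)).
Qed.
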